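(* Let $\mathcal R$ be a right bialgebroid over an algebra $A$. Then the category $\mathcal{YD}^{\mathcal R}_{\mathcal R}$ of right-right Yetter-Drinfeld modules of $\mathcal R$ is a pre-braided monoidal category. If $(\mathcal L,\mathcal R,S)$ is a Hopf algebroid, then the category $\mathcal{YD}^{\mathcal H}_{\mathcal R}$ of full right-right Yetter-Drinfeld modules of $(\mathcal L,\mathcal R,S)$ is a braided monoidal category.
   Context: All algebras are unital and associative over a field $k$. Left bialgebroid over $B$: an algebra $\mathcal L$ with algebra maps $s_L:B\to\mathcal L$, $t_L:B^{op}\to\mathcal L$ with commuting images and a coalgebra structure $(\Delta_L,\varepsilon_L)$ in $B$-bimodules for $b.X.c=s_L(b)t_L(c)X$ (so $t_L(b)X\otimes_BY=X\otimes_Bs_L(b)Y$), such that $\Delta_L$ is an algebra map into $\{\sum X_i\otimes_BY_i:\sum X_it_L(b)\otimes_BY_i=\sum X_i\otimes_BY_is_L(b)\ \forall b\in B\}$ with factorwise product, $\varepsilon_L(1)=1$, $\varepsilon_L(s_L(b)X)=b\varepsilon_L(X)$, $\varepsilon_L(Xs_L(\varepsilon_L(Y)))=\varepsilon_L(XY)=\varepsilon_L(Xt_L(\varepsilon_L(Y)))$. Write $\Delta_L(X)=X_{(1)}\otimes_BX_{(2)}$. Right bialgebroid over $A$: an algebra $\mathcal R$ with algebra maps $s_R:A\to\mathcal R$, $t_R:A^{op}\to\mathcal R$ with commuting images and a coalgebra structure $(\Delta_R,\varepsilon_R)$ in $A$-bimodules for $c\cdot X\cdot b=Xs_R(b)t_R(c)$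 (so $Xs_R(a)\otimes_AY=X\otimes_AYt_R(a)$), such that $\Delta_R$ is an algebra map into $\{\sum X_i\otimes_AY_i:\sum s_R(a)X_i\otimes_AY_i=\sum X_i\otimes_At_R(a)Y_i\ \forall a\in A\}$ with factorwise product, $\varepsilon_R(1)=1$, $\varepsilon_R(s_R(\varepsilon_R(X))Y)=\varepsilon_R(XY)=\varepsilon_R(t_R(\varepsilon_R(X))Y)$. Write $\Delta_R(X)=X_{[1]}\otimes_AX_{[2]}$. Hopf algebroid $\mathcal H=(\mathcal L,\mathcal R,S)$: a left bialgebroid $\mathcal L$ over $B$ with an invertible anti-algebra map $S:\mathcal L\to\mathcal L$ such that $S\circ t_L=s_L$, $(S^{-1}X_{(2)})_{(1)}\otimes_B(S^{-1}X_{(2)})_{(2)}X_{(1)}=S^{-1}(X)\otimes_B1$ and $S(X_{(1)})_{(1)}X_{(2)}\otimes_BS(X_{(1)})_{(2)}=1\otimes_BS(X)$; $\mathcal R$ is the right bialgebroid over $A=B^{op}$ with the same underlying algebra and $s_R=t_L$, $t_R=S^{-1}\circ t_L$, $\Delta_R(X)=S(S^{-1}(X)_{(2)})\otimes_AS(S^{-1}(X)_{(1)})$, $\varepsilon_R=\varepsilon_L\circ S$. Comodules (coactions coassociative and counital). Right $\mathcal R$-comodule: $A$-bimodule $\Gamma$ ($a\cdot\rho\cdot a'$) with $\delta_R(\rho)=\rho_{[0]}\otimes_A\rho_{[1]}\in\Gamma\otimes_A\mathcal R$ ($\rho\cdot a\otimes_AX=\rho\otimes_AXt_R(a)$), $\delta_R(a\cdot\rho\cdot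 a')=\rho_{[0]}\otimes_As_R(a)\rho_{[1]}s_R(a')$, image in $\{\sum\rho_i\otimes X_i:\sum a\cdot\rho_i\otimes X_i=\sum\rho_i\otimes t_R(a)X_i\ \forall a\}$. Right $\mathcal L$-comodule: $B$-bimodule $\Gamma$ ($b*\rho*b'$) with $\delta_L(\rho)=\rho_{(0)}\otimes_B\rho_{(1)}\in\Gamma\otimes_B\mathcal L$ ($\rho*b\otimes_BX=\rho\otimes_Bs_L(b)X$), $\delta_L(b*\rho*b')=\rho_{(0)}\otimes_Bt_L(b')\rho_{(1)}t_L(b)$, image in $\{\sum\rho_i\otimes X_i:\sum b*\rho_i\otimes X_i=\sum\rho_i\otimes X_is_L(b)\ \forall b\}$. Right $(\mathcal L,\mathcal R,S)$-comodule: a right $\mathcal L$- and right $\mathcal R$-comodule with $\delta_L(\rho\cdot a)=\rho_{(0)}\otimes_B\rho_{(1)}s_R(a)$, $\delta_R(\rho*b)=\rho_{[0]}\otimes_At_L(b)\rho_{[1]}$, $(\mathrm{id}\otimes\Delta_R)\delta_L=(\delta_L\otimes\mathrm{id})\delta_R$, $(\mathrm{id}\otimes\Delta_L)\delta_R=(\delta_R\otimes\mathrm{id})\delta_L$. Right-right Yetter-Drinfeld module of $\mathcal R$: a right $\mathcal R$-comodule and right $\mathcal R$-module $\Lambda$ (action $\blacktriangleleft$) with $\rho\blacktriangleleft s_R(a)=\rho\cdot a$, $\rho\blacktriangleleft t_R(a)=a\cdot\rho$ and $(\rho\blacktriangleleft X_{[2]})_{[0]}\otimes_AX_{[1]}(\rho\blacktriangleleft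 X_{[2]})_{[1]}=\rho_{[0]}\blacktriangleleft X_{[1]}\otimes_A\rho_{[1]}X_{[2]}$. A full right-right Yetter-Drinfeld module is one that is in addition a right $(\mathcal L,\mathcal R,S)$-comodule whose underlying right $\mathcal R$-comodule structure is the given one. Monoidal structure: $\Lambda^1\otimes_A\Lambda^2$ is balanced by $\eta^1\blacktriangleleft s_R(a)\otimes_A\eta^2=\eta^1\otimes_A\eta^2\blacktriangleleft t_R(a)$, with $(\eta^1\otimes_A\eta^2)\blacktriangleleft X=\eta^1\blacktriangleleft X_{[1]}\otimes_A\eta^2\blacktriangleleft X_{[2]}$, $\delta_R(\eta^1\otimes_A\eta^2)=\eta^1_{[0]}\otimes_A\eta^2_{[0]}\otimes_A\eta^1_{[1]}\eta^2_{[1]}$, and bimodule structure $a\cdot(\eta^1\otimes_A\eta^2)\cdot a'=a\cdot\eta^1\otimes_A\eta^2\cdot a'$; in the full case also $\delta_L(\eta^1\otimes_A\eta^2)=\eta^1_{(0)}\otimes_A\eta^2_{(0)}\otimes_B\eta^1_{(1)}\eta^2_{(1)}$ with $b'*(\eta^1\otimes_A\eta^2)*b=\eta^1*b\otimes_Ab'*\eta^2$. ''Pre-braided'' means braided except that the braiding morphisms need not be invertible. *)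

(* Defs.v *)
From HB Require Import structures.
From mathcomp Require Import all_boot all_order all_algebra.
From mathcomp Require Import boolp.

Set Implicit Arguments.
Unset Strict Implicit.
Unset Printing Implicit Defensive.

Import GRing.Theory.
Local Open Scope ring_scope.
Local Open Scope quotient_scope.

(* The opposite algebra B^op is the library's converse ring B^c. *)

HB.instance Definition _ (k : fieldType) (V : lmodType k) :=
  GRing.Lmodule.copy V^c V.

Section ConverseAlgebra.
Variables (k : fieldType) (A : algType k).

Fact converse_scalerAl (c : k) (x y : A^c) : c *: (x * y) = (c *: x : A^c) * y.
Proof. exact: (scalerAr c (y : A) x). Qed.

HB.instance Definition _ :=
  GRing.Lmodule_isLalgebra.Build k A^c converse_scalerAl.

Fact converse_scalerAr (c : k) (x y : A^c) : c *: (x * y) = x * (c *: y : A^c).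
Proof. exact: (scalerAl c (y : A) x). Qed.

HB.instance Definition _ :=
  GRing.Lalgebra_isAlgebra.Build k A^c converse_scalerAr.
End ConverseAlgebra.

(* tens f g is the quotient of M (x)_k N by the relations
   f m i (x) n = m (x) g i n, for i ranging over the index type I of scalars. *)

Section TensorProduct.
Variables (k : fieldType) (M N : lmodType k) (I : Type).
Variables (f : M -> I -> M) (g : I -> N -> N).

Definition formal_scale (c : k) (s : seq (M * N)) : seq (M * N) :=
  [seq (c *: p.1, p.2) | p <- s].

Inductive tens_rel : seq (M * N) -> seq (M * N) -> Prop :=
| tens_refl s : tens_rel s s
| tens_sym s u : tens_rel s u -> tens_rel u s
| tens_trans s u v : tens_rel s u -> tens_rel u v -> tens_rel s v
| tens_cat s s' u u' :
    tens_rel s s' -> tens_rel u u' -> tens_rel (s ++ u) (s' ++ u')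
| tens_scal c s s' :
    tens_rel s s' -> tens_rel (formal_scale c s) (formal_scale c s')
| tens_comm s u : tens_rel (s ++ u) (u ++ s)
| tens_0l n : tens_rel [:: (0, n)] [::]
| tens_Dl m m' n : tens_rel [:: (m + m', n)] [:: (m, n); (m', n)]
| tens_Dr m n n' : tens_rel [:: (m, n + n')] [:: (m, n); (m, n')]
| tens_Z c m n : tens_rel [:: (c *: m, n)] [:: (m, c *: n)]
| tens_bal m i n : tens_rel [:: (f m i, n)] [:: (m, g i n)].

Definition tens_relb (s u : seq (M * N)) : bool := `[< tens_rel s u >].

Fact tens_relb_equiv : equiv_class_of tens_relb.
Proof.
split=> [s|s u|u s v].
- exact/asboolP/tens_refl.
- by apply/asboolP/asboolP => /tens_sym.
- by move=> /asboolP su /asboolP uv; apply/asboolP; apply: tens_trans su uv.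
Qed.

Canonical tens_equiv := EquivRelPack tens_relb_equiv.

Definition tens : Type := {eq_quot tens_equiv}.

HB.instance Definition _ := Choice.on tens.
HB.instance Definition _ := EqQuotient.on tens.

Fact tensP (s u : seq (M * N)) :
  tens_rel s u <-> \pi_tens s = \pi_tens u.
Proof.
split=> [su|/eqmodP/asboolP //].
by apply/eqmodP/asboolP.
Qed.

Fact tensW (P : tens -> Prop) :
  (forall s, P (\pi_tens s)) -> forall x, P x.
Proof. by move=> Ppi x; rewrite -[x]reprK. Qed.

Fact tens_repr (s : seq (M * N)) : tens_rel (repr (\pi_tens s)) s.
Proof. by apply/tensP; rewrite reprK. Qed.

Definition tens_zero : tens := \pi_tens [::].
Definition tens_add (x y : tens) : tens := \pi_tens (repr x ++ repr y).
Definition tens_scale (c : k) (x : tens) : tens :=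
  \pi_tens (formal_scale c (repr x)).
Definition tens_opp (x : tens) : tens := tens_scale (- 1) x.

Fact tens_addE s u : tens_add (\pi_tens s) (\pi_tens u) = \pi_tens (s ++ u).
Proof. by apply/tensP/tens_cat; apply: tens_repr. Qed.

Fact tens_scaleE c s :
  tens_scale c (\pi_tens s) = \pi_tens (formal_scale c s).
Proof. by apply/tensP/tens_scal; apply: tens_repr. Qed.

Fact tens_addA : associative tens_add.
Proof.
move=> x y z; elim/tensW: x => x; elim/tensW: y => y; elim/tensW: z => z.
by rewrite !tens_addE catA.
Qed.

Fact tens_addC : commutative tens_add.
Proof.
move=> x y; elim/tensW: x => x; elim/tensW: y => y; rewrite !tens_addE.
exact/tensP/tens_comm.
Qed.

Fact tens_add0 : left_id tens_zero tens_add.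
Proof. by move=> x; elim/tensW: x => x; rewrite tens_addE. Qed.

Fact formal_scale_add a b s :
  tens_rel (formal_scale (a + b) s) (formal_scale a s ++ formal_scale b s).
Proof.
elim: s => [|p s IHs] /=; first exact: tens_refl.
apply: (@tens_trans _ ([:: (a *: p.1, p.2); (b *: p.1, p.2)]
                        ++ (formal_scale a s ++ formal_scale b s))).
  by rewrite -cat1s; apply: tens_cat => //; rewrite scalerDl; apply: tens_Dl.
rewrite -[_ :: (_ ++ _)]cat1s.
apply: (@tens_cat [:: _] _ (_ :: _)); first exact: tens_refl.
rewrite -cat1s -[(b *: p.1, p.2) :: formal_scale b s]cat1s !catA.
by apply: tens_cat; [apply: tens_comm | apply: tens_refl].
Qed.

Fact formal_scale0 s : tens_rel (formal_scale 0 s) [::].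
Proof.
elim: s => [|p s IHs] /=; first exact: tens_refl.
rewrite -cat1s -[[::]]/([::] ++ [::]); apply: tens_cat => //.
by rewrite scale0r; apply: tens_0l.
Qed.

Fact formal_scale1 s : formal_scale 1 s = s.
Proof. by elim: s => //= -[m n] s ->; rewrite scale1r. Qed.

Fact tens_addN : left_inverse tens_zero tens_opp tens_add.
Proof.
move=> x; elim/tensW: x => x; rewrite /tens_opp tens_scaleE tens_addE; apply/tensP.
rewrite -{2}[x]formal_scale1.
apply: (tens_trans (tens_sym (formal_scale_add _ _ _))).
by rewrite addNr; apply: formal_scale0.
Qed.

HB.instance Definition _ :=
  GRing.isZmodule.Build tens tens_addA tens_addC tens_add0 tens_addN.

Fact tens_scaleA a b (v : tens) :
  tens_scale a (tens_scale b v) = tens_scale (a * b) v.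
Proof.
elim/tensW: v => s; rewrite !tens_scaleE /formal_scale -map_comp.
by congr (\pi_tens _); apply: eq_map => p /=; rewrite scalerA.
Qed.

Fact tens_scale1 : left_id 1 tens_scale.
Proof. by move=> s; elim/tensW: s => s; rewrite tens_scaleE formal_scale1. Qed.

Fact tens_scaleDr : right_distributive tens_scale +%R.
Proof.
move=> c x y; elim/tensW: x => x; elim/tensW: y => y; rewrite /GRing.add /=.
by rewrite tens_addE !tens_scaleE tens_addE /formal_scale map_cat.
Qed.

Fact tens_scaleDl (v : tens) : {morph tens_scale^~ v : a b / a + b}.
Proof.
move=> a b; elim/tensW: v => s; rewrite [RHS]/GRing.add /=.
by rewrite !tens_scaleE tens_addE; apply/tensP/formal_scale_add.
Qed.

HB.instance Definition _ :=
  GRing.Zmodule_isLmodule.Build k tens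
    tens_scaleA tens_scale1 tens_scaleDr tens_scaleDl.

Definition tpure (m : M) (n : N) : tens := \pi_tens [:: (m, n)].

(* tsum t F evaluates sum_i F m_i n_i for a chosen expression
   t = sum_i m_i (x) n_i, as in Sweedler's notation. Every expression below of
   this form is independent of the chosen expression of t, either because F is
   balanced or because t lies in a Takeuchi-type subspace. *)
Definition tsum (V : zmodType) (t : tens) (F : M -> N -> V) : V :=
  \sum_(p <- repr t) F p.1 p.2.

Fact pi_tensE s : \pi_tens s = \sum_(p <- s) tpure p.1 p.2.
Proof.
elim: s => [|[m n] s IHs]; first by rewrite big_nil.
by rewrite big_cons -IHs /tpure [RHS]/GRing.add /= tens_addE.
Qed.

Fact tsum_tpure (t : tens) : tsum t tpure = t.
Proof. by rewrite /tsum -pi_tensE reprK. Qed.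

Section Lift.
Variables (V : lmodType k) (F : M -> N -> V).
Hypotheses (F_Dl : forall m m' n, F (m + m') n = F m n + F m' n)
  (F_Dr : forall m n n', F m (n + n') = F m n + F m n')
  (F_Zl : forall c m n, F (c *: m) n = c *: F m n)
  (F_Zr : forall c m n, F m (c *: n) = c *: F m n)
  (F_bal : forall m i n, F (f m i) n = F m (g i n)).

Fact tens_rel_sum s u : tens_rel s u ->
  \sum_(p <- s) F p.1 p.2 = \sum_(p <- u) F p.1 p.2.
Proof.
elim=> {s u}.
- by [].
- by move=> s u _ ->.
- by move=> s u v _ -> _ ->.
- by move=> s s' u u' _ ss' _ uu'; rewrite !big_cat /= ss' uu'.
- move=> c s s' _ ss'; rewrite !big_map /=.
  under eq_bigr do rewrite F_Zl; under [RHS]eq_bigr do rewrite F_Zl.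
  by rewrite -!scaler_sumr ss'.
- by move=> s u; rewrite !big_cat /= addrC.
- by move=> n; rewrite big_seq1 big_nil -[X in F X](scale0r 0) F_Zl scale0r.
- by move=> m m' n; rewrite !big_cons !big_nil !addr0 F_Dl.
- by move=> m n n'; rewrite !big_cons !big_nil !addr0 F_Dr.
- by move=> c m n; rewrite !big_seq1 F_Zl F_Zr.
- by move=> m i n; rewrite !big_seq1 F_bal.
Qed.

Fact tsumE s : tsum (\pi_tens s) F = \sum_(p <- s) F p.1 p.2.
Proof. exact/tens_rel_sum/tens_repr. Qed.

Fact tsum_pure m n : tsum (tpure m n) F = F m n.
Proof. by rewrite tsumE big_seq1. Qed.

Fact tsumD t t' : tsum (t + t') F = tsum t F + tsum t' F.
Proof.
elim/tensW: t => s; elim/tensW: t' => u.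
by rewrite [X in tsum X]/GRing.add /= tens_addE !tsumE big_cat.
Qed.

Fact tsum0 : tsum 0 F = 0.
Proof. by rewrite [X in tsum X]/GRing.zero /= tsumE big_nil. Qed.

Fact tsum_sum (T : Type) (r : seq T) (G : T -> tens) :
  tsum (\sum_(i <- r) G i) F = \sum_(i <- r) tsum (G i) F.
Proof.
elim: r => [|i r IHr]; first by rewrite !big_nil tsum0.
by rewrite !big_cons tsumD IHr.
Qed.
End Lift.

Fact tpureDl m m' n : tpure (m + m') n = tpure m n + tpure m' n.
Proof. by rewrite [RHS]/GRing.add /= tens_addE; apply/tensP/tens_Dl. Qed.

Fact tpureDr m n n' : tpure m (n + n') = tpure m n + tpure m n'.
Proof. by rewrite [RHS]/GRing.add /= tens_addE; apply/tensP/tens_Dr. Qed.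

Fact tpureZl c m n : tpure (c *: m) n = c *: tpure m n.
Proof. by rewrite [RHS]/GRing.scale /= tens_scaleE. Qed.

Fact tpureZr c m n : tpure m (c *: n) = c *: tpure m n.
Proof. by rewrite -tpureZl; apply/tensP/tens_sym/tens_Z. Qed.

Fact tpure_bal m i n : tpure (f m i) n = tpure m (g i n).
Proof. exact/tensP/tens_bal. Qed.
End TensorProduct.

Arguments tpure {k M N I f g} m n.

Notation "x ⊗ y" := (tpure x y) (at level 35, no associativity).
Notation "'\tsum_(' x , y <- t ) F" := (tsum t (fun x y => F))
  (at level 41, F at level 41, x binder, y binder, t at level 50,
   format "'[' '\tsum_(' x ,  y  <-  t ) '/  '  F ']'").

Section Modules.
Variable k : fieldType.

Definition is_bilinear (U V W : lmodType k) (op : U -> V -> W) : Prop :=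
  (forall u, linear (op u)) /\ (forall v, linear (op^~ v)).

Record is_right_module (A : algType k) (M : lmodType k) (op : M -> A -> M) :
    Prop := {
  rmod_bilinear : is_bilinear op;
  rmod_1 : forall m, op m 1 = m;
  rmod_M : forall m a b, op m (a * b) = op (op m a) b }.

Record is_left_module (A : algType k) (M : lmodType k) (op : A -> M -> M) :
    Prop := {
  lmod_bilinear : is_bilinear op;
  lmod_1 : forall m, op 1 m = m;
  lmod_M : forall m a b, op (a * b) m = op a (op b m) }.

Record is_bimodule (A : algType k) (M : lmodType k)
    (l : A -> M -> M) (r : M -> A -> M) : Prop := {
  bimod_left : is_left_module l;
  bimod_right : is_right_module r;
  bimod_comm : forall a m b, r (l a m) b = l a (r m b) }.
End Modules.

Section LeftBialgebroid.
Variables (k : fieldType) (B L : algType k).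

(* M (x)_B L with (m * b) (x) X = m (x) s(b) X, and the right B-action
   m (x) t(b) X used to form (M (x)_B L) (x)_B L. *)
Definition ltensor (s : B -> L) (M : lmodType k) (r : M -> B -> M) :
    lmodType k :=
  tens r (fun b X => s b * X).

Definition ltensor_ract (s t : B -> L) (M : lmodType k) (r : M -> B -> M)
    (u : ltensor s r) (b : B) : ltensor s r :=
  \tsum_(m, X <- u) m ⊗ (t b * X).

Record left_bialgebroid : Type := LeftBialgebroid {
  sL : {lrmorphism B -> L};
  tL : {lrmorphism B^c -> L};
  sL_tL_comm : forall b c : B, sL b * tL c = tL c * sL b;
  DeltaL : {linear L -> ltensor sL (fun X (b : B) => tL b * X)};
  epsL : {linear L -> B};
  DeltaL_bimod : forall (b c : B) (X : L),
    DeltaL (sL b * tL c * X) =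
      \tsum_(X1, X2 <- DeltaL X) (sL b * X1) ⊗ (tL c * X2);
  epsL_bimod : forall (b c : B) (X : L),
    epsL (sL b * tL c * X) = b * epsL X * c;
  DeltaL_coassoc : forall X : L,
    (\tsum_(X1, X2 <- DeltaL X) (DeltaL X1) ⊗ X2
       : ltensor sL (ltensor_ract (s := sL) tL (r := _))) =
    \tsum_(X1, X2 <- DeltaL X) \tsum_(Y, Z <- DeltaL X2) (X1 ⊗ Y) ⊗ Z;
  DeltaL_counitl : forall X : L,
    \tsum_(X1, X2 <- DeltaL X) sL (epsL X1) * X2 = X;
  DeltaL_counitr : forall X : L,
    \tsum_(X1, X2 <- DeltaL X) tL (epsL X2) * X1 = X;
  DeltaL_takeuchi : forall (b : B) (X : L),
    \tsum_(X1, X2 <- DeltaL X) (X1 * tL b) ⊗ X2 =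
    \tsum_(X1, X2 <- DeltaL X) X1 ⊗ (X2 * sL b)
      :> ltensor sL (fun X (b : B) => tL b * X);
  DeltaL_1 : DeltaL 1 = 1 ⊗ 1;
  DeltaL_M : forall X Y : L,
    DeltaL (X * Y) =
      \tsum_(X1, X2 <- DeltaL X) \tsum_(Y1, Y2 <- DeltaL Y)
        (X1 * Y1) ⊗ (X2 * Y2);
  epsL_1 : epsL 1 = 1;
  epsL_sL : forall (b : B) (X : L), epsL (sL b * X) = b * epsL X;
  epsL_Ms : forall X Y : L, epsL (X * sL (epsL Y)) = epsL (X * Y);
  epsL_Mt : forall X Y : L, epsL (X * tL (epsL Y)) = epsL (X * Y) }.
End LeftBialgebroid.

Section RightBialgebroid.
Variables (k : fieldType) (A R : algType k).

(* M (x)_A R with (m . a) (x) X = m (x) X t(a), and the right A-action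
   m (x) X s(a) used to form (M (x)_A R) (x)_A R. *)
Definition rtensor (t : A -> R) (M : lmodType k) (r : M -> A -> M) :
    lmodType k :=
  tens r (fun a X => X * t a).

Definition rtensor_ract (s t : A -> R) (M : lmodType k) (r : M -> A -> M)
    (u : rtensor t r) (a : A) : rtensor t r :=
  \tsum_(m, X <- u) m ⊗ (X * s a).

Record right_bialgebroid : Type := RightBialgebroid {
  sR : {lrmorphism A -> R};
  tR : {lrmorphism A^c -> R};
  sR_tR_comm : forall a b : A, sR a * tR b = tR b * sR a;
  DeltaR : {linear R -> rtensor tR (fun X (a : A) => X * sR a)};
  epsR : {linear R -> A};
  DeltaR_bimod : forall (c b : A) (X : R),
    DeltaR (X * sR b * tR c) =
      \tsum_(X1, X2 <- DeltaR X) (X1 * tR c) ⊗ (X2 * sR b);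
  epsR_bimod : forall (c b : A) (X : R),
    epsR (X * sR b * tR c) = c * epsR X * b;
  DeltaR_coassoc : forall X : R,
    (\tsum_(X1, X2 <- DeltaR X) (DeltaR X1) ⊗ X2
       : rtensor tR (rtensor_ract sR (t := tR) (r := _))) =
    \tsum_(X1, X2 <- DeltaR X) \tsum_(Y, Z <- DeltaR X2) (X1 ⊗ Y) ⊗ Z;
  DeltaR_counitl : forall X : R,
    \tsum_(X1, X2 <- DeltaR X) X2 * tR (epsR X1) = X;
  DeltaR_counitr : forall X : R,
    \tsum_(X1, X2 <- DeltaR X) X1 * sR (epsR X2) = X;
  DeltaR_takeuchi : forall (a : A) (X : R),
    \tsum_(X1, X2 <- DeltaR X) (sR a * X1) ⊗ X2 =
    \tsum_(X1, X2 <- DeltaR X) X1 ⊗ (tR a * X2)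
      :> rtensor tR (fun X (a : A) => X * sR a);
  DeltaR_1 : DeltaR 1 = 1 ⊗ 1;
  DeltaR_M : forall X Y : R,
    DeltaR (X * Y) =
      \tsum_(X1, X2 <- DeltaR X) \tsum_(Y1, Y2 <- DeltaR Y)
        (X1 * Y1) ⊗ (X2 * Y2);
  epsR_1 : epsR 1 = 1;
  epsR_sM : forall X Y : R, epsR (sR (epsR X) * Y) = epsR (X * Y);
  epsR_tM : forall X Y : R, epsR (tR (epsR X) * Y) = epsR (X * Y) }.
End RightBialgebroid.

Section HopfAlgebroid.
Variables (k : fieldType) (B H : algType k).

Record hopf_algebroid : Type := HopfAlgebroid {
  hopfL : left_bialgebroid B H;
  hopfR : right_bialgebroid B^c H;
  antipode : {lrmorphism H -> H^c};
  antipodeV : H -> H;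
  antipodeK : cancel antipode antipodeV;
  antipodeVK : cancel antipodeV antipode;
  antipode_tL : forall b : B, antipode (tL hopfL b) = sL hopfL b;
  antipodeV_Delta : forall X : H,
    \tsum_(X1, X2 <- DeltaL hopfL X)
      \tsum_(Y, Z <- DeltaL hopfL (antipodeV X2)) Y ⊗ (Z * X1) =
    antipodeV X ⊗ 1 :> ltensor (sL hopfL) (fun X (b : B) => tL hopfL b * X);
  antipode_Delta : forall X : H,
    \tsum_(X1, X2 <- DeltaL hopfL X)
      \tsum_(Y, Z <- DeltaL hopfL (antipode X1)) (Y * X2) ⊗ Z =
    1 ⊗ antipode X :> ltensor (sL hopfL) (fun X (b : B) => tL hopfL b * X);
  hopf_sR : forall b : B, sR hopfR b = tL hopfL b;
  hopf_tR : forall b : B, tR hopfR b = antipodeV (tL hopfL b);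
  hopf_DeltaR : forall X : H,
    DeltaR hopfR X =
      \tsum_(X1, X2 <- DeltaL hopfL (antipodeV X))
        (antipode X2 : H) ⊗ (antipode X1 : H);
  hopf_epsR : forall X : H, epsR hopfR X = epsL hopfL (antipode X) }.
End HopfAlgebroid.

Section Comodules.
Variable k : fieldType.

Record is_right_Rcomodule (A R : algType k) (RR : right_bialgebroid A R)
    (M : lmodType k) (l : A -> M -> M) (r : M -> A -> M)
    (delta : M -> rtensor (tR RR) r) : Prop := {
  Rcom_bimodule : is_bimodule l r;
  Rcom_linear : linear delta;
  Rcom_bimod : forall a m a',
    delta (r (l a m) a') =
      \tsum_(m0, m1 <- delta m) m0 ⊗ (sR RR a * m1 * sR RR a');
  Rcom_takeuchi : forall a m,
    \tsum_(m0, m1 <- delta m) l a m0 ⊗ m1 =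
    \tsum_(m0, m1 <- delta m) m0 ⊗ (tR RR a * m1) :> rtensor (tR RR) r;
  Rcom_coassoc : forall m,
    (\tsum_(m0, m1 <- delta m) delta m0 ⊗ m1
       : rtensor (tR RR) (rtensor_ract (sR RR) (t := tR RR) (r := r))) =
    \tsum_(m0, m1 <- delta m) \tsum_(X, Y <- DeltaR RR m1) (m0 ⊗ X) ⊗ Y;
  Rcom_counit : forall m,
    \tsum_(m0, m1 <- delta m) r m0 (epsR RR m1) = m }.

Record is_right_Lcomodule (B L : algType k) (LL : left_bialgebroid B L)
    (M : lmodType k) (l : B -> M -> M) (r : M -> B -> M)
    (delta : M -> ltensor (sL LL) r) : Prop := {
  Lcom_bimodule : is_bimodule l r;
  Lcom_linear : linear delta;
  Lcom_bimod : forall b m b',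
    delta (r (l b m) b') =
      \tsum_(m0, m1 <- delta m) m0 ⊗ (tL LL b' * m1 * tL LL b);
  Lcom_takeuchi : forall b m,
    \tsum_(m0, m1 <- delta m) l b m0 ⊗ m1 =
    \tsum_(m0, m1 <- delta m) m0 ⊗ (m1 * sL LL b) :> ltensor (sL LL) r;
  Lcom_coassoc : forall m,
    (\tsum_(m0, m1 <- delta m) delta m0 ⊗ m1
       : ltensor (sL LL) (ltensor_ract (s := sL LL) (tL LL) (r := r))) =
    \tsum_(m0, m1 <- delta m) \tsum_(X, Y <- DeltaL LL m1) (m0 ⊗ X) ⊗ Y;
  Lcom_counit : forall m,
    \tsum_(m0, m1 <- delta m) r m0 (epsL LL m1) = m }.

(* (la, ra, dR) is the R-comodule structure and (lb, rb, dL) the L-comodule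
   structure. The two mixed coassociativity laws hold in
   (M (x)_B L) (x)_A R and (M (x)_A R) (x)_B L. *)
Record is_hopf_comodule (B H : algType k) (HH : hopf_algebroid B H)
    (M : lmodType k) (la : B^c -> M -> M) (ra : M -> B^c -> M)
    (dR : M -> rtensor (tR (hopfR HH)) ra)
    (lb : B -> M -> M) (rb : M -> B -> M)
    (dL : M -> ltensor (sL (hopfL HH)) rb) : Prop := {
  hcom_R : is_right_Rcomodule la dR;
  hcom_L : is_right_Lcomodule lb dL;
  hcom_dL_ra : forall m (a : B^c),
    dL (ra m a) = \tsum_(m0, m1 <- dL m) m0 ⊗ (m1 * sR (hopfR HH) a);
  hcom_dR_rb : forall m (b : B),
    dR (rb m b) = \tsum_(m0, m1 <- dR m) m0 ⊗ (tL (hopfL HH) b * m1);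
  hcom_mixedR : forall m,
    (\tsum_(m0, m1 <- dL m)
       \tsum_(X, Y <- DeltaR (hopfR HH) m1) (m0 ⊗ X) ⊗ Y
       : rtensor (tR (hopfR HH))
           (fun (u : ltensor (sL (hopfL HH)) rb) (a : B^c) =>
              \tsum_(m, X <- u) m ⊗ (X * sR (hopfR HH) a))) =
    \tsum_(m0, m1 <- dR m) dL m0 ⊗ m1;
  hcom_mixedL : forall m,
    (\tsum_(m0, m1 <- dR m)
       \tsum_(X, Y <- DeltaL (hopfL HH) m1) (m0 ⊗ X) ⊗ Y
       : ltensor (sL (hopfL HH))
           (fun (u : rtensor (tR (hopfR HH)) ra) (b : B) =>
              \tsum_(m, X <- u) m ⊗ (tL (hopfL HH) b * X))) =
    \tsum_(m0, m1 <- dL m) dR m0 ⊗ m1 }.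
End Comodules.

Record category : Type := Category {
  ob :> Type;
  hom : ob -> ob -> Type;
  idm : forall X, hom X X;
  comp : forall X Y Z, hom Y Z -> hom X Y -> hom X Z;
  compA : forall W X Y Z (h : hom Y Z) (g : hom X Y) (f : hom W X),
    comp h (comp g f) = comp (comp h g) f;
  comp1l : forall X Y (f : hom X Y), comp (idm Y) f = f;
  comp1r : forall X Y (f : hom X Y), comp f (idm X) = f }.

Arguments hom {c} X Y.
Arguments idm {c} X.
Arguments comp {c X Y Z} g f.
Notation "g ⊚ f" := (comp g f) (at level 40, left associativity).

Definition inverses (C : category) (X Y : C) (f : hom X Y) (g : hom Y X) :
    Prop :=
  g ⊚ f = idm X /\ f ⊚ g = idm Y.

Record monoidal (C : category) (T : C -> C -> C) (I : C) : Type := Monoidal {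
  tenh : forall X X' Y Y' : C,
    hom X X' -> hom Y Y' -> hom (T X Y) (T X' Y');
  assoc : forall X Y Z : C, hom (T (T X Y) Z) (T X (T Y Z));
  assocV : forall X Y Z : C, hom (T X (T Y Z)) (T (T X Y) Z);
  lunit : forall X : C, hom (T I X) X;
  lunitV : forall X : C, hom X (T I X);
  runit : forall X : C, hom (T X I) X;
  runitV : forall X : C, hom X (T X I);
  tenh_id : forall X Y : C, tenh (idm X) (idm Y) = idm (T X Y);
  tenh_comp : forall (X X' X'' Y Y' Y'' : C)
      (f' : hom X' X'') (f : hom X X') (g' : hom Y' Y'') (g : hom Y Y'),
    tenh (f' ⊚ f) (g' ⊚ g) = tenh f' g' ⊚ tenh f g;
  assoc_iso : forall X Y Z : C, inverses (assoc X Y Z) (assocV X Y Z);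
  assoc_nat : forall (X X' Y Y' Z Z' : C)
      (f : hom X X') (g : hom Y Y') (h : hom Z Z'),
    assoc X' Y' Z' ⊚ tenh (tenh f g) h = tenh f (tenh g h) ⊚ assoc X Y Z;
  lunit_iso : forall X : C, inverses (lunit X) (lunitV X);
  lunit_nat : forall (X Y : C) (f : hom X Y),
    lunit Y ⊚ tenh (idm I) f = f ⊚ lunit X;
  runit_iso : forall X : C, inverses (runit X) (runitV X);
  runit_nat : forall (X Y : C) (f : hom X Y),
    runit Y ⊚ tenh f (idm I) = f ⊚ runit X;
  pentagon : forall W X Y Z : C,
    assoc W X (T Y Z) ⊚ assoc (T W X) Y Z =
    tenh (idm W) (assoc X Y Z) ⊚ assoc W (T X Y) Z ⊚
      tenh (assoc W X Y) (idm Z);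
  triangle : forall X Y : C,
    tenh (idm X) (lunit Y) ⊚ assoc X I Y = tenh (runit X) (idm Y) }.

(* The unit conditions follow from the hexagons for an invertible braiding, but
   not for a pre-braiding (the zero morphisms of a linear category satisfy
   naturality and the hexagons). *)
Record is_prebraiding (C : category) (T : C -> C -> C) (I : C)
    (M : monoidal T I) (br : forall X Y : C, hom (T X Y) (T Y X)) : Prop := {
  braid_nat : forall (X X' Y Y' : C) (f : hom X X') (g : hom Y Y'),
    br X' Y' ⊚ tenh M f g = tenh M g f ⊚ br X Y;
  braid_hexagon1 : forall X Y Z : C,
    assoc M Y Z X ⊚ br X (T Y Z) ⊚ assoc M X Y Z =
    tenh M (idm Y) (br X Z) ⊚ assoc M Y X Z ⊚ tenh M (br X Y) (idm Z);
  braid_hexagon2 : forall X Y Z : C,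
    assocV M Z X Y ⊚ br (T X Y) Z ⊚ assocV M X Y Z =
    tenh M (br X Z) (idm Y) ⊚ assocV M X Z Y ⊚ tenh M (idm X) (br Y Z);
  braid_lunit : forall X : C, lunit M X ⊚ br X I = runit M X;
  braid_runit : forall X : C, runit M X ⊚ br I X = lunit M X }.

Definition pre_braided (C : category) (T : C -> C -> C) (I : C)
    (M : monoidal T I) : Prop :=
  exists br : forall X Y : C, hom (T X Y) (T Y X), is_prebraiding M br.

Definition braided (C : category) (T : C -> C -> C) (I : C)
    (M : monoidal T I) : Prop :=
  exists br : forall X Y : C, hom (T X Y) (T Y X),
    is_prebraiding M br /\
    forall X Y : C, exists brV : hom (T Y X) (T X Y), inverses (br X Y) brV.

Section YetterDrinfeld.
Variables (k : fieldType) (A R : algType k) (RR : right_bialgebroid A R).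

(* yd_data carries the operations without axioms, so that the tensor product
   and the unit can be given by their formulas; is_yd collects the axioms. *)
Record yd_data : Type := YdData {
  yd_sort :> lmodType k;
  yd_lact : A -> yd_sort -> yd_sort;
  yd_ract : yd_sort -> A -> yd_sort;
  yd_coact : yd_sort -> rtensor (tR RR) yd_ract;
  yd_act : yd_sort -> R -> yd_sort }.

Record is_yd (X : yd_data) : Prop := {
  yd_comodule : is_right_Rcomodule (@yd_lact X) (@yd_coact X);
  yd_module : is_right_module (@yd_act X);
  yd_act_sR : forall (x : X) (a : A), yd_act x (sR RR a) = yd_ract x a;
  yd_act_tR : forall (x : X) (a : A), yd_act x (tR RR a) = yd_lact a x;
  yd_compat : forall (x : X) (r : R),
    \tsum_(r1, r2 <- DeltaR RR r)
      \tsum_(x0, x1 <- yd_coact (yd_act x r2)) x0 ⊗ (r1 * x1) =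
    \tsum_(x0, x1 <- yd_coact x)
      \tsum_(r1, r2 <- DeltaR RR r) yd_act x0 r1 ⊗ (x1 * r2)
      :> rtensor (tR RR) (@yd_ract X) }.

Record yd : Type := Yd { yd_dat :> yd_data; ydP : is_yd yd_dat }.

Record is_yd_hom (X Y : yd_data) (f : X -> Y) : Prop := {
  ydh_linear : linear f;
  ydh_lact : forall a x, f (yd_lact a x) = yd_lact a (f x);
  ydh_ract : forall x a, f (yd_ract x a) = yd_ract (f x) a;
  ydh_act : forall x r, f (yd_act x r) = yd_act (f x) r;
  ydh_coact : forall x,
    yd_coact (f x) = \tsum_(x0, x1 <- yd_coact x) f x0 ⊗ x1 }.

Record yd_hom (X Y : yd_data) : Type := YdHom {
  yd_fun :> X -> Y;
  yd_funP : is_yd_hom yd_fun }.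

Fact yd_hom_eq (X Y : yd_data) (f g : yd_hom X Y) : f =1 g -> f = g.
Proof.
case: f g => f fP [g gP] /= /funext fg; move: fP gP; rewrite fg => fP gP.
by rewrite (Prop_irrelevance fP gP).
Qed.

Fact yd_id_subproof (X : yd_data) : is_yd_hom (@id X).
Proof. by split=> // x; rewrite tsum_tpure. Qed.

Fact coact_comp (I : Type) (M N P : lmodType k) (V : lmodType k)
    (r : M -> I -> M) (r' : N -> I -> N) (r'' : P -> I -> P)
    (l : I -> V -> V) (u : tens r l)
    (g : N -> P) (f : M -> N) : linear g ->
    (forall n i, g (r' n i) = r'' (g n) i) ->
  \tsum_(n, v <- (\tsum_(m, v <- u) f m ⊗ v : tens r' l)) g n ⊗ v =
  \tsum_(m, v <- u) g (f m) ⊗ v :> tens r'' l.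
Proof.
move=> gL gr.
pose gM := GRing.isLinear.Build k N P *:%R g gL.
pose g' : {linear N -> P} := HB.pack g gM.
have gE n : g n = g' n by [].
rewrite tsum_sum.
- apply: eq_bigr => p _; rewrite tsum_pure //=.
  + by move=> m m' n; rewrite !gE linearD tpureDl.
  + by move=> m n n'; rewrite tpureDr.
  + by move=> c m n; rewrite !gE linearZ tpureZl.
  + by move=> c m n; rewrite tpureZr.
  + by move=> m i n; rewrite gr tpure_bal.
- by move=> m m' n; rewrite !gE linearD tpureDl.
- by move=> m n n'; rewrite tpureDr.
- by move=> c m n; rewrite !gE linearZ tpureZl.
- by move=> c m n; rewrite tpureZr.
- by move=> m i n; rewrite gr tpure_bal.
Qed.

Fact yd_comp_subproof (X Y Z : yd_data) (g : yd_hom Y Z) (f : yd_hom X Y) :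
  is_yd_hom (g \o f).
Proof.
case: g f => g [gL gl gr ga gc] [f [fL fl fr fa fc]] /=.
split=> [c x y|a x|x a|x r|x] /=.
- by rewrite fL gL.
- by rewrite fl gl.
- by rewrite fr gr.
- by rewrite fa ga.
- by rewrite gc fc coact_comp.
Qed.

Definition yd_id (X : yd_data) : yd_hom X X := YdHom (yd_id_subproof X).
Definition yd_comp (X Y Z : yd_data) (g : yd_hom Y Z) (f : yd_hom X Y) :
  yd_hom X Z := YdHom (yd_comp_subproof g f).

Fact yd_compA (W X Y Z : yd) (h : yd_hom Y Z) (g : yd_hom X Y)
  (f : yd_hom W X) : yd_comp h (yd_comp g f) = yd_comp (yd_comp h g) f.
Proof. exact: yd_hom_eq. Qed.
Fact yd_comp1l (X Y : yd) (f : yd_hom X Y) : yd_comp (yd_id Y) f = f.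
Proof. exact: yd_hom_eq. Qed.
Fact yd_comp1r (X Y : yd) (f : yd_hom X Y) : yd_comp f (yd_id X) = f.
Proof. exact: yd_hom_eq. Qed.

Definition YD : category :=
  @Category yd (fun X Y => yd_hom X Y) (fun X => yd_id X)
    (fun X Y Z g f => yd_comp g f) yd_compA yd_comp1l yd_comp1r.

Definition yd_tens (X Y : yd_data) : lmodType k :=
  tens (fun (x : X) (a : A) => yd_act x (sR RR a))
       (fun (a : A) (y : Y) => yd_act y (tR RR a)).

Definition yd_tensor_ract (X Y : yd_data) (u : yd_tens X Y) (a : A) :
    yd_tens X Y :=
  \tsum_(x, y <- u) x ⊗ yd_ract y a.

Definition yd_tensor (X Y : yd_data) : yd_data :=
  @YdData (yd_tens X Y)
    (fun a u => \tsum_(x, y <- u) yd_lact a x ⊗ y)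
    (@yd_tensor_ract X Y)
    (fun u =>
       \tsum_(x, y <- u)
         \tsum_(x0, x1 <- yd_coact x) \tsum_(y0, y1 <- yd_coact y)
           ((x0 ⊗ y0 : yd_tens X Y) ⊗ (x1 * y1)
              : rtensor (tR RR) (@yd_tensor_ract X Y)))
    (fun u r =>
       \tsum_(x, y <- u)
         \tsum_(r1, r2 <- DeltaR RR r) yd_act x r1 ⊗ yd_act y r2).

(* The unit object is A, with the action 1 <| X = eps(X) of R and the coaction
   determined by 1 |-> 1 (x) 1. *)
Definition yd_unit : yd_data :=
  @YdData A (fun a x => a * x) (fun x a => x * a)
    (fun x => 1 ⊗ sR RR x)
    (fun x r => epsR RR (sR RR x * r)).

Record yd_canonical (T_yd : forall X Y : yd, is_yd (yd_tensor X Y))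
    (I_yd : is_yd yd_unit)
    (M : monoidal (C := YD) (fun X Y => Yd (T_yd X Y)) (Yd I_yd)) : Prop := {
  yd_tenhE : forall (X X' Y Y' : yd) (f : yd_hom X X') (g : yd_hom Y Y')
      (x : X) (y : Y),
    (tenh (C := YD) M f g : yd_hom _ _) (x ⊗ y) = f x ⊗ g y;
  yd_assocE : forall (X Y Z : yd) (x : X) (y : Y) (z : Z),
    (assoc M X Y Z : yd_hom _ _) ((x ⊗ y) ⊗ z) = x ⊗ (y ⊗ z);
  yd_lunitE : forall (X : yd) (a : A) (x : X),
    (lunit M X : yd_hom _ _) (a ⊗ x) = yd_lact a x;
  yd_runitE : forall (X : yd) (x : X) (a : A),
    (runit M X : yd_hom _ _) (x ⊗ a) = yd_ract x a }.
End YetterDrinfeld.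

Section FullYetterDrinfeld.
Variables (k : fieldType) (B H : algType k) (HH : hopf_algebroid B H).

Record fyd_data : Type := FydData {
  fyd_yd :> yd_data (hopfR HH);
  fyd_llact : B -> fyd_yd -> fyd_yd;
  fyd_lract : fyd_yd -> B -> fyd_yd;
  fyd_lcoact : fyd_yd -> ltensor (sL (hopfL HH)) fyd_lract }.

Record is_fyd (X : fyd_data) : Prop := {
  fyd_is_yd : is_yd X;
  fyd_comodule :
    is_hopf_comodule (@yd_lact _ _ _ _ X) (@yd_coact _ _ _ _ X)
      (@fyd_llact X) (@fyd_lcoact X) }.

Record fyd : Type := Fyd { fyd_dat :> fyd_data; fydP : is_fyd fyd_dat }.

Record is_fyd_hom (X Y : fyd_data) (f : X -> Y) : Prop := {
  fydh_yd : is_yd_hom f;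
  fydh_llact : forall b x, f (fyd_llact b x) = fyd_llact b (f x);
  fydh_lract : forall x b, f (fyd_lract x b) = fyd_lract (f x) b;
  fydh_lcoact : forall x,
    fyd_lcoact (f x) = \tsum_(x0, x1 <- fyd_lcoact x) f x0 ⊗ x1 }.

Record fyd_hom (X Y : fyd_data) : Type := FydHom {
  fyd_fun :> X -> Y;
  fyd_funP : is_fyd_hom fyd_fun }.

Fact fyd_hom_eq (X Y : fyd_data) (f g : fyd_hom X Y) : f =1 g -> f = g.
Proof.
case: f g => f fP [g gP] /= /funext fg; move: fP gP; rewrite fg => fP gP.
by rewrite (Prop_irrelevance fP gP).
Qed.

Fact fyd_id_subproof (X : fyd_data) : is_fyd_hom (@id X).
Proof.
split=> //; first exact: yd_id_subproof.
by move=> x; rewrite tsum_tpure.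
Qed.

Fact fyd_comp_subproof (X Y Z : fyd_data) (g : fyd_hom Y Z)
  (f : fyd_hom X Y) : is_fyd_hom (g \o f).
Proof.
case: g f => g [gyd gl gr gc] [f [fyd fl fr fc]] /=.
split=> [|b x|x b|x] /=.
- exact: (yd_comp_subproof (YdHom gyd) (YdHom fyd)).
- by rewrite fl gl.
- by rewrite fr gr.
- by rewrite gc fc coact_comp //; case: gyd.
Qed.

Definition fyd_id (X : fyd_data) : fyd_hom X X := FydHom (fyd_id_subproof X).
Definition fyd_comp (X Y Z : fyd_data) (g : fyd_hom Y Z) (f : fyd_hom X Y) :
  fyd_hom X Z := FydHom (fyd_comp_subproof g f).

Fact fyd_compA (W X Y Z : fyd) (h : fyd_hom Y Z) (g : fyd_hom X Y)
  (f : fyd_hom W X) : fyd_comp h (fyd_comp g f) = fyd_comp (fyd_comp h g) f.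
Proof. exact: fyd_hom_eq. Qed.
Fact fyd_comp1l (X Y : fyd) (f : fyd_hom X Y) : fyd_comp (fyd_id Y) f = f.
Proof. exact: fyd_hom_eq. Qed.
Fact fyd_comp1r (X Y : fyd) (f : fyd_hom X Y) : fyd_comp f (fyd_id X) = f.
Proof. exact: fyd_hom_eq. Qed.

Definition FYD : category :=
  @Category fyd (fun X Y => fyd_hom X Y) (fun X => fyd_id X)
    (fun X Y Z g f => fyd_comp g f) fyd_compA fyd_comp1l fyd_comp1r.

Definition fyd_tensor_lract (X Y : fyd_data) (u : yd_tensor X Y) (b : B) :
    yd_tensor X Y :=
  \tsum_(x, y <- u) fyd_lract x b ⊗ y.

Definition fyd_tensor (X Y : fyd_data) : fyd_data :=
  @FydData (yd_tensor X Y)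
    (fun b u => \tsum_(x, y <- u) x ⊗ fyd_llact b y)
    (@fyd_tensor_lract X Y)
    (fun u =>
       \tsum_(x, y <- u)
         \tsum_(x0, x1 <- fyd_lcoact x) \tsum_(y0, y1 <- fyd_lcoact y)
           ((x0 ⊗ y0 : yd_tens X Y) ⊗ (x1 * y1)
              : ltensor (sL (hopfL HH)) (@fyd_tensor_lract X Y))).

(* As A = B^op, the B-bimodule b * x * b' = b' . x . b underlying the unit
   object is the regular B-bimodule. *)
Definition fyd_unit : fyd_data :=
  @FydData (yd_unit (hopfR HH))
    (fun b x => @GRing.mul B b x) (fun x b => @GRing.mul B x b)
    (fun x => (1 : B^c) ⊗ tL (hopfL HH) x).

Record fyd_canonical (T_fyd : forall X Y : fyd, is_fyd (fyd_tensor X Y))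
    (I_fyd : is_fyd fyd_unit)
    (M : monoidal (C := FYD) (fun X Y => Fyd (T_fyd X Y)) (Fyd I_fyd)) :
    Prop := {
  fyd_tenhE : forall (X X' Y Y' : fyd) (f : fyd_hom X X') (g : fyd_hom Y Y')
      (x : X) (y : Y),
    (tenh (C := FYD) M f g : fyd_hom _ _) (x ⊗ y) = f x ⊗ g y;
  fyd_assocE : forall (X Y Z : fyd) (x : X) (y : Y) (z : Z),
    (assoc M X Y Z : fyd_hom _ _) ((x ⊗ y) ⊗ z) = x ⊗ (y ⊗ z);
  fyd_lunitE : forall (X : fyd) (a : B^c) (x : X),
    (lunit M X : fyd_hom _ _) (a ⊗ x) = yd_lact a x;
  fyd_runitE : forall (X : fyd) (x : X) (a : B^c),
    (runit M X : fyd_hom _ _) (x ⊗ a) = yd_ract x a }.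
End FullYetterDrinfeld.

(* Main.v *)
(** The pre-braiding is x (x) y |-> y_[0] (x) x <| y_[1]. Every formula is a
    functional of Sweedler legs, so each axiom comes down to two things:
    evaluating coassociativity (or the Takeuchi, counit or Yetter-Drinfeld
    identities) through a functional, and checking that this functional is
    balanced over the base, where the Takeuchi conditions enter.

    In the Hopf algebroid case, comparing the two coactions through their counits
    shows that the B-bimodule structure of a full module is the opposite of its
    A-bimodule structure. The antipode recovers delta_L from delta_R, since
    delta_L(m_[0]) S(m_[1]) = m (x) 1; hence every morphism of Yetter-Drinfeld
    modules between full ones is L-colinear, full modules form a full
    subcategory, and the monoidal structure and braiding restrict to it. The
    inverse braiding is y (x) x |-> x <| S^-1(y_(1)) (x) y_(0). *)

Require Import Defs.
From HB Require Import structures.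
From mathcomp Require Import all_boot all_order all_algebra.

Set Implicit Arguments.
Unset Strict Implicit.
Unset Printing Implicit Defensive.

Import GRing.Theory.
Local Open Scope ring_scope.

(** * Balanced maps *)

(** The obstacle throughout is that [tsum] evaluates a chosen representative, so a Sweedler sum may
    be rewritten only under a balanced functional. In iterated sums the functional left for one
    factor is often balanced only after the legs of the other factor have been summed, because a
    Takeuchi condition concerns a whole sum and not its single terms. This decides the order in
    which the factors of a tensor product are treated.

    The two halves of a Hopf algebroid meet in the mixed laws, where scalars of one side have to
    pass through the coproduct of the other. They can, because s_L and t_R have the same image; this
    follows from antipode identities evaluated at s_L(b) and at t_R(b).

    L-colinearity can be read off from the R-coaction because the equation satisfied by delta_L and
    S has a unique solution: the second mixed law together with S(h_(1)) h_(2) = t_L(eps_R(h))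
    undoes the multiplication by S. The same equation can thus be tested on the composite of delta_L
    with any R-colinear map. *)

Section Tensors.
Variable k : fieldType.

Lemma linear_id (U : lmodType k) : linear (fun x : U => x).
Proof. by []. Qed.

Lemma linear_comp (U V W : lmodType k) (h : V -> W) (g : U -> V) :
  linear h -> linear g -> linear (fun x => h (g x)).
Proof. by move=> hL gL c x y; rewrite gL hL. Qed.

Lemma linear_linear (U V W : lmodType k) (h : {linear V -> W}) (g : U -> V) :
  linear g -> linear (fun x => h (g x)).
Proof. exact/linear_comp/linearP. Qed.

Lemma linear_lrmorphism (U : lmodType k) (A B : algType k)
    (h : {lrmorphism A -> B}) (g : U -> A) :
  linear g -> linear (fun x => h (g x)).
Proof. exact/linear_comp/linearP. Qed.

Lemma linear_add (U V : lmodType k) (h : U -> V) :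
  linear h -> {morph h : x y / x + y}.
Proof. by move=> hL x y; have := hL 1 x y; rewrite !scale1r. Qed.

Lemma linear_0 (U V : lmodType k) (h : U -> V) : linear h -> h 0 = 0.
Proof.
by move=> hL; have := hL (-1) 0 0;
  rewrite scaler0 addr0 scaleN1r addNr.
Qed.

Lemma linear_scale (U V : lmodType k) (h : U -> V) :
  linear h -> forall c x, h (c *: x) = c *: h x.
Proof.
by move=> hL c x; have := hL c x 0;
  rewrite !addr0 (linear_0 hL) addr0.
Qed.

Section Balanced.
Variables (M N : lmodType k) (I : Type) (f : M -> I -> M) (g : I -> N -> N).
Variable V : lmodType k.

Record balanced (F : M -> N -> V) : Prop := Balanced {
  balanced_l : forall n, linear (fun m => F m n);
  balanced_r : forall m, linear (fun n => F m n);
  balanced_eq : forall m i n, F (f m i) n = F m (g i n) }.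

Lemma tsum_tpureE (F : M -> N -> V) (m : M) (n : N) :
  balanced F -> tsum (m ⊗ n : tens f g) F = F m n.
Proof.
case=> Fl Fr Fb; apply: tsum_pure => // [? ? ?|? ? ?|? ? ?|? ? ?].
- exact: (linear_add (Fl _)).
- exact: (linear_add (Fr _)).
- exact: (linear_scale (Fl _)).
- exact: (linear_scale (Fr _)).
Qed.

Lemma linear_tsum (F : M -> N -> V) :
  balanced F -> linear (fun t : tens f g => tsum t F).
Proof.
move=> Fbal; have [Fl Fr Fb] := Fbal.
have tsD (t t' : tens f g) : tsum (t + t') F = tsum t F + tsum t' F.
  apply: tsumD => // [? ? ?|? ? ?|? ? ?|? ? ?].
  - exact: (linear_add (Fl _)).
  - exact: (linear_add (Fr _)).
  - exact: (linear_scale (Fl _)).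
  - exact: (linear_scale (Fr _)).
move=> c x y; rewrite tsD; congr (_ + _).
have ts0 : tsum (0 : tens f g) F = 0.
  by have := tsD 0 0; rewrite addr0 -[LHS]addr0 => /addrI <-.
rewrite -[x]tsum_tpure [\tsum_(_, _ <- x) _]/tsum.
elim: (repr x) => [|p s IHs]; first by rewrite big_nil scaler0 ts0 scaler0.
by rewrite big_cons scalerDr !tsD IHs -tpureZl !tsum_tpureE //
  (linear_scale (Fl _)) scalerDr.
Qed.

Lemma tens_ext (F G : tens f g -> V) : linear F -> linear G ->
  (forall m n, F (m ⊗ n) = G (m ⊗ n)) -> forall t, F t = G t.
Proof.
move=> FL GL FG t; rewrite -[t]tsum_tpure /tsum.
elim/big_ind: _ => [|x y xE yE|p _]; rewrite ?FG //.
  by rewrite !linear_0.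
by rewrite (linear_add FL) (linear_add GL) xE yE.
Qed.
End Balanced.

Section Sums.
Variables (M N : lmodType k) (I : Type) (f : M -> I -> M) (g : I -> N -> N).
Implicit Type t : tens f g.

Lemma eq_tsum (V : zmodType) t (F G : M -> N -> V) :
  (forall m n, F m n = G m n) -> tsum t F = tsum t G.
Proof. by move=> FG; apply: eq_bigr => p _; apply: FG. Qed.

Lemma linear_tsumr (U V : lmodType k) t (F : U -> M -> N -> V) :
  (forall m n, linear (fun u => F u m n)) -> linear (fun u => tsum t (F u)).
Proof.
move=> FL c x y; rewrite /tsum scaler_sumr -big_split /=.
by apply: eq_bigr => p _; rewrite FL.
Qed.

Lemma raddf_tsum (U V : lmodType k) (h : U -> V) t (F : M -> N -> U) :
  linear h -> h (tsum t F) = tsum t (fun m n => h (F m n)).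
Proof.
by move=> hL; apply: (big_morph h); [apply: linear_add | apply: linear_0].
Qed.

(** Both sides are sums over representatives fixed in advance, so the exchange is legitimate even
    where the inner functional is not balanced. It serves to reach an order of summation in which it
    is. *)
Lemma tsum_exchange (M' N' : lmodType k) (J : Type) (f' : M' -> J -> M')
    (g' : J -> N' -> N') (V : zmodType) t (u : tens f' g')
    (F : M -> N -> M' -> N' -> V) :
  \tsum_(m, n <- t) \tsum_(m', n' <- u) F m n m' n' =
  \tsum_(m', n' <- u) \tsum_(m, n <- t) F m n m' n'.
Proof. exact: exchange_big. Qed.
End Sums.

Lemma tsum_exchange4 (M M' N N' P P' Q Q' : lmodType k) (I J I' J' : Type)
    (f : M -> I -> M) (g : I -> N -> N) (f' : M' -> I' -> M')
    (g' : I' -> N' -> N') (fP : P -> J -> P) (gP : J -> Q -> Q)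
    (fP' : P' -> J' -> P') (gP' : J' -> Q' -> Q') (V : zmodType)
    (t : tens f g) (u : tens f' g') (a : M -> N -> tens fP gP)
    (b : M' -> N' -> tens fP' gP') F :
  \tsum_(m, n <- t) \tsum_(p, q <- a m n)
    \tsum_(m', n' <- u) \tsum_(p', q' <- b m' n')
      (F m n p q m' n' p' q' : V) =
  \tsum_(m', n' <- u) \tsum_(p', q' <- b m' n')
    \tsum_(m, n <- t) \tsum_(p, q <- a m n) F m n p q m' n' p' q'.
Proof.
under eq_tsum => m n do rewrite tsum_exchange.
rewrite tsum_exchange; apply: eq_tsum => m' n'.
under eq_tsum => m n do rewrite tsum_exchange.
by rewrite tsum_exchange.
Qed.

Lemma tsum_tsum (M N : lmodType k) (I : Type) (f : M -> I -> M)
    (g : I -> N -> N) (M' N' : lmodType k) (J : Type) (f' : M' -> J -> M')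
    (g' : J -> N' -> N') (V : lmodType k) (u : tens f' g')
    (G : M' -> N' -> tens f g) (F : M -> N -> V) :
  balanced f g F ->
  tsum (tsum u G) F = \tsum_(m, n <- u) tsum (G m n) F.
Proof. by move=> Fb; apply: (raddf_tsum _ _ (linear_tsum Fb)). Qed.

(* The trilinear functionals that factor through the iterated tensor product
   (M (x) N) (x) P, where (m (x) n) j = m (x) c j n. *)
Record balanced3 (M N P V : lmodType k) (I J : Type) (f : M -> I -> M)
    (g : I -> N -> N) (c : J -> N -> N) (h : J -> P -> P)
    (F : M -> N -> P -> V) : Prop := Balanced3 {
  balanced3_1 : forall n p, linear (fun m => F m n p);
  balanced3_2 : forall m p, linear (fun n => F m n p);
  balanced3_3 : forall m n, linear (fun p => F m n p);
  balanced3_eq12 : forall m i n p, F (f m i) n p = F m (g i n) p;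
  balanced3_eq23 : forall m n j p, F m (c j n) p = F m n (h j p) }.

Lemma balanced3_l (M N P V : lmodType k) (I J : Type) (f : M -> I -> M)
    (g : I -> N -> N) (c : J -> N -> N) (h : J -> P -> P) (F : M -> N -> P -> V)
      (p : P) :
  balanced3 f g c h F -> balanced f g (fun m n => F m n p).
Proof. by case=> ? ? ? F12 _; split=> *; rewrite ?F12. Qed.

(** Transfers an identity in (M (x) N) (x) P to sums of a trilinear functional, by the map that [F]
    induces on M (x) N for each element of P. The data are generic so that coassociativity of
    [DeltaR], coassociativity of both coactions and the two mixed laws are all instances. *)
Lemma tsum_triple (M N P V : lmodType k) (I J : Type) (f : M -> I -> M)
    (g : I -> N -> N) (c : J -> N -> N) (h : J -> P -> P)
    (F : M -> N -> P -> V)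
    (M1 N1 : lmodType k) (I1 : Type) (f1 : M1 -> I1 -> M1)
    (g1 : I1 -> N1 -> N1) (t1 : tens f1 g1) (D : M1 -> tens f g) (p1 : N1 -> P)
    (N2 : lmodType k) (I2 : Type) (f2 : M -> I2 -> M)
    (g2 : I2 -> N2 -> N2) (t2 : tens f2 g2)
    (I3 : Type) (f3 : N -> I3 -> N) (g3 : I3 -> P -> P)
    (E : N2 -> tens f3 g3) :
  (forall j, linear (c j)) -> (forall i j n, c j (g i n) = g i (c j n)) ->
  \tsum_(m, n <- t1) (D m) ⊗ (p1 n) =
    \tsum_(m, n <- t2) \tsum_(n', p <- E n) (m ⊗ n') ⊗ p
    :> tens (fun (u : tens f g) (j : J) => \tsum_(m, n <- u) m ⊗ c j n) h ->
  balanced3 f g c h F ->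
  \tsum_(m, n <- t1) \tsum_(m', n' <- D m) F m' n' (p1 n) =
  \tsum_(m, n <- t2) \tsum_(n', p <- E n) F m n' p.
Proof.
move=> cL cg e [F1 F2 F3 F12 F23].
have F12b p : balanced f g (fun m n => F m n p) by split.
(* Since [c j] commutes with the action [g], it descends to the inner tensor product and provides
   its right action. *)
have cb j : balanced f g (fun m n => m ⊗ c j n : tens f g).
  split=> [n a x y|m a x y|m i n].
  - by rewrite tpureDl tpureZl.
  - by rewrite cL tpureDr tpureZr.
  - by rewrite tpure_bal cg.
have Fb : balanced (fun (u : tens f g) (j : J) => \tsum_(m, n <- u) m ⊗ c j n)
    h (fun u p => tsum u (fun m n => F m n p)).
  split=> [p|u|u j p]; first exact: linear_tsum.
    by apply: linear_tsumr => m n; apply: F3.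
  rewrite tsum_tsum //; apply: eq_tsum => m n.
  by rewrite tsum_tpureE // F23.
have := congr1 (fun t => tsum t (fun u p => tsum u (fun m n => F m n p))) e.
rewrite !tsum_tsum // => {}e; apply: etrans (etrans _ e) _.
  by apply: eq_tsum => m n; rewrite tsum_tpureE.
apply: eq_tsum => m n; rewrite tsum_tsum //; apply: eq_tsum => n' p.
by rewrite !tsum_tpureE.
Qed.

Lemma linear_tpurel (U M N : lmodType k) (I : Type) (f : M -> I -> M)
    (g : I -> N -> N) (h : U -> M) (n : N) :
  linear h -> linear (fun u => h u ⊗ n : tens f g).
Proof. by move=> hL c x y; rewrite hL tpureDl tpureZl. Qed.

Lemma linear_tpurer (U M N : lmodType k) (I : Type) (f : M -> I -> M)
    (g : I -> N -> N) (m : M) (h : U -> N) :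
  linear h -> linear (fun u => m ⊗ h u : tens f g).
Proof. by move=> hL c x y; rewrite hL tpureDr tpureZr. Qed.

Lemma tpure_tsum (M N P : lmodType k) (I J : Type) (f : M -> I -> M)
    (g : I -> N -> N) (f' : tens f g -> J -> tens f g) (h : J -> P -> P)
    (u : tens f g) (p : P) :
  u ⊗ p = \tsum_(m, n <- u) (m ⊗ n) ⊗ p :> tens f' h.
Proof.
rewrite -[u in LHS]tsum_tpure (raddf_tsum (h := fun v => v ⊗ p)) //.
by apply: linear_tpurel; apply: linear_id.
Qed.

(** The universal trilinear functional: an identity proved for all balanced functionals, evaluated
    at this one, becomes an identity between elements of the iterated tensor product. *)
Lemma balanced3_tpure (M N P : lmodType k) (I J : Type) (f : M -> I -> M)
    (g : I -> N -> N) (c : J -> N -> N) (h : J -> P -> P) :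
  (forall j, linear (c j)) -> (forall i j n, c j (g i n) = g i (c j n)) ->
  balanced3 f g c h (fun m n p => (m ⊗ n) ⊗ p
    : tens (fun (u : tens f g) (j : J) => \tsum_(m, n <- u) m ⊗ c j n) h).
Proof.
move=> cL cg; split.
- by move=> n p; do 2 apply: linear_tpurel; apply: linear_id.
- by move=> m p; apply: linear_tpurel; apply: linear_tpurer; apply: linear_id.
- by move=> m n; apply: linear_tpurer; apply: linear_id.
- by move=> m i n p; rewrite tpure_bal.
move=> m n j p; rewrite -tpure_bal tsum_tpureE //; split=> [q|v|v i q].
- by apply: linear_tpurel; apply: linear_id.
- exact: linear_tpurer.
- by rewrite tpure_bal cg.
Qed.

Lemma linear_mull (U : lmodType k) (R : algType k) (h : U -> R) (r : R) :
  linear h -> linear (fun u => h u * r).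
Proof. by move=> hL c x y; rewrite hL mulrDl scalerAl. Qed.

Lemma linear_mulr (U : lmodType k) (R : algType k) (h : U -> R) (r : R) :
  linear h -> linear (fun u => r * h u).
Proof. by move=> hL c x y; rewrite hL mulrDr scalerAr. Qed.
End Tensors.

Ltac lin_ext := fail.

(* [lin] proves linearity by recursion on the term; [lin_ext] is its extension
   point. [bal] leaves only the middle-linearity condition of [balanced] and
   the linearity goals that [lin] cannot solve. *)
Ltac lin := cbv beta; intros; try assumption;
  lazymatch goal with
  | |- GRing.linear_for ?sc ?h0 =>
    let h := eval cbv beta in (fun x => h0 x) in
    change (GRing.linear_for sc h); lazymatch h with
    | fun x => x => exact: linear_id
    | fun x => tpure (@?a x) (@?b x) =>
      lazymatch b with
      | fun _ => ?c => apply: linear_tpurel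
      | _ => apply: linear_tpurer
      end; lin
    | fun x => GRing.mul (@?a x) (@?b x) =>
      lazymatch b with
      | fun _ => ?c => apply: linear_mull
      | _ => apply: linear_mulr
      end; lin
    | fun x => tsum (@?t x) (@?b x) =>
      lazymatch t with
      | fun _ => ?c => apply: linear_tsumr; lin
      | _ => apply: (linear_comp (linear_tsum _)); [ | lin]
      end
    | fun x => GRing.LRMorphism.sort _ (@?a x) =>
      apply: linear_lrmorphism; lin
    | fun x => GRing.Linear.sort _ (@?a x) => apply: linear_linear; lin
    | _ => first [lin_ext
      | match goal with
        | H : balanced _ _ ?F |- GRing.linear_for _ (fun x => ?F (@?a x) ?b) =>
          apply: (linear_comp (balanced_l H _)); lin
        | H : balanced _ _ ?F |- GRing.linear_for _ (fun x => ?F ?a (@?b x)) =>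
          apply: (linear_comp (balanced_r H _)); lin
        | H : balanced3 _ _ _ _ ?F |- GRing.linear_for _
          (fun x => ?F (@?a x) ?b ?c) =>
          apply: (linear_comp (balanced3_1 H _ _)); lin
        | H : balanced3 _ _ _ _ ?F |- GRing.linear_for _
          (fun x => ?F ?a (@?b x) ?c) =>
          apply: (linear_comp (balanced3_2 H _ _)); lin
        | H : balanced3 _ _ _ _ ?F |- GRing.linear_for _
          (fun x => ?F ?a ?b (@?c x)) =>
          apply: (linear_comp (balanced3_3 H _ _)); lin
        end ]
    end
  end.

Ltac bal := split; cbv beta; try by [lin].

(** * Right bialgebroids *)

Local Notation balancedR RR :=
  (balanced (fun X a => X * sR RR a) (fun a X => X * tR RR a)).
Local Notation balancedR3 RR :=
  (balanced3 (fun X a => X * sR RR a) (fun a X => X * tR RR a)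
     (fun a X => X * sR RR a) (fun a X => X * tR RR a)).

Section RightBialgebroid.
Variables (k : fieldType) (A R : algType k) (RR : right_bialgebroid A R).
Local Notation s := (sR RR).
Local Notation t := (tR RR).
Local Notation Delta := (DeltaR RR).
Local Notation eps := (epsR RR).

Lemma tR1 : t 1 = 1. Proof. exact: rmorph1. Qed.

Lemma sR1 : s 1 = 1. Proof. exact: rmorph1. Qed.

Lemma epsR_Ms (r : R) (a : A) : eps (r * s a) = eps r * a.
Proof. by have := epsR_bimod RR 1 a r; rewrite tR1 mulr1 mul1r. Qed.

Lemma epsR_Mt (r : R) (a : A) : eps (r * t a) = a * eps r.
Proof. by have := epsR_bimod RR a 1 r; rewrite sR1 !mulr1. Qed.

Lemma epsR_s (a : A) : eps (s a) = a.
Proof. by rewrite -[s a]mul1r epsR_Ms epsR_1 mul1r. Qed.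

Lemma tpure_DeltaR (x y : R) (a : A) :
  (x * s a) ⊗ y = x ⊗ (y * t a)
    :> rtensor t (fun X (a : A) => X * s a).
Proof. exact: (tpure_bal (fun X (a : A) => X * s a) (fun a X => X * t a)). Qed.

Lemma DeltaR_s (a : A) : Delta (s a) = 1 ⊗ s a.
Proof.
have := DeltaR_bimod RR 1 a 1; rewrite tR1 mulr1 mul1r DeltaR_1 => ->.
rewrite tsum_tpureE ?mulr1 ?mul1r //; bal => *.
by rewrite !mulr1 tpure_DeltaR -!mulrA sR_tR_comm.
Qed.

Lemma DeltaR_t (a : A) : Delta (t a) = t a ⊗ 1.
Proof.
have := DeltaR_bimod RR a 1 1; rewrite sR1 !mulr1 mul1r DeltaR_1 => ->.
rewrite tsum_tpureE ?mulr1 ?mul1r //; bal => *.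
by rewrite !mulr1 -mulrA sR_tR_comm mulrA tpure_DeltaR.
Qed.

Lemma tsum_DeltaR1 (V : lmodType k) (F : R -> R -> V) :
  balancedR RR F -> tsum (Delta 1) F = F 1 1.
Proof. by move=> Fb; rewrite DeltaR_1 tsum_tpureE. Qed.

Lemma tsum_DeltaRM (V : lmodType k) (F : R -> R -> V) (x y : R) :
  balancedR RR F ->
  tsum (Delta (x * y)) F =
  \tsum_(x1, x2 <- Delta x) \tsum_(y1, y2 <- Delta y) F (x1 * y1) (x2 * y2).
Proof.
move=> Fb; rewrite DeltaR_M tsum_tsum //; apply: eq_tsum => x1 x2.
by rewrite tsum_tsum //; apply: eq_tsum => y1 y2; rewrite tsum_tpureE.
Qed.

(** [G] and [G'] are separate from [F] so that the summands of a goal have to match the Takeuchi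
    identity only up to provable equality. *)
Lemma tsum_DeltaR_takeuchi (V : lmodType k) (F G G' : R -> R -> V) (a : A)
    (x : R) :
  balancedR RR F -> (forall x1 x2, G x1 x2 = F (s a * x1) x2) ->
  (forall x1 x2, G' x1 x2 = F x1 (t a * x2)) ->
  tsum (Delta x) G = tsum (Delta x) G'.
Proof.
move=> Fb GE G'E; have := congr1 (fun u => tsum u F) (DeltaR_takeuchi RR a x).
rewrite !tsum_tsum // => e; apply: etrans (etrans _ e) _; apply: eq_tsum => *.
  by rewrite tsum_tpureE.
by rewrite tsum_tpureE.
Qed.

Lemma tsum_DeltaR_s (V : lmodType k) (F : R -> R -> V) (a : A) :
  balancedR RR F -> tsum (Delta (s a)) F = F 1 (s a).
Proof. by move=> Fb; rewrite DeltaR_s tsum_tpureE. Qed.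

Lemma tsum_DeltaR_t (V : lmodType k) (F : R -> R -> V) (a : A) :
  balancedR RR F -> tsum (Delta (t a)) F = F (t a) 1.
Proof. by move=> Fb; rewrite DeltaR_t tsum_tpureE. Qed.

(** A scalar s(a) between the first factors becomes t(a) between the second ones by balancedness of
    [F] and the Takeuchi condition for [Delta x]. This is what makes the factorwise product well
    defined. *)
Lemma balancedR_mul (V : lmodType k) (F : R -> R -> V) (x : R) :
  balancedR RR F ->
  balancedR RR (fun x1 x2 => \tsum_(y1, y2 <- Delta x) F (x1 * y1) (x2 * y2)).
Proof.
move=> Fb; bal => m i n.
apply: (@tsum_DeltaR_takeuchi _ (fun y1 y2 => F (m * y1) (n * y2)) _ _ i).
- by bal => *; rewrite !mulrA (balanced_eq Fb).
- by move=> *; rewrite mulrA.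
- by move=> *; rewrite mulrA.
Qed.

Lemma tsum_DeltaR_sM (V : lmodType k) (F : R -> R -> V) (a : A) (x : R) :
  balancedR RR F ->
  tsum (Delta (s a * x)) F = \tsum_(x1, x2 <- Delta x) F x1 (s a * x2).
Proof.
move=> Fb; rewrite tsum_DeltaRM // tsum_DeltaR_s; last exact: balancedR_mul.
by under eq_tsum => x1 x2 do rewrite mul1r.
Qed.

Lemma tsum_DeltaR_tM (V : lmodType k) (F : R -> R -> V) (a : A) (x : R) :
  balancedR RR F ->
  tsum (Delta (t a * x)) F = \tsum_(x1, x2 <- Delta x) F (t a * x1) x2.
Proof.
move=> Fb; rewrite tsum_DeltaRM // tsum_DeltaR_t; last exact: balancedR_mul.
by under eq_tsum => x1 x2 do rewrite mul1r.
Qed.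

Lemma tsum_DeltaR_Mt (V : lmodType k) (F : R -> R -> V) (a : A) (x : R) :
  balancedR RR F ->
  tsum (Delta (x * t a)) F = \tsum_(x1, x2 <- Delta x) F (x1 * t a) x2.
Proof.
move=> Fb; rewrite tsum_DeltaRM //; apply: eq_tsum => x1 x2.
by rewrite tsum_DeltaR_t ?mulr1 //; bal => *; rewrite !mulrA (balanced_eq Fb).
Qed.

Lemma tsum_DeltaR_coassoc (V : lmodType k) (F : R -> R -> R -> V) (x : R) :
  balancedR3 RR F ->
  \tsum_(x1, x2 <- Delta x) \tsum_(y, z <- Delta x1) F y z x2 =
  \tsum_(x1, x2 <- Delta x) \tsum_(y, z <- Delta x2) F x1 y z.
Proof.
move=> Fb; apply: tsum_triple (DeltaR_coassoc RR x) Fb; first by move=> *; lin.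
by move=> i j n; rewrite -!mulrA sR_tR_comm.
Qed.

Section Rtensor.
Variables (M : lmodType k) (r : M -> A -> M).

Lemma tpure_rtensor (m : M) (a : A) (x : R) :
  r m a ⊗ x = m ⊗ (x * t a) :> rtensor t r.
Proof. exact: (tpure_bal r (fun a x => x * t a)). Qed.

Lemma balanced_rtensor : balanced r (fun a x => x * t a)
  (fun m x => m ⊗ x : rtensor t r).
Proof. by bal => *; apply: tpure_rtensor. Qed.

Lemma balanced3_rtensor :
  balanced3 r (fun a x => x * t a) (fun a x => x * s a) (fun a x => x * t a)
    (fun m x y => (m ⊗ x) ⊗ y : rtensor t (rtensor_ract s (t := t) (r := r))).
Proof.
apply: balanced3_tpure => [a|a b x]; first by lin.
by rewrite -!mulrA sR_tR_comm.
Qed.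
End Rtensor.

Lemma balanced3_DeltaR (M V : lmodType k) (r : M -> A -> M)
    (F : M -> R -> R -> V) (m : M) :
  balanced3 r (fun a x => x * t a) (fun a x => x * s a) (fun a x => x * t a) F
    ->
  balancedR RR (F m).
Proof.
by case=> ? F2 F3 ? Fb; split=> *; [apply: F2 | apply: F3 | apply: Fb].
Qed.

(** Expresses that id (x) Delta is well defined on M (x)_A R: the coproduct of x t(a) carries t(a)
    on its first leg, next to the module factor. *)
Lemma balanced3_rtensor_DeltaR (M V : lmodType k) (r : M -> A -> M)
    (F : M -> R -> R -> V) :
  balanced3 r (fun a x => x * t a) (fun a x => x * s a) (fun a x => x * t a) F
    ->
  balanced r (fun a x => x * t a) (fun m x => tsum (Delta x) (F m)).
Proof.
move=> Fb; split=> [x|m|m a x].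
- by apply: linear_tsumr => *; lin.
- apply: (linear_comp (linear_tsum (balanced3_DeltaR _ Fb))); lin.
rewrite (tsum_DeltaR_Mt _ _ (balanced3_DeltaR m Fb)).
by apply: eq_tsum => *; rewrite (balanced3_eq12 Fb).
Qed.
End RightBialgebroid.

(** * Yetter-Drinfeld modules and their tensor product *)

Local Notation balancedM RR r := (balanced r (fun a X => X * tR RR a)).
Local Notation balancedT RR X Y :=
  (balanced (fun (x : yd_sort X) a => yd_act x (sR RR a))
     (fun a (y : yd_sort Y) => yd_act y (tR RR a))).

Section YetterDrinfeldModule.
Variables (k : fieldType) (A R : algType k) (RR : right_bialgebroid A R).
Variable X : yd RR.
Implicit Types (v : X) (a : A) (r : R).
Local Notation s := (sR RR).
Local Notation t := (tR RR).
Local Notation Delta := (DeltaR RR).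
Local Notation eps := (epsR RR).

Let Xcom := yd_comodule (ydP X).
Let Xmod := yd_module (ydP X).
Let Xbim := Rcom_bimodule Xcom.

Lemma linear_yd_coact : linear (@yd_coact _ _ _ _ X).
Proof. exact: Rcom_linear Xcom. Qed.

Lemma linear_yd_coact_comp (U : lmodType k) (h : U -> X) :
  linear h -> linear (fun u => yd_coact (h u)).
Proof. exact: linear_comp linear_yd_coact. Qed.

Lemma linear_yd_actl r : linear (fun v => yd_act v r).
Proof. by case: (rmod_bilinear Xmod) => _; apply. Qed.

Lemma linear_yd_actr v : linear (fun r => yd_act v r).
Proof. by case: (rmod_bilinear Xmod) => + _; apply. Qed.

Lemma linear_yd_ract a : linear (fun v => yd_ract v a).
Proof. by case: (rmod_bilinear (bimod_right Xbim)) => _; apply. Qed.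

Lemma linear_yd_ractr v : linear (fun a => yd_ract v a).
Proof. by case: (rmod_bilinear (bimod_right Xbim)) => + _; apply. Qed.

Lemma linear_yd_lact a : linear (fun v => yd_lact a v).
Proof. by case: (lmod_bilinear (bimod_left Xbim)) => + _; apply. Qed.

Lemma linear_yd_lactl v : linear (fun a => yd_lact a v).
Proof. by case: (lmod_bilinear (bimod_left Xbim)) => _; apply. Qed.

Lemma yd_act1 v : yd_act v 1 = v. Proof. exact: rmod_1 Xmod v. Qed.

Lemma yd_actM v r r' : yd_act v (r * r') = yd_act (yd_act v r) r'.
Proof. exact: rmod_M Xmod v r r'. Qed.

Lemma yd_actS v a : yd_act v (s a) = yd_ract v a.
Proof. exact: yd_act_sR (ydP X) v a. Qed.

Lemma yd_actT v a : yd_act v (t a) = yd_lact a v.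
Proof. exact: yd_act_tR (ydP X) v a. Qed.

Lemma yd_ract1 v : yd_ract v 1 = v.
Proof. exact: rmod_1 (bimod_right Xbim) v. Qed.

Lemma yd_lact1 v : yd_lact 1 v = v.
Proof. exact: lmod_1 (bimod_left Xbim) v. Qed.

Lemma yd_ractM v a a' : yd_ract v (a * a') = yd_ract (yd_ract v a) a'.
Proof. exact: rmod_M (bimod_right Xbim) v a a'. Qed.

Lemma yd_lactM v a a' : yd_lact (a * a') v = yd_lact a (yd_lact a' v).
Proof. exact: lmod_M (bimod_left Xbim) v a a'. Qed.

Lemma yd_ract_lact a v a' : yd_ract (yd_lact a v) a' = yd_lact a (yd_ract v a').
Proof. exact: bimod_comm Xbim a v a'. Qed.

Lemma yd_coact_ract v a :
  yd_coact (yd_ract v a) = \tsum_(x0, x1 <- yd_coact v) x0 ⊗ (x1 * s a).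
Proof.
rewrite -{1}[v]yd_lact1 (Rcom_bimod Xcom).
by apply: eq_tsum => x0 x1; rewrite sR1 mul1r.
Qed.

Lemma yd_coact_lact v a :
  yd_coact (yd_lact a v) = \tsum_(x0, x1 <- yd_coact v) x0 ⊗ (s a * x1).
Proof.
rewrite -{1}[v]yd_ract1 -yd_ract_lact (Rcom_bimod Xcom).
by apply: eq_tsum => x0 x1; rewrite sR1 mulr1.
Qed.

Lemma tsum_coact_counit v :
  \tsum_(x0, x1 <- yd_coact v) yd_ract x0 (eps x1) = v.
Proof. exact: (Rcom_counit Xcom v). Qed.

Section Functional.
Variables (V : lmodType k) (F : X -> R -> V).
Hypothesis Fb : balancedM RR (@yd_ract _ _ _ _ X) F.

Lemma tsum_coact_ract v a :
  tsum (yd_coact (yd_ract v a)) F =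
  \tsum_(x0, x1 <- yd_coact v) F x0 (x1 * s a).
Proof.
rewrite yd_coact_ract tsum_tsum //; apply: eq_tsum => x0 x1.
by rewrite tsum_tpureE.
Qed.

Lemma tsum_coact_lact v a :
  tsum (yd_coact (yd_lact a v)) F =
  \tsum_(x0, x1 <- yd_coact v) F x0 (s a * x1).
Proof.
rewrite yd_coact_lact tsum_tsum //; apply: eq_tsum => x0 x1.
by rewrite tsum_tpureE.
Qed.

Lemma tsum_coact_takeuchi (G G' : X -> R -> V) a v :
  (forall x0 x1, G x0 x1 = F (yd_lact a x0) x1) ->
  (forall x0 x1, G' x0 x1 = F x0 (t a * x1)) ->
  tsum (yd_coact v) G = tsum (yd_coact v) G'.
Proof.
move=> GE G'E; have := congr1 (fun u => tsum u F) (Rcom_takeuchi Xcom a v).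
rewrite !tsum_tsum // => e; apply: etrans (etrans _ e) _; apply: eq_tsum => *.
  by rewrite tsum_tpureE.
by rewrite tsum_tpureE.
Qed.

Lemma tsum_yd_compat v r :
  \tsum_(r1, r2 <- Delta r) \tsum_(x0, x1 <- yd_coact (yd_act v r2))
    F x0 (r1 * x1) =
  \tsum_(x0, x1 <- yd_coact v) \tsum_(r1, r2 <- Delta r)
    F (yd_act x0 r1) (x1 * r2).
Proof.
have := congr1 (fun u => tsum u F) (yd_compat (ydP X) v r).
rewrite !tsum_tsum // => e; apply: etrans (etrans _ e) _; apply: eq_tsum => *.
  by rewrite tsum_tsum //; apply: eq_tsum => *; rewrite tsum_tpureE.
by rewrite tsum_tsum //; apply: eq_tsum => *; rewrite tsum_tpureE.
Qed.
End Functional.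

Lemma tsum_coact_coassoc (V : lmodType k) (F : X -> R -> R -> V) v :
  balanced3 (@yd_ract _ _ _ _ X) (fun a X => X * t a) (fun a X => X * s a)
    (fun a X => X * t a) F ->
  \tsum_(x0, x1 <- yd_coact v) \tsum_(w, z <- yd_coact x0) F w z x1 =
  \tsum_(x0, x1 <- yd_coact v) \tsum_(w, z <- Delta x1) F x0 w z.
Proof.
move=> Fb; apply: tsum_triple (Rcom_coassoc Xcom v) Fb; first by move=> *; lin.
by move=> i j n; rewrite -!mulrA sR_tR_comm.
Qed.
End YetterDrinfeldModule.

(** The linearity lemmas concern bundled modules, while goals show only the underlying data. [yd_of]
    recovers the bundle, and is extended whenever a new kind of object acquires one. *)
Ltac yd_of y := lazymatch y with yd_dat ?X => X end.

Ltac lin_yd :=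
  match goal with
  | |- GRing.linear_for _ (fun x => @yd_act _ _ _ _ ?y (@?a x) ?r) =>
      let X := yd_of y in
      apply: (linear_comp (@linear_yd_actl _ _ _ _ X _)); lin
  | |- GRing.linear_for _ (fun x => @yd_act _ _ _ _ ?y ?z (@?a x)) =>
      let X := yd_of y in
      apply: (linear_comp (@linear_yd_actr _ _ _ _ X _)); lin
  | |- GRing.linear_for _ (fun x => @yd_ract _ _ _ _ ?y (@?a x) ?r) =>
      let X := yd_of y in
      apply: (linear_comp (@linear_yd_ract _ _ _ _ X _)); lin
  | |- GRing.linear_for _ (fun x => @yd_ract _ _ _ _ ?y ?z (@?a x)) =>
      let X := yd_of y in
      apply: (linear_comp (@linear_yd_ractr _ _ _ _ X _)); lin
  | |- GRing.linear_for _ (fun x => @yd_lact _ _ _ _ ?y ?r (@?a x)) =>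
      let X := yd_of y in
      apply: (linear_comp (@linear_yd_lact _ _ _ _ X _)); lin
  | |- GRing.linear_for _ (fun x => @yd_lact _ _ _ _ ?y (@?a x) ?r) =>
      let X := yd_of y in
      apply: (linear_comp (@linear_yd_lactl _ _ _ _ X _)); lin
  | |- GRing.linear_for _ (fun x => @yd_coact _ _ _ _ ?y (@?a x)) =>
      let X := yd_of y in
      apply: (@linear_yd_coact_comp _ _ _ _ X); lin
  | |- GRing.linear_for _ (fun x => yd_fun ?f (@?a x)) =>
      apply: (linear_comp (ydh_linear (yd_funP f))); lin
  | H : GRing.linear_for _ ?f |- GRing.linear_for _ (fun x => ?f (@?a x)) =>
      apply: (linear_comp H); lin
  end.

Ltac lin_ext ::= lin_yd.

Section YetterDrinfeldTensor.
Variables (k : fieldType) (A R : algType k) (RR : right_bialgebroid A R).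
Variables X Y : yd RR.
Implicit Types (v : X) (w : Y) (a : A) (r : R).
Local Notation s := (sR RR).
Local Notation t := (tR RR).
Local Notation Delta := (DeltaR RR).
Local Notation XY := (yd_tensor X Y).

Lemma tpure_ydT v w a :
  yd_ract v a ⊗ w = v ⊗ yd_lact a w :> yd_tens X Y.
Proof.
rewrite -yd_actS -yd_actT.
exact: (tpure_bal (fun (v : X) a => yd_act v (s a))
  (fun a (w : Y) => yd_act w (t a))).
Qed.

Lemma balanced_tensor_ract a :
  balancedT RR X Y (fun v w => v ⊗ yd_ract w a : yd_tens X Y).
Proof. by bal => v b w; rewrite yd_actS tpure_ydT yd_actT yd_ract_lact. Qed.

Lemma balanced_tensor_lact a :
  balancedT RR X Y (fun v w => yd_lact a v ⊗ w : yd_tens X Y).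
Proof. by bal => v b w; rewrite yd_actS -yd_ract_lact tpure_ydT yd_actT. Qed.

Lemma tensor_ractE v w a :
  @yd_ract _ _ _ _ XY (v ⊗ w) a = v ⊗ yd_ract w a.
Proof. exact: tsum_tpureE (balanced_tensor_ract a). Qed.

Lemma tensor_lactE v w a :
  @yd_lact _ _ _ _ XY a (v ⊗ w) = yd_lact a v ⊗ w.
Proof. exact: tsum_tpureE (balanced_tensor_lact a). Qed.

Lemma linear_tensor_ract a : linear (fun u : yd_tens X Y => @yd_ract _ _ _ _ XY
  u a).
Proof. exact: linear_tsum (balanced_tensor_ract a). Qed.

Lemma linear_tensor_lact a : linear (fun u : yd_tens X Y => @yd_lact _ _ _ _ XY
  a u).
Proof. exact: linear_tsum (balanced_tensor_lact a). Qed.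

Lemma linear_tensor_ractr u : linear (fun a => @yd_ract _ _ _ _ XY u a).
Proof. by apply: linear_tsumr => x y; lin. Qed.

Lemma linear_tensor_lactl u : linear (fun a => @yd_lact _ _ _ _ XY a u).
Proof. by apply: linear_tsumr => x y; lin. Qed.

Lemma balanced_tensor_coact1 (V : lmodType k) (F : yd_tens X Y -> R -> V)
  (x : X) (r : R) :
  balancedM RR (@yd_ract _ _ _ _ XY) F ->
  balancedM RR (@yd_ract _ _ _ _ Y) (fun y q => F (x ⊗ y) (r * q)).
Proof.
by move=> Fb; bal => y a q; rewrite -tensor_ractE (balanced_eq Fb) mulrA.
Qed.

(** A scalar taken off [x] lands on the leg y0, and only the Takeuchi condition for the whole
    coaction of [w] carries it to y1, in between [r] and y1. The sum over the legs of [w] therefore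
    has to stand inside. *)
Lemma balanced_tensor_coact2 (V : lmodType k) (F : yd_tens X Y -> R -> V)
  (w : Y) :
  balancedM RR (@yd_ract _ _ _ _ XY) F ->
  balancedM RR (@yd_ract _ _ _ _ X)
    (fun x r => \tsum_(y0, y1 <- yd_coact w) F (x ⊗ y0) (r * y1)).
Proof.
move=> Fb; bal => x a r.
apply: (tsum_coact_takeuchi (a := a) (balanced_tensor_coact1 x r Fb)) => y q.
  by rewrite tpure_ydT.
by rewrite mulrA.
Qed.

Lemma balanced_tensor_coact (V : lmodType k) (F : yd_tens X Y -> R -> V) :
  balancedM RR (@yd_ract _ _ _ _ XY) F ->
  balancedT RR X Y (fun v w =>
     \tsum_(x0, x1 <- yd_coact v) \tsum_(y0, y1 <- yd_coact w)
        F (x0 ⊗ y0) (x1 * y1)).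
Proof.
move=> Fb; bal.
- move=> w; apply: (linear_comp (linear_tsum _)); last by lin.
  exact: balanced_tensor_coact2.
- move=> v; apply: linear_tsumr => x0 x1.
  apply: (linear_comp (linear_tsum _)); last by lin.
  exact: balanced_tensor_coact1.
move=> v a w.
rewrite yd_actS yd_actT tsum_coact_ract; last exact: balanced_tensor_coact2.
apply: eq_tsum => x0 x1.
rewrite tsum_coact_lact; last exact: balanced_tensor_coact1.
by apply: eq_tsum => y0 y1; rewrite mulrA.
Qed.

Lemma balanced_tpure_tensor :
  balancedM RR (@yd_ract _ _ _ _ XY)
    (fun u r => u ⊗ r : rtensor t (@yd_tensor_ract _ _ _ _ X Y)).
Proof.
by bal => u a r; apply: (tpure_bal (@yd_ract _ _ _ _ XY)
  (fun a X => X * t a)).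
Qed.

Lemma linear_tensor_coact : linear (@yd_coact _ _ _ _ XY).
Proof. exact: linear_tsum (balanced_tensor_coact balanced_tpure_tensor). Qed.

Lemma linear_tensor_coact_comp (U : lmodType k) (h : U -> yd_tens X Y) :
  linear h -> linear (fun u => @yd_coact _ _ _ _ XY (h u)).
Proof. exact: linear_comp linear_tensor_coact. Qed.

Lemma tsum_tensor_coact (V : lmodType k) (F : yd_tens X Y -> R -> V) v w :
  balancedM RR (@yd_ract _ _ _ _ XY) F ->
  tsum (@yd_coact _ _ _ _ XY (v ⊗ w)) F =
     \tsum_(x0, x1 <- yd_coact v) \tsum_(y0, y1 <- yd_coact w)
        F (x0 ⊗ y0) (x1 * y1).
Proof.
move=> Fb; rewrite [yd_coact _](tsum_tpureE _ _
  (balanced_tensor_coact balanced_tpure_tensor)).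
rewrite tsum_tsum //; apply: eq_tsum => x0 x1.
rewrite tsum_tsum //; apply: eq_tsum => y0 y1.
by rewrite tsum_tpureE.
Qed.

Lemma balanced_tensor_act1 (V : lmodType k) (F : X -> Y -> V) (v : X) (w : Y) :
  balancedT RR X Y F ->
  balancedR RR (fun r1 r2 => F (yd_act v r1) (yd_act w r2)).
Proof. by move=> Fb; bal => r a r'; rewrite !yd_actM (balanced_eq Fb). Qed.

(** A scalar between [v] and [w] ends up in front of r1 or of r2, where the Takeuchi condition for
    [Delta r] exchanges s(a) and t(a). *)
Lemma balanced_tensor_act (V : lmodType k) (F : X -> Y -> V) r :
  balancedT RR X Y F ->
  balancedT RR X Y (fun v w =>
     \tsum_(r1, r2 <- Delta r) F (yd_act v r1) (yd_act w r2)).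
Proof.
move=> Fb; bal => v a w.
apply: (tsum_DeltaR_takeuchi (RR := RR) (a := a)
          (F := fun r1 r2 => F (yd_act v r1) (yd_act w r2))) => [|r1 r2|r1 r2].
- exact: balanced_tensor_act1.
- by rewrite yd_actM.
- by rewrite yd_actM.
Qed.

Lemma balanced_tpure_ydT :
  balancedT RR X Y (fun v w => v ⊗ w : yd_tens X Y).
Proof. by bal => v a w; rewrite yd_actS yd_actT tpure_ydT. Qed.

Lemma linear_tensor_actl r : linear (fun u : yd_tens X Y => @yd_act _ _ _ _ XY u
  r).
Proof. exact: linear_tsum (balanced_tensor_act r balanced_tpure_ydT). Qed.

Lemma linear_tensor_actr u : linear (fun r => @yd_act _ _ _ _ XY u r).
Proof.
apply: linear_tsumr => v w; apply: (linear_comp (linear_tsum _)); last by lin.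
exact: balanced_tensor_act1 balanced_tpure_ydT.
Qed.

Lemma tensor_actE v w r :
  @yd_act _ _ _ _ XY (v ⊗ w) r =
  \tsum_(r1, r2 <- Delta r) yd_act v r1 ⊗ yd_act w r2.
Proof. exact: tsum_tpureE (balanced_tensor_act r balanced_tpure_ydT). Qed.
End YetterDrinfeldTensor.

(** Temporary: it covers [yd_tensor X Y] before its Yetter-Drinfeld axioms are available. Afterwards
    [yd_of] produces the bundled tensor product and [lin_yd] suffices. *)
Ltac lin_tensor :=
  match goal with
  | |- GRing.linear_for _ (fun x => yd_act (@?a x) ?r) =>
      apply: (linear_comp (linear_tensor_actl _)); lin
  | |- GRing.linear_for _ (fun x => yd_act ?y (@?a x)) =>
      apply: (linear_comp (linear_tensor_actr _)); lin
  | |- GRing.linear_for _ (fun x => yd_ract (@?a x) ?r) =>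
      apply: (linear_comp (linear_tensor_ract _)); lin
  | |- GRing.linear_for _ (fun x => yd_ract ?y (@?a x)) =>
      apply: (linear_comp (linear_tensor_ractr _)); lin
  | |- GRing.linear_for _ (fun x => yd_lact ?r (@?a x)) =>
      apply: (linear_comp (linear_tensor_lact _)); lin
  | |- GRing.linear_for _ (fun x => yd_lact (@?a x) ?r) =>
      apply: (linear_comp (linear_tensor_lactl _)); lin
  | |- GRing.linear_for _ (fun x => yd_coact (@?a x)) =>
      apply: linear_tensor_coact_comp; lin
  end.

Ltac lin_ext ::= first [lin_yd | lin_tensor].

(** * The Yetter-Drinfeld axioms for the tensor product *)

Section TensorIsYetterDrinfeld.
Variables (k : fieldType) (A R : algType k) (RR : right_bialgebroid A R).
Variables X Y : yd RR.
Local Notation s := (sR RR).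
Local Notation t := (tR RR).
Local Notation Delta := (DeltaR RR).
Local Notation eps := (epsR RR).
Local Notation XY := (yd_tensor X Y).

Lemma tensor_bimodule : is_bimodule (@yd_lact _ _ _ _ XY) (@yd_ract _ _ _ _ XY).
Proof.
split; [split | split | ].
- split=> [a|u]; first exact: linear_tensor_lact.
  by apply: linear_tsumr => x y; lin.
- apply: tens_ext => [||x y]; try by [lin].
  by rewrite tensor_lactE yd_lact1.
- move=> u a b; move: u; apply: tens_ext => [||x y]; try by [lin].
  by rewrite !tensor_lactE yd_lactM.
- split=> [u|a]; last exact: linear_tensor_ract.
  by apply: linear_tsumr => x y; lin.
- apply: tens_ext => [||x y]; try by [lin].
  by rewrite tensor_ractE yd_ract1.
- move=> u a b; move: u; apply: tens_ext => [||x y]; try by [lin].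
  by rewrite !tensor_ractE yd_ractM.
- move=> a u b; move: u; apply: tens_ext => [||x y]; try by [lin].
  by rewrite !(tensor_ractE, tensor_lactE).
Qed.

Lemma tensor_coactE (x : X) (y : Y) : @yd_coact _ _ _ _ XY (x ⊗ y) =
  \tsum_(x0, x1 <- yd_coact x) \tsum_(y0, y1 <- yd_coact y)
    (x0 ⊗ y0) ⊗ (x1 * y1).
Proof.
exact: tsum_tpureE (balanced_tensor_coact
  (@balanced_tpure_tensor _ _ _ _ X Y)).
Qed.

Lemma tensor_coact_bimod (a : A) (u : XY) (b : A) :
  yd_coact (yd_ract (yd_lact a u) b) =
  \tsum_(u0, u1 <- yd_coact u) u0 ⊗ (s a * u1 * s b).
Proof.
have Fb : balancedM RR (@yd_ract _ _ _ _ XY) (fun u r => u ⊗ (s a * r * s b)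
    : rtensor t (@yd_tensor_ract _ _ _ _ X Y)).
  bal => x c r; rewrite (balanced_eq (@balanced_tpure_tensor _ _ _ _ X Y)).
  by rewrite -!mulrA sR_tR_comm.
move: u; apply: tens_ext => [||x y]; try by [lin].
rewrite tensor_lactE tensor_ractE tsum_tensor_coact // tensor_coactE.
rewrite tsum_coact_lact; last first.
  exact: balanced_tensor_coact2 (@balanced_tpure_tensor _ _ _ _ X Y).
apply: eq_tsum => x0 x1; rewrite tsum_coact_ract; last first.
  exact: balanced_tensor_coact1 (@balanced_tpure_tensor _ _ _ _ X Y).
by apply: eq_tsum => y0 y1; rewrite !mulrA.
Qed.

Lemma tensor_coact_takeuchi (a : A) (u : XY) :
  \tsum_(u0, u1 <- yd_coact u) yd_lact a u0 ⊗ u1 =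
    \tsum_(u0, u1 <- yd_coact u) u0 ⊗ (t a * u1)
    :> rtensor t (@yd_ract _ _ _ _ XY).
Proof.
have Tb := (@balanced_tpure_tensor _ _ _ _ X Y).
have Fb : balancedM RR (@yd_ract _ _ _ _ XY) (fun u r => u ⊗ (t a * r)
    : rtensor t (@yd_tensor_ract _ _ _ _ X Y)).
  by bal => x c r; rewrite (balanced_eq Tb) mulrA.
have Gb : balancedM RR (@yd_ract _ _ _ _ XY) (fun u r => yd_lact a u ⊗ r
    : rtensor t (@yd_tensor_ract _ _ _ _ X Y)).
  bal => x c r; rewrite -(balanced_eq Tb).
  by rewrite -(bimod_comm tensor_bimodule).
move: u; apply: tens_ext => [||x y]; try by [lin].
rewrite !tsum_tensor_coact //.
apply: (tsum_coact_takeuchi (balanced_tensor_coact2 y Tb)) => x0 x1.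
  by apply: eq_tsum => y0 y1; rewrite tensor_lactE.
by apply: eq_tsum => y0 y1; rewrite mulrA.
Qed.

Section Triple.
Variables (V : lmodType k) (F : XY -> R -> R -> V).
Hypothesis Fb : balanced3 (@yd_ract _ _ _ _ XY) (fun a x => x * t a)
  (fun a x => x * s a) (fun a x => x * t a) F.

Lemma balanced3_tensor_r (x : X) (p q : R) :
  balanced3 (@yd_ract _ _ _ _ Y) (fun a x => x * t a)
    (fun a x => x * s a) (fun a x => x * t a)
    (fun y p' q' => F (x ⊗ y) (p * p') (q * q')).
Proof.
split=> *; try by [lin].
  by rewrite -tensor_ractE (balanced3_eq12 Fb) mulrA.
by rewrite !mulrA (balanced3_eq23 Fb).
Qed.

Lemma balanced3_tensor_l (y : Y) :
  balanced3 (@yd_ract _ _ _ _ X) (fun a x => x * t a)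
    (fun a x => x * s a) (fun a x => x * t a)
    (fun x p q => \tsum_(y0, y1 <- yd_coact y) \tsum_(p', q' <- Delta y1)
       F (x ⊗ y0) (p * p') (q * q')).
Proof.
split; cbv beta; try by [lin].
- move=> m i n p.
  have /balanced3_rtensor_DeltaR Gb := balanced3_tensor_r m n p.
  apply: (tsum_coact_takeuchi Gb (a := i)) => y0 y1; first by rewrite tpure_ydT.
  rewrite (tsum_DeltaR_tM _ _ (balanced3_DeltaR _ (balanced3_tensor_r _ _ _))).
  by apply: eq_tsum => p' q'; rewrite !mulrA.
move=> m n i p; apply: eq_tsum => y0 y1.
apply: (tsum_DeltaR_takeuchi (RR := RR) (a := i)
  (F := fun p' q' => F (m ⊗ y0) (n * p') (p * q'))) => [|p' q'|p' q'].
- exact: balanced3_DeltaR (balanced3_tensor_r _ _ _).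
- by rewrite mulrA.
- by rewrite mulrA.
Qed.

(** Coassociativity is applied to [y] while the legs of [x] are held fixed, and then to [x] with the
    legs of [y] summed inside: in the legs of [x] the functional is balanced only after this
    summation. Multiplicativity of [Delta] joins the two results. *)
Lemma tsum_tensor_coassoc (u : XY) :
  \tsum_(u0, u1 <- yd_coact u) \tsum_(v0, v1 <- yd_coact u0) F v0 v1 u1 =
  \tsum_(u0, u1 <- yd_coact u) \tsum_(p, q <- Delta u1) F u0 p q.
Proof.
have Fb1 w : balancedM RR (@yd_ract _ _ _ _ XY) (fun u p => F u p w).
  by bal => *; rewrite (balanced3_eq12 Fb).
have Gb : balancedM RR (@yd_ract _ _ _ _ XY) (fun u0 u1 =>
    \tsum_(v0, v1 <- yd_coact u0) F v0 v1 u1).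
  bal => v a r.
  rewrite -[v in LHS](lmod_1 (bimod_left tensor_bimodule)) tensor_coact_bimod.
  rewrite tsum_tsum //; apply: eq_tsum => u0 u1.
  by rewrite tsum_tpureE // sR1 mul1r (balanced3_eq23 Fb).
have Hb := balanced3_rtensor_DeltaR Fb.
move: u; apply: tens_ext => [||x y]; try by [lin].
rewrite !tsum_tensor_coact //.
transitivity (\tsum_(x0, x1 <- yd_coact x) \tsum_(x0', x1' <- yd_coact x0)
  \tsum_(y0, y1 <- yd_coact y) \tsum_(p', q' <- Delta y1)
       F (x0' ⊗ y0) (x1' * p') (x1 * q')).
  apply: eq_tsum => x0 x1.
  under eq_tsum => y0 y1 do rewrite tsum_tensor_coact //.
  rewrite tsum_exchange; apply: eq_tsum => x0' x1'.
  exact: tsum_coact_coassoc (balanced3_tensor_r x0' x1' x1).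
rewrite (tsum_coact_coassoc _ (balanced3_tensor_l y)).
apply: eq_tsum => x0 x1; rewrite tsum_exchange; apply: eq_tsum => y0 y1.
by rewrite tsum_DeltaRM //; apply: balanced3_DeltaR Fb.
Qed.
End Triple.

Lemma tensor_coact_coassoc (u : XY) :
  (\tsum_(u0, u1 <- yd_coact u) yd_coact u0 ⊗ u1
     : rtensor t (rtensor_ract s (t := t) (r := @yd_ract _ _ _ _ XY))) =
  \tsum_(u0, u1 <- yd_coact u) \tsum_(p, q <- Delta u1) (u0 ⊗ p) ⊗ q.
Proof.
rewrite -(tsum_tensor_coassoc (balanced3_rtensor _ _)).
apply: eq_tsum => u0 u1; rewrite -[yd_coact u0 in LHS]tsum_tpure.
by rewrite (raddf_tsum (h := fun v => v ⊗ u1)) //; lin.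
Qed.

Lemma tensor_counit (u : XY) :
  \tsum_(u0, u1 <- yd_coact u) yd_ract u0 (eps u1) = u.
Proof.
have XYb : balancedM RR (@yd_ract _ _ _ _ XY) (fun u r => yd_ract u (eps r)).
  by bal => v a r; rewrite epsR_Mt (rmod_M (bimod_right tensor_bimodule)).
have Yb : balancedM RR (@yd_ract _ _ _ _ Y) (fun y r => yd_ract y (eps r)).
  by bal => y a r; rewrite epsR_Mt yd_ractM.
move: u; apply: tens_ext => [||x y]; try by [lin].
rewrite tsum_tensor_coact //.
(* As eps(x1 y1) = eps(s(eps(x1)) y1), the counit of x1 can be made a left scalar on [y].
   Counitality then applies to [y] and, once the scalar has crossed to x0, to [x]. *)
transitivity (\tsum_(x0, x1 <- yd_coact x) x0 ⊗ yd_lact (eps x1) y : XY).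
  apply: eq_tsum => x0 x1.
  rewrite -[yd_lact _ y](tsum_coact_counit) tsum_coact_lact //.
  rewrite (raddf_tsum (h := fun v => x0 ⊗ v)); last by lin.
  by apply: eq_tsum => y0 y1; rewrite tensor_ractE epsR_sM.
under eq_tsum => x0 x1 do rewrite -tpure_ydT.
by rewrite -(raddf_tsum (h := fun v => v ⊗ y)) ?tsum_coact_counit //; lin.
Qed.

Lemma tensor_module : is_right_module (@yd_act _ _ _ _ XY).
Proof.
split.
- by split=> [u|r]; lin.
- apply: tens_ext => [||x y]; try by [lin].
  rewrite tensor_actE tsum_DeltaR1 ?yd_act1 //.
  exact: balanced_tensor_act1 (@balanced_tpure_ydT _ _ _ _ X Y).
move=> u r r'; move: u; apply: tens_ext => [||x y]; try by [lin].
rewrite !tensor_actE tsum_DeltaRM; last first.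
  exact: balanced_tensor_act1 (@balanced_tpure_ydT _ _ _ _ X Y).
rewrite (raddf_tsum (h := fun u : XY => yd_act u r')); last by lin.
apply: eq_tsum => r1 r2; rewrite tensor_actE.
by apply: eq_tsum => r1' r2'; rewrite !yd_actM.
Qed.

Section Compatibility.
Variables (V : lmodType k) (F : XY -> R -> V).
Hypothesis Fb : balancedM RR (@yd_ract _ _ _ _ XY) F.

Let Fmul p : balancedM RR (@yd_ract _ _ _ _ XY) (fun u q => F u (p * q)).
Proof. by bal => u a q; rewrite (balanced_eq Fb) mulrA. Qed.

Let F_act (u : XY) (p : R) : balancedR RR
  (fun r1 r2 => F (yd_act u r1) (p * r2)).
Proof.
bal => r1 a r2.
rewrite (rmod_M tensor_module) mulrA -(balanced_eq Fb); congr F.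
move: {r1}(yd_act u r1); apply: tens_ext => [||x y]; try by [lin].
rewrite tensor_actE tensor_ractE tsum_DeltaR_s; last first.
  exact: balanced_tensor_act1 (@balanced_tpure_ydT _ _ _ _ X Y).
by rewrite yd_act1 yd_actS.
Qed.

Let balanced3_l (x : X) (y : Y) : balancedR3 RR (fun p q q' =>
  \tsum_(x0, x1 <- yd_coact (yd_act x q))
    \tsum_(y0, y1 <- yd_coact (yd_act y q')) F (x0 ⊗ y0) (p * (x1 * y1))).
Proof.
have Fb2 p := balanced_tensor_coact2 _ (Fmul p).
have Fb1 p x0 x1 := balanced_tensor_coact1 x0 x1 (Fmul p).
split; cbv beta; try by [lin].
- move=> p a q q'; rewrite yd_actM yd_actT tsum_coact_lact //.
  apply: eq_tsum => x0 x1; apply: eq_tsum => y0 y1.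
  by rewrite !mulrA.
- move=> p q a q'; rewrite !yd_actM yd_actT yd_actS tsum_coact_ract //.
  apply: eq_tsum => x0 x1; rewrite tsum_coact_lact //.
  by apply: eq_tsum => y0 y1; rewrite !mulrA.
Qed.

Let balanced3_r (x : X) (y : Y) p' : balancedR3 RR (fun p q q' =>
    \tsum_(y0, y1 <- yd_coact (yd_act y q'))
      F (yd_act x p ⊗ y0) (p' * q * y1)).
Proof.
have Fb1 q x0 x1 := balanced_tensor_coact1 x0 x1 (Fmul q).
have Fb2 x0 x1 := balanced_tensor_coact1 x0 x1 Fb.
split; cbv beta; try by [lin].
- move=> p a q q'; rewrite yd_actM yd_actS.
  apply: (tsum_coact_takeuchi (Fb2 (yd_act x p) (p' * q)) (a := a)) => y0 y1.
    by rewrite tpure_ydT.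
  by rewrite !mulrA.
- move=> p q a q'; rewrite !yd_actM yd_actT tsum_coact_lact //.
  by apply: eq_tsum => y0 y1; rewrite !mulrA.
Qed.

(** Of the three legs of the iterated coproduct of [r], the identity for [x] uses the first two and
    the identity for [y] the last two. Coassociativity regroups the legs before, between and after
    these uses. *)
Lemma tsum_tensor_compat (u : XY) (r : R) :
  \tsum_(r1, r2 <- Delta r) \tsum_(u0, u1 <- yd_coact (yd_act u r2))
    F u0 (r1 * u1) =
  \tsum_(u0, u1 <- yd_coact u) \tsum_(r1, r2 <- Delta r)
    F (yd_act u0 r1) (u1 * r2).
Proof.
have Gb : balancedM RR (@yd_ract _ _ _ _ XY)
    (fun u0 u1 => \tsum_(r1, r2 <- Delta r) F (yd_act u0 r1) (u1 * r2)).
  bal => v a p.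
  apply: (tsum_DeltaR_takeuchi (RR := RR) (a := a)
    (F := fun r1 r2 => F (yd_act v r1) (p * r2))) => // r1 r2;
      last by rewrite mulrA.
  rewrite (rmod_M tensor_module); congr (F (yd_act _ _) _).
  move: {p} v; apply: tens_ext => [||x y]; try by [lin].
  rewrite tensor_actE tensor_ractE tsum_DeltaR_s ?yd_act1 ?yd_actS //.
  exact: balanced_tensor_act1 (@balanced_tpure_ydT _ _ _ _ X Y).
move: u; apply: tens_ext => [||x y]; try by [lin].
rewrite tsum_tensor_coact //.
transitivity (\tsum_(r1, r2 <- Delta r) \tsum_(p, q <- Delta r2)
  \tsum_(x0, x1 <- yd_coact (yd_act x p))
    \tsum_(y0, y1 <- yd_coact (yd_act y q)) F (x0 ⊗ y0) (r1 * (x1 * y1))).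
  apply: eq_tsum => r1 r2; rewrite tensor_actE.
  rewrite (raddf_tsum (h := fun v : XY => \tsum_(u0, u1 <- yd_coact v) F u0
    (r1 * u1))); last by lin.
  by apply: eq_tsum => p q; rewrite tsum_tensor_coact.
rewrite -(tsum_DeltaR_coassoc _ (balanced3_l x y)).
transitivity (\tsum_(r1, r2 <- Delta r) \tsum_(x0, x1 <- yd_coact x)
  \tsum_(p, q <- Delta r1)
    \tsum_(y0, y1 <- yd_coact (yd_act y r2)) F (yd_act x0 p ⊗ y0)
      (x1 * q * y1)).
  apply: eq_tsum => r1 r2.
  rewrite -(tsum_yd_compat (F := fun x0 p =>
    \tsum_(y0, y1 <- yd_coact (yd_act y r2)) F (x0 ⊗ y0) (p * y1)));
      last exact: balanced_tensor_coact2.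
  apply: eq_tsum => p q; apply: eq_tsum => x0 x1; apply: eq_tsum => y0 y1.
  by rewrite mulrA.
rewrite tsum_exchange; apply: eq_tsum => x0 x1.
rewrite (tsum_DeltaR_coassoc _ (balanced3_r x0 y x1)).
transitivity (\tsum_(r1, r2 <- Delta r) \tsum_(y0, y1 <- yd_coact y)
  \tsum_(p, q <- Delta r2) F (yd_act x0 r1 ⊗ yd_act y0 p) (x1 * (y1 * q))).
  apply: eq_tsum => r1 r2.
  rewrite -(tsum_yd_compat (F := fun y0 q => F (yd_act x0 r1 ⊗ y0) (x1 * q)));
    last exact: balanced_tensor_coact1.
  apply: eq_tsum => p q; apply: eq_tsum => y0 y1.
  by rewrite mulrA.
rewrite tsum_exchange; apply: eq_tsum => y0 y1.
rewrite -(tsum_DeltaR_coassoc (F := fun p q q' => F (yd_act x0 p ⊗ yd_act y0 q)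
  (x1 * (y1 * q')))); last first.
  split; cbv beta; try by [lin].
    by move=> p a q q'; rewrite !yd_actM yd_actS yd_actT tpure_ydT.
  move=> p q a q'; rewrite yd_actM yd_actS -tensor_ractE (balanced_eq Fb).
  by rewrite !mulrA.
apply: eq_tsum => r1 r2; rewrite tensor_actE.
rewrite (raddf_tsum (h := fun v : XY => F v (x1 * y1 * r2))); last by lin.
by apply: eq_tsum => p q; rewrite mulrA.
Qed.
End Compatibility.

Lemma tensor_coact_comodule :
  is_right_Rcomodule (@yd_lact _ _ _ _ XY) (@yd_coact _ _ _ _ XY).
Proof.
split.
- exact: tensor_bimodule.
- exact: linear_tensor_coact.
- exact: tensor_coact_bimod.
- exact: tensor_coact_takeuchi.
- exact: tensor_coact_coassoc.
- exact: tensor_counit.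
Qed.

Lemma tensor_is_yd : is_yd XY.
Proof.
split.
- exact: tensor_coact_comodule.
- exact: tensor_module.
- move=> u a; move: u; apply: tens_ext => [||x y]; try by [lin].
  rewrite tensor_actE tensor_ractE tsum_DeltaR_s ?yd_act1 ?yd_actS //.
  exact: balanced_tensor_act1 (@balanced_tpure_ydT _ _ _ _ X Y).
- move=> u a; move: u; apply: tens_ext => [||x y]; try by [lin].
  rewrite tensor_actE tensor_lactE tsum_DeltaR_t ?yd_act1 ?yd_actT //.
  exact: balanced_tensor_act1 (@balanced_tpure_ydT _ _ _ _ X Y).
- exact: tsum_tensor_compat (@balanced_tpure_tensor _ _ _ _ X Y).
Qed.
End TensorIsYetterDrinfeld.

(** Canonical, so that lemmas on bundled modules apply to tensor products, also iterated ones, by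
    unification. *)
Canonical tensor_yd (k : fieldType) (A R : algType k)
    (RR : right_bialgebroid A R) (X Y : yd RR) : yd RR := Yd (tensor_is_yd X Y).

(** * The unit object and morphisms *)

Section Unit.
Variables (k : fieldType) (A R : algType k) (RR : right_bialgebroid A R).
Local Notation s := (sR RR).
Local Notation t := (tR RR).
Local Notation Delta := (DeltaR RR).
Local Notation eps := (epsR RR).
Local Notation I := (yd_unit RR).

Lemma tpure_unit (a : A) (r : R) :
  a ⊗ r = 1 ⊗ (r * t a) :> rtensor t (@yd_ract _ _ _ _ I).
Proof. by rewrite -tpure_rtensor [yd_ract _ _]mul1r. Qed.

Lemma unit_is_yd : is_yd I.
Proof.
have Tb := balanced_rtensor RR (@yd_ract _ _ _ _ I).
split; first split.
- split; [split | split | ].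
  + by split=> [a|x] /=; lin.
  + exact: mul1r.
  + by move=> *; rewrite /= mulrA.
  + by split=> [a|x] /=; lin.
  + exact: mulr1.
  + by move=> *; rewrite /= mulrA.
  + by move=> *; rewrite /= mulrA.
- by rewrite /=; lin.
- move=> a x b /=; rewrite tsum_tpureE; first by rewrite !rmorphM.
  bal => y c r; rewrite tpure_rtensor; congr (_ ⊗ _).
  by rewrite -!mulrA sR_tR_comm.
- move=> a x /=; rewrite !tsum_tpureE.
  + by rewrite mulr1 tpure_unit sR_tR_comm.
  + by bal => y c r; rewrite tpure_rtensor mulrA.
  + by bal => y c r; rewrite /= mulrA; apply:
      (tpure_rtensor RR (@yd_ract _ _ _ _ I)).
- move=> x; rewrite !tsum_tpureE /=.
  + by rewrite rmorph1 DeltaR_s tsum_tpureE //;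
      exact: balanced3_DeltaR (balanced3_rtensor _ _).
  + exact: (balanced3_rtensor_DeltaR (balanced3_rtensor RR
      (@yd_ract _ _ _ _ I))).
  + bal => y c r; rewrite /= (rmorphM s).
    exact: (balanced3_eq23 (balanced3_rtensor RR (@yd_ract _ _ _ _ I))).
- move=> x; rewrite tsum_tpureE /=; first by rewrite epsR_s mul1r.
  by bal => y c r; rewrite /= epsR_Mt mulrA.
- split.
  + by split=> [x|r] /=; lin.
  + by move=> x /=; rewrite mulr1 epsR_s.
  + by move=> x r r' /=; rewrite epsR_sM mulrA.
- by move=> x a /=; rewrite -rmorphM epsR_s.
- by move=> x a /=; rewrite epsR_Mt epsR_s.
move=> x r /=; rewrite tsum_tpureE.
  (* Both sides of the Yetter-Drinfeld identity equal [1 ⊗ (s x * r)]: the left one by the right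
     counit law for [s x * r], the right one by the left counit law for [r]. *)
  transitivity (\tsum_(r1, r2 <- Delta (s x * r)) 1 ⊗ (r1 * s (eps r2))
    : rtensor t (@yd_ract _ _ _ _ I)).
    rewrite tsum_DeltaR_sM; last first.
      bal => p a q; rewrite epsR_Mt rmorphM; congr (_ ⊗ _).
      by rewrite mulrA.
    apply: eq_tsum => r1 r2; rewrite tsum_tpureE //.
    by bal => y c p; rewrite tpure_rtensor mulrA.
  rewrite -(raddf_tsum (h := fun p => 1 ⊗ p)) ?DeltaR_counitr; last by lin.
  transitivity (\tsum_(r1, r2 <- Delta r) 1 ⊗ (s x * (r2 * t (eps r1)))
    : rtensor t (@yd_ract _ _ _ _ I)).
    rewrite -(raddf_tsum (h := fun p => 1 ⊗ (s x * p))) ?DeltaR_counitl //.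
    by lin.
  apply: eq_tsum => r1 r2.
  by rewrite sR1 mul1r [RHS]tpure_unit mulrA.
bal => y c p.
apply: (tsum_DeltaR_takeuchi (RR := RR) (a := c)
  (F := fun r1 r2 => eps (s y * r1) ⊗ (p * r2))) => [|r1 r2|r1 r2].
- bal => q a q'; rewrite !mulrA epsR_Ms; exact: tpure_rtensor.
- by rewrite /= rmorphM mulrA.
- by rewrite mulrA.
Qed.
End Unit.

Canonical unit_yd (k : fieldType) (A R : algType k)
    (RR : right_bialgebroid A R) : yd RR := Yd (unit_is_yd RR).

Ltac yd_of y ::=
  lazymatch y with
  | yd_dat ?X => X
  | yd_tensor ?P ?Q =>
      let p := yd_of P in let q := yd_of Q in constr:(tensor_yd p q)
  | yd_unit ?RR => constr:(unit_yd RR)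
  end.

Ltac lin_ext ::= lin_yd.

(** * Morphisms of Yetter-Drinfeld modules and their tensor products *)

Section Homs.
Variables (k : fieldType) (A R : algType k) (RR : right_bialgebroid A R).
Local Notation t := (tR RR).

Lemma balanced_hom (X Y : yd RR) (V : lmodType k) (f : X -> Y)
    (F : Y -> R -> V) :
  linear f -> (forall x a, f (yd_ract x a) = yd_ract (f x) a) ->
  balancedM RR (@yd_ract _ _ _ _ Y) F ->
  balancedM RR (@yd_ract _ _ _ _ X) (fun x r => F (f x) r).
Proof.
by move=> fL fr Fb; bal => x a r; rewrite fr (balanced_eq Fb).
Qed.

Lemma balanced_hom_rtensor (X Y : yd RR) (f : X -> Y) :
  linear f -> (forall x a, f (yd_ract x a) = yd_ract (f x) a) ->
  balancedM RR (@yd_ract _ _ _ _ X)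
    (fun x r => f x ⊗ r : rtensor t (@yd_ract _ _ _ _ Y)).
Proof.
move=> fL fr; exact: balanced_hom (balanced_rtensor RR (@yd_ract _ _ _ _ Y)).
Qed.

Lemma tsum_hom_coact (X Y : yd RR) (V : lmodType k) (f : yd_hom X Y)
    (F : Y -> R -> V) (x : X) :
  balancedM RR (@yd_ract _ _ _ _ Y) F ->
  tsum (yd_coact (f x)) F = \tsum_(x0, x1 <- yd_coact x) F (f x0) x1.
Proof.
move=> Fb; rewrite (ydh_coact (yd_funP f)) tsum_tsum //.
by apply: eq_tsum => x0 x1; rewrite tsum_tpureE.
Qed.

(** Consequently the inverses of the associator, of the unitors and, for full modules, of the
    braiding have to be found only as maps. *)
Lemma yd_hom_inverse (X Y : yd RR) (f : yd_hom X Y) (g : Y -> X) :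
  cancel f g -> cancel g f -> is_yd_hom g.
Proof.
move=> fK gK; have [fL fl fr fa fc] := yd_funP f.
have gL : linear g.
  by move=> c x y; apply: (can_inj fK); rewrite fL !gK.
have gr x a : g (yd_ract x a) = yd_ract (g x) a.
  by apply: (can_inj fK); rewrite fr !gK.
split=> // [a x|x r|x].
- by apply: (can_inj fK); rewrite fl !gK.
- by apply: (can_inj fK); rewrite fa !gK.
rewrite -[in RHS](gK x) fc tsum_tsum; last exact: balanced_hom_rtensor.
rewrite -[LHS]tsum_tpure; apply: eq_tsum => x0 x1.
by rewrite tsum_tpureE ?fK //; exact: balanced_hom_rtensor.
Qed.

Section TensorHom.
Variables (X X' Y Y' : yd RR) (f : yd_hom X X') (g : yd_hom Y Y').

Definition tensor_map (u : yd_tensor X Y) : yd_tensor X' Y' :=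
  \tsum_(x, y <- u) f x ⊗ g y.

Let Fb : balancedT RR X Y (fun x y => f x ⊗ g y : yd_tensor X' Y').
Proof.
bal => x a y; rewrite !yd_actS !yd_actT (ydh_ract (yd_funP f)).
by rewrite (ydh_lact (yd_funP g)) tpure_ydT.
Qed.

Lemma tensor_mapE x y : tensor_map (x ⊗ y) = f x ⊗ g y.
Proof. exact: tsum_tpureE Fb. Qed.

Lemma linear_tensor_map : linear tensor_map.
Proof. exact: linear_tsum Fb. Qed.

Lemma tensor_map_is_hom : is_yd_hom tensor_map.
Proof.
have mL := linear_tensor_map.
have mr u a : tensor_map (yd_ract u a) = yd_ract (tensor_map u) a.
  move: u; apply: tens_ext => [||x y]; try by [lin].
  by rewrite tensor_mapE !tensor_ractE tensor_mapE (ydh_ract (yd_funP g)).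
split=> // [a u|u r|u]; move: u; apply: tens_ext => [||x y]; try by [lin].
- by rewrite tensor_mapE !tensor_lactE tensor_mapE (ydh_lact (yd_funP f)).
- rewrite tensor_mapE !tensor_actE (raddf_tsum (h := tensor_map)) //.
  apply: eq_tsum => r1 r2.
  by rewrite tensor_mapE (ydh_act (yd_funP f)) (ydh_act (yd_funP g)).
- have Gb := balanced_hom_rtensor mL mr.
  by apply: (linear_comp (linear_tsum Gb)); lin.
rewrite tsum_tensor_coact; last exact: balanced_hom_rtensor mL mr.
rewrite tensor_mapE tensor_coactE.
have Tb := @balanced_tpure_tensor _ _ _ _ X' Y'.
rewrite tsum_hom_coact; last exact: balanced_tensor_coact2 Tb.
apply: eq_tsum => x0 x1.
rewrite tsum_hom_coact; last exact: balanced_tensor_coact1 Tb.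
by apply: eq_tsum => y0 y1; rewrite tensor_mapE.
Qed.

Definition tensor_hom : yd_hom (yd_tensor X Y) (yd_tensor X' Y') :=
  YdHom tensor_map_is_hom.
End TensorHom.
End Homs.

(** * The associator *)

Section Associativity.
Variables (k : fieldType) (A R : algType k) (RR : right_bialgebroid A R).
Variables X Y Z : yd RR.
Local Notation Delta := (DeltaR RR).

Lemma tens3_ext (V : lmodType k) (F G : yd_tensor (yd_tensor X Y) Z -> V) :
  linear F -> linear G ->
  (forall x y z, F ((x ⊗ y) ⊗ z) = G ((x ⊗ y) ⊗ z)) -> forall u, F u = G u.
Proof.
move=> FL GL FG; apply: tens_ext => // u z; move: u.
by apply: tens_ext => // [c u v|c u v]; rewrite tpureDl tpureZl (FL, GL).
Qed.

Lemma tens3_extV (V : lmodType k) (F G : yd_tensor X (yd_tensor Y Z) -> V) :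
  linear F -> linear G ->
  (forall x y z, F (x ⊗ (y ⊗ z)) = G (x ⊗ (y ⊗ z))) -> forall u, F u = G u.
Proof.
move=> FL GL FG; apply: tens_ext => // x u; move: u.
by apply: tens_ext => // [c u v|c u v]; rewrite tpureDr tpureZr (FL, GL).
Qed.

Definition assoc_map (u : yd_tensor (yd_tensor X Y) Z) :
    yd_tensor X (yd_tensor Y Z) :=
  \tsum_(v, z <- u) \tsum_(x, y <- v) x ⊗ (y ⊗ z).

Definition assocV_map (u : yd_tensor X (yd_tensor Y Z)) :
    yd_tensor (yd_tensor X Y) Z :=
  \tsum_(x, v <- u) \tsum_(y, z <- v) (x ⊗ y) ⊗ z.

Let inner_balanced z :
  balancedT RR X Y (fun x y => x ⊗ (y ⊗ z) : yd_tensor X (yd_tensor Y Z)).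
Proof.
bal => x a y; rewrite !yd_actS !yd_actT.
by rewrite (tpure_ydT (Y := tensor_yd Y Z)) tensor_lactE.
Qed.

Let outer_balanced : balancedT RR (yd_tensor X Y) Z (fun v z =>
  \tsum_(x, y <- v) x ⊗ (y ⊗ z) : yd_tensor X (yd_tensor Y Z)).
Proof.
bal => v a z; move: v; apply: tens_ext => [||x y]; try by [lin].
by rewrite (yd_actS (X := tensor_yd X Y)) yd_actT tensor_ractE !tsum_tpureE //
  tpure_ydT.
Qed.

Let inner_balancedV x :
  balancedT RR Y Z (fun y z => (x ⊗ y) ⊗ z : yd_tensor (yd_tensor X Y) Z).
Proof.
bal => y a z; rewrite !yd_actS !yd_actT.
by rewrite -(tpure_ydT (X := tensor_yd X Y)) tensor_ractE.
Qed.

Let outer_balancedV : balancedT RR X (yd_tensor Y Z) (fun x v =>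
  \tsum_(y, z <- v) (x ⊗ y) ⊗ z : yd_tensor (yd_tensor X Y) Z).
Proof.
bal => x a v; move: v; apply: tens_ext => [||y z]; try by [lin].
by rewrite yd_actS (yd_actT (X := tensor_yd Y Z)) tensor_lactE !tsum_tpureE //
  tpure_ydT.
Qed.

Lemma assoc_mapE x y z : assoc_map ((x ⊗ y) ⊗ z) = x ⊗ (y ⊗ z).
Proof. by rewrite [LHS](tsum_tpureE _ _ outer_balanced) tsum_tpureE. Qed.

Lemma assocV_mapE x y z : assocV_map (x ⊗ (y ⊗ z)) = (x ⊗ y) ⊗ z.
Proof. by rewrite [LHS](tsum_tpureE _ _ outer_balancedV) tsum_tpureE. Qed.

Lemma linear_assoc_map : linear assoc_map.
Proof. exact: linear_tsum outer_balanced. Qed.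

Lemma linear_assocV_map : linear assocV_map.
Proof. exact: linear_tsum outer_balancedV. Qed.

Lemma assoc_mapK : cancel assoc_map assocV_map.
Proof.
have ? := linear_assoc_map; have ? := linear_assocV_map.
apply: tens3_ext => [||x y z]; try by [lin].
by rewrite assoc_mapE assocV_mapE.
Qed.

Lemma assocV_mapK : cancel assocV_map assoc_map.
Proof.
have ? := linear_assoc_map; have ? := linear_assocV_map.
apply: tens3_extV => [||x y z]; try by [lin].
by rewrite assocV_mapE assoc_mapE.
Qed.

(** Compatibility with the action is coassociativity of [Delta]; compatibility with the coaction is
    associativity of the product of R. *)
Lemma assoc_map_is_hom : is_yd_hom assoc_map.
Proof.
have aL := linear_assoc_map.
have ar u a : assoc_map (yd_ract u a) = yd_ract (assoc_map u) a.
  move: u; apply: tens3_ext => [||x y z]; try by [lin].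
  by rewrite assoc_mapE !tensor_ractE assoc_mapE.
have Gb := balanced_hom_rtensor aL ar.
have Tb := @balanced_tpure_tensor _ _ _ _ X (yd_tensor Y Z).
split=> // [a u|u r|u]; move: u; apply: tens3_ext => [||x y z]; try by [lin].
- by rewrite assoc_mapE !tensor_lactE assoc_mapE.
- rewrite assoc_mapE !tensor_actE (raddf_tsum (h := assoc_map)) //.
  have Bb : balancedR3 RR (fun p q r => yd_act x p ⊗ (yd_act y q ⊗ yd_act z r)
      : yd_tensor X (yd_tensor Y Z)).
    split; cbv beta; try by [lin].
      by move=> p a q r'; rewrite !yd_actM yd_actS yd_actT
        (tpure_ydT (Y := tensor_yd Y Z)) tensor_lactE.
    by move=> p q a r'; rewrite !yd_actM yd_actS yd_actT tpure_ydT.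
  transitivity (\tsum_(r1, r2 <- Delta r) \tsum_(p, q <- Delta r1)
    yd_act x p ⊗ (yd_act y q ⊗ yd_act z r2) : yd_tensor X (yd_tensor Y Z)).
    apply: eq_tsum => r1 r2; rewrite tensor_actE.
    rewrite (raddf_tsum (h := fun v => assoc_map (v ⊗ _))); last by lin.
    by apply: eq_tsum => p q; rewrite assoc_mapE.
  rewrite tsum_DeltaR_coassoc //; apply: eq_tsum => r1 r2.
  by rewrite tensor_actE (raddf_tsum (h := fun v => yd_act x r1 ⊗ v)) //; lin.
rewrite assoc_mapE tensor_coactE tsum_tensor_coact //.
rewrite tsum_tensor_coact; last exact: balanced_tensor_coact2 Gb.
apply: eq_tsum => x0 x1.
rewrite tsum_tensor_coact; last exact: balanced_tensor_coact1 Tb.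
apply: eq_tsum => y0 y1; apply: eq_tsum => z0 z1.
by rewrite assoc_mapE mulrA.
Qed.

Definition assoc_hom : yd_hom (yd_tensor (yd_tensor X Y) Z)
  (yd_tensor X (yd_tensor Y Z)) := YdHom assoc_map_is_hom.

Definition assocV_hom : yd_hom (yd_tensor X (yd_tensor Y Z))
    (yd_tensor (yd_tensor X Y) Z) :=
  YdHom (yd_hom_inverse (f := assoc_hom) assoc_mapK assocV_mapK).
End Associativity.

(** * The unitors *)

Section Unitors.
Variables (k : fieldType) (A R : algType k) (RR : right_bialgebroid A R).
Variable X : yd RR.
Local Notation eps := (epsR RR).
Local Notation I := (yd_unit RR).
Local Notation one := (1 : yd_unit RR).

Lemma tpure_lunit (a : I) (x : X) : a ⊗ x = one ⊗ yd_lact a x :> yd_tensor I X.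
Proof. by rewrite -tpure_ydT [yd_ract _ _]mul1r. Qed.

Lemma tpure_runit (x : X) (a : I) : x ⊗ a = yd_ract x a ⊗ one :> yd_tensor X I.
Proof. by rewrite tpure_ydT [yd_lact _ _]mulr1. Qed.

Lemma lunit_ext (V : lmodType k) (F G : yd_tensor I X -> V) :
  linear F -> linear G -> (forall x, F (one ⊗ x) = G (one ⊗ x)) ->
  forall u, F u = G u.
Proof. by move=> FL GL FG; apply: tens_ext => // a x; rewrite tpure_lunit. Qed.

Lemma runit_ext (V : lmodType k) (F G : yd_tensor X I -> V) :
  linear F -> linear G -> (forall x, F (x ⊗ one) = G (x ⊗ one)) ->
  forall u, F u = G u.
Proof. by move=> FL GL FG; apply: tens_ext => // a x; rewrite tpure_runit. Qed.

Definition lunit_map (u : yd_tensor I X) : X := \tsum_(a, x <- u) yd_lact a x.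
Definition lunitV_map (x : X) : yd_tensor I X := one ⊗ x.
Definition runit_map (u : yd_tensor X I) : X := \tsum_(x, a <- u) yd_ract x a.
Definition runitV_map (x : X) : yd_tensor X I := x ⊗ one.

Let lunit_balanced : balancedT RR I X (fun a x => yd_lact a x).
Proof. by bal => a b x; rewrite yd_actS yd_actT yd_lactM. Qed.

Let runit_balanced : balancedT RR X I (fun x a => yd_ract x a).
Proof. by bal => x b a; rewrite yd_actS yd_actT yd_ractM. Qed.

Lemma lunit_mapE a x : lunit_map (a ⊗ x) = yd_lact a x.
Proof. exact: tsum_tpureE lunit_balanced. Qed.

Lemma runit_mapE x a : runit_map (x ⊗ a) = yd_ract x a.
Proof. exact: tsum_tpureE runit_balanced. Qed.

Lemma linear_lunit_map : linear lunit_map.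
Proof. exact: linear_tsum lunit_balanced. Qed.

Lemma linear_runit_map : linear runit_map.
Proof. exact: linear_tsum runit_balanced. Qed.

Lemma lunit_mapK : cancel lunit_map lunitV_map.
Proof.
have ? := linear_lunit_map.
apply: lunit_ext => [||x]; rewrite /lunitV_map; try by [lin].
by rewrite lunit_mapE yd_lact1.
Qed.

Lemma lunitV_mapK : cancel lunitV_map lunit_map.
Proof. by move=> x; rewrite lunit_mapE yd_lact1. Qed.

Lemma runit_mapK : cancel runit_map runitV_map.
Proof.
have ? := linear_runit_map.
apply: runit_ext => [||x]; rewrite /runitV_map; try by [lin].
by rewrite runit_mapE yd_ract1.
Qed.

Lemma runitV_mapK : cancel runitV_map runit_map.
Proof. by move=> x; rewrite runit_mapE yd_ract1. Qed.

Lemma unit_lactE a : @yd_lact _ _ _ _ I a one = a.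
Proof. exact: mulr1. Qed.

Lemma unit_ractE a : @yd_ract _ _ _ _ I one a = a.
Proof. exact: mul1r. Qed.

Lemma unit_actE r : @yd_act _ _ _ _ I one r = eps r.
Proof. by rewrite /= rmorph1 mul1r. Qed.

Lemma tsum_unit_coact (V : lmodType k) (F : I -> R -> V) :
  balancedM RR (@yd_ract _ _ _ _ I) F -> tsum (@yd_coact _ _ _ _ I one) F = F
    one 1.
Proof. by move=> Fb; rewrite [yd_coact _]/= tsum_tpureE // rmorph1. Qed.

(** Tested on [one ⊗ x], the action of r gives x <| (r2 t(eps(r1))), because the scalar eps(r1) acts
    from the left as t(eps(r1)). The left counit law of [DeltaR] turns this into x <| r. *)
Lemma lunit_map_is_hom : is_yd_hom lunit_map.
Proof.
have lL := linear_lunit_map.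
have lr u a : lunit_map (yd_ract u a) = yd_ract (lunit_map u) a.
  move: u; apply: lunit_ext => [||x]; try by [lin].
  by rewrite tensor_ractE !lunit_mapE !yd_lact1.
have Gb := balanced_hom_rtensor lL lr.
split=> // [a u|u r|u]; move: u; apply: lunit_ext => [||x]; try by [lin].
- by rewrite tensor_lactE !lunit_mapE unit_lactE yd_lact1.
- rewrite tensor_actE lunit_mapE yd_lact1 (raddf_tsum (h := lunit_map)) //.
  rewrite -[r in RHS](DeltaR_counitl RR) raddf_tsum; last by lin.
  by apply: eq_tsum => r1 r2; rewrite lunit_mapE unit_actE yd_actM yd_actT.
rewrite lunit_mapE yd_lact1 tsum_tensor_coact //.
rewrite tsum_unit_coact; last exact: balanced_tensor_coact2 Gb.
rewrite -[LHS]tsum_tpure; apply: eq_tsum => x0 x1.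
by rewrite lunit_mapE yd_lact1 mul1r.
Qed.

Lemma runit_map_is_hom : is_yd_hom runit_map.
Proof.
have lL := linear_runit_map.
have lr u a : runit_map (yd_ract u a) = yd_ract (runit_map u) a.
  move: u; apply: runit_ext => [||x]; try by [lin].
  by rewrite tensor_ractE !runit_mapE unit_ractE yd_ract1.
have Gb := balanced_hom_rtensor lL lr.
split=> // [a u|u r|u]; move: u; apply: runit_ext => [||x]; try by [lin].
- by rewrite tensor_lactE !runit_mapE !yd_ract1.
- rewrite tensor_actE runit_mapE yd_ract1 (raddf_tsum (h := runit_map)) //.
  rewrite -[r in RHS](DeltaR_counitr RR) raddf_tsum; last by lin.
  by apply: eq_tsum => r1 r2; rewrite runit_mapE unit_actE yd_actM yd_actS.
rewrite runit_mapE yd_ract1 tsum_tensor_coact //.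
rewrite -[LHS]tsum_tpure; apply: eq_tsum => x0 x1.
rewrite tsum_unit_coact; last exact: balanced_tensor_coact1 Gb.
by rewrite runit_mapE yd_ract1 mulr1.
Qed.

Definition lunit_hom : yd_hom (yd_tensor I X) X := YdHom lunit_map_is_hom.
Definition lunitV_hom : yd_hom X (yd_tensor I X) :=
  YdHom (yd_hom_inverse (f := lunit_hom) lunit_mapK lunitV_mapK).
Definition runit_hom : yd_hom (yd_tensor X I) X := YdHom runit_map_is_hom.
Definition runitV_hom : yd_hom X (yd_tensor X I) :=
  YdHom (yd_hom_inverse (f := runit_hom) runit_mapK runitV_mapK).
End Unitors.

(** * The pre-braiding *)

Section Braiding.
Variables (k : fieldType) (A R : algType k) (RR : right_bialgebroid A R).
Variables X Y : yd RR.
Local Notation t := (tR RR).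
Local Notation Delta := (DeltaR RR).

Definition braid_map (u : yd_tensor X Y) : yd_tensor Y X :=
  \tsum_(x, y <- u) \tsum_(y0, y1 <- yd_coact y) y0 ⊗ yd_act x y1.

Lemma braid_inner_balanced (x : X) :
  balancedM RR (@yd_ract _ _ _ _ Y) (fun y r => y ⊗ yd_act x r : yd_tensor Y X).
Proof. by bal => y a r; rewrite tpure_ydT yd_actM yd_actT. Qed.

Lemma braid_balanced : balancedT RR X Y (fun x y =>
  \tsum_(y0, y1 <- yd_coact y) y0 ⊗ yd_act x y1 : yd_tensor Y X).
Proof.
have Fb := braid_inner_balanced.
bal => x a y; rewrite yd_actT tsum_coact_lact //.
by apply: eq_tsum => y0 y1; rewrite yd_actM.
Qed.

Lemma braid_mapE (x : X) (y : Y) :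
  braid_map (x ⊗ y) = \tsum_(y0, y1 <- yd_coact y) y0 ⊗ yd_act x y1.
Proof. exact: tsum_tpureE braid_balanced. Qed.

Lemma linear_braid_map : linear braid_map.
Proof. exact: linear_tsum braid_balanced. Qed.

(** Compatibility with the action of R is exactly the Yetter-Drinfeld identity for [Y].
    Compatibility with the coaction is the Yetter-Drinfeld identity for [X], placed between two uses
    of coassociativity for [Y]. *)
Lemma braid_map_is_hom : is_yd_hom braid_map.
Proof.
have bL := linear_braid_map; have Fb := braid_inner_balanced.
have br u a : braid_map (yd_ract u a) = yd_ract (braid_map u) a.
  move: u; apply: tens_ext => [||x y]; try by [lin].
  rewrite tensor_ractE !braid_mapE tsum_coact_ract //.
  rewrite (raddf_tsum (h := fun u : yd_tensor Y X => yd_ract u a)); last by lin.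
  by apply: eq_tsum => y0 y1; rewrite tensor_ractE yd_actM yd_actS.
have Gb := balanced_hom_rtensor bL br.
have Tb := @balanced_tpure_tensor _ _ _ _ Y X.
have Tb1 z p := balanced_tensor_coact1 z p Tb.
split=> // [a u|u r|u]; move: u; apply: tens_ext => [||x y]; try by [lin].
- rewrite tensor_lactE !braid_mapE.
  rewrite (raddf_tsum (h := fun u : yd_tensor Y X => yd_lact a u)); last by lin.
  symmetry; apply: (tsum_coact_takeuchi (Fb x) (a := a)) => y0 y1.
    by rewrite tensor_lactE.
  by rewrite yd_actM yd_actT.
- rewrite tensor_actE braid_mapE (raddf_tsum (h := braid_map)) //.
  transitivity (\tsum_(r1, r2 <- Delta r)
    \tsum_(y0, y1 <- yd_coact (yd_act y r2))
     y0 ⊗ yd_act x (r1 * y1) : yd_tensor Y X).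
    apply: eq_tsum => r1 r2; rewrite braid_mapE.
    by apply: eq_tsum => y0 y1; rewrite yd_actM.
  rewrite (tsum_yd_compat (Fb x)).
  rewrite (raddf_tsum (h := fun u : yd_tensor Y X => yd_act u r)); last by lin.
  apply: eq_tsum => y0 y1; rewrite tensor_actE.
  by apply: eq_tsum => r1 r2; rewrite yd_actM.
rewrite tsum_tensor_coact // braid_mapE.
rewrite (raddf_tsum (h := fun u : yd_tensor Y X => yd_coact u)); last by lin.
transitivity (\tsum_(y0, y1 <- yd_coact y) \tsum_(z, p <- yd_coact y0)
  \tsum_(x0, x1 <- yd_coact (yd_act x y1))
    ((z ⊗ x0 : yd_tensor Y X) ⊗ (p * x1)
      : rtensor t (@yd_ract _ _ _ _ (yd_tensor Y X)))).
  by apply: eq_tsum => y0 y1; rewrite tensor_coactE.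
rewrite (tsum_coact_coassoc (F := fun z p q =>
  \tsum_(x0, x1 <- yd_coact (yd_act x q))
    ((z ⊗ x0 : yd_tensor Y X) ⊗ (p * x1)
      : rtensor t (@yd_ract _ _ _ _ (yd_tensor Y X))))); last first.
  split; cbv beta; try by [lin].
    move=> z a p q.
    apply: (tsum_coact_takeuchi (Tb1 z p) (a := a)) => x0 x1.
      by rewrite tpure_ydT.
    by rewrite mulrA.
  move=> z p a q; rewrite yd_actM yd_actT tsum_coact_lact; last first.
    exact: balanced_tensor_coact1 Tb.
  by apply: eq_tsum => x0 x1; rewrite mulrA.
transitivity (\tsum_(y0, y1 <- yd_coact y) \tsum_(x0, x1 <- yd_coact x)
  \tsum_(p, q <- Delta y1)
    ((y0 ⊗ yd_act x0 p : yd_tensor Y X) ⊗ (x1 * q)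
      : rtensor t (@yd_ract _ _ _ _ (yd_tensor Y X)))).
  apply: eq_tsum => y0 y1.
  rewrite -(tsum_yd_compat (F := fun x0 q => (y0 ⊗ x0 : yd_tensor Y X) ⊗ q)) //.
  bal => x0 a q; rewrite -tensor_ractE.
  exact: (balanced_eq Tb).
rewrite tsum_exchange; apply: eq_tsum => x0 x1.
rewrite -(tsum_coact_coassoc (F := fun z p q =>
    ((z ⊗ yd_act x0 p : yd_tensor Y X) ⊗ (x1 * q)
      : rtensor t (@yd_ract _ _ _ _ (yd_tensor Y X))))); last first.
  split; cbv beta; try by [lin].
    by move=> z a p q; rewrite tpure_ydT yd_actM yd_actT.
  move=> z p a q; rewrite yd_actM yd_actS -tensor_ractE mulrA.
  exact: (balanced_eq Tb).
apply: eq_tsum => y0 y1; rewrite braid_mapE.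
by rewrite (raddf_tsum (h := fun v => v ⊗ (x1 * y1))) //; lin.
Qed.

Definition braid_hom : yd_hom (yd_tensor X Y) (yd_tensor Y X) :=
  YdHom braid_map_is_hom.
End Braiding.

(** * The monoidal category and its pre-braiding *)

Section Monoidal.
Variables (k : fieldType) (A R : algType k) (RR : right_bialgebroid A R).
Local Notation Delta := (DeltaR RR).

Lemma tensor_homE (X X' Y Y' : yd RR) (f : yd_hom X X') (g : yd_hom Y Y') x y :
  tensor_hom f g (x ⊗ y) = f x ⊗ g y.
Proof. exact: tensor_mapE. Qed.

Lemma assoc_homE (X Y Z : yd RR) (x : X) (y : Y) (z : Z) :
  assoc_hom X Y Z ((x ⊗ y) ⊗ z) = x ⊗ (y ⊗ z).
Proof. exact: assoc_mapE. Qed.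

Lemma assocV_homE (X Y Z : yd RR) (x : X) (y : Y) (z : Z) :
  assocV_hom X Y Z (x ⊗ (y ⊗ z)) = (x ⊗ y) ⊗ z.
Proof. exact: assocV_mapE. Qed.

Lemma lunit_homE (X : yd RR) a (x : X) : lunit_hom X (a ⊗ x) = yd_lact a x.
Proof. exact: lunit_mapE. Qed.

Lemma runit_homE (X : yd RR) a (x : X) : runit_hom X (x ⊗ a) = yd_ract x a.
Proof. exact: runit_mapE. Qed.

Lemma braid_homE (X Y : yd RR) (x : X) (y : Y) :
  braid_hom X Y (x ⊗ y) = \tsum_(y0, y1 <- yd_coact y) y0 ⊗ yd_act x y1.
Proof. exact: braid_mapE. Qed.

Lemma yd_compE (X Y Z : yd RR) (g : yd_hom Y Z) (f : yd_hom X Y) x :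
  yd_comp g f x = g (f x).
Proof. by []. Qed.

(** Kept transparent, because the formulas for the structure maps and the braiding axioms have to
    compute with them. Each coherence equation holds by evaluation on pure tensors, which span. *)
Definition yd_monoidal :
  monoidal (C := YD RR) (fun X Y => Yd (tensor_is_yd X Y)) (Yd (unit_is_yd RR)).
Proof.
apply: (@Monoidal (YD RR) _ _ (fun X X' Y Y' f g => tensor_hom f g)
  (fun X Y Z => assoc_hom X Y Z) (fun X Y Z => assocV_hom X Y Z)
  (fun X => lunit_hom X) (fun X => lunitV_hom X)
  (fun X => runit_hom X) (fun X => runitV_hom X)).
- move=> X Y; apply: yd_hom_eq; apply: tens_ext => [||x y]; try by [lin].
  by rewrite tensor_homE.
- move=> X X' X'' Y Y' Y'' f' f g' g.
  apply: yd_hom_eq; apply: tens_ext => [||x y]; try by [lin].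
  by rewrite [RHS]yd_compE !tensor_homE.
- move=> X Y Z; split; apply: yd_hom_eq => u;
    [exact: assoc_mapK | exact: assocV_mapK].
- move=> X X' Y Y' Z Z' f g h.
  apply: yd_hom_eq; apply: tens3_ext => [||x y z]; try by [lin].
  by rewrite !yd_compE assoc_homE !tensor_homE assoc_homE.
- move=> X; split; apply: yd_hom_eq => u;
    [exact: lunit_mapK | exact: lunitV_mapK].
- move=> X Y f; apply: yd_hom_eq; apply: lunit_ext => [||x]; try by [lin].
  by rewrite !yd_compE tensor_homE !lunit_homE !yd_lact1.
- move=> X; split; apply: yd_hom_eq => u;
    [exact: runit_mapK | exact: runitV_mapK].
- move=> X Y f; apply: yd_hom_eq; apply: runit_ext => [||x]; try by [lin].
  by rewrite !yd_compE tensor_homE !runit_homE !yd_ract1.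
- move=> W X Y Z; apply: yd_hom_eq; apply: tens_ext => [||u z]; try by [lin].
  move: u; apply: tens3_ext => [||w x y]; try by [lin].
  by rewrite !yd_compE !(assoc_homE, tensor_homE).
move=> X Y; apply: yd_hom_eq; apply: tens3_ext => [||x a y]; try by [lin].
by rewrite yd_compE assoc_homE !tensor_homE lunit_homE runit_homE tpure_ydT.
Defined.

Lemma yd_monoidal_canonical : yd_canonical yd_monoidal.
Proof.
split=> *; [exact: tensor_homE | exact: assoc_homE | exact: lunit_homE
  | exact: runit_homE].
Qed.

(** The first hexagon is multiplicativity of the action, applied to the product y1 z1 that occurs in
    the coaction of y (x) z. The second is coassociativity of the coaction of z. The unit conditions
    express that 1 coacts as 1 (x) 1 and that coactions are counital. *)
Lemma yd_prebraiding : is_prebraiding yd_monoidal (fun X Y => braid_hom X Y).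
Proof.
split.
- move=> X X' Y Y' f g; apply: yd_hom_eq; apply: tens_ext => [||x y];
    try by [lin].
  rewrite !yd_compE tensor_homE !braid_homE tsum_hom_coact; last first.
    exact: braid_inner_balanced.
  rewrite (raddf_tsum (h := fun u => tensor_hom g f u)); last by lin.
  by apply: eq_tsum => y0 y1; rewrite tensor_homE (ydh_act (yd_funP f)).
- move=> X Y Z; apply: yd_hom_eq; apply: tens3_ext => [||x y z]; try by [lin].
  rewrite !yd_compE assoc_homE tensor_homE !braid_homE tsum_tensor_coact;
    last first.
    exact: (@braid_inner_balanced _ _ _ _ X (tensor_yd Y Z)).
  rewrite (raddf_tsum (h := fun u => assoc_hom Y Z X u)); last by lin.
  rewrite (raddf_tsum (h := fun u => tensor_hom (yd_id Y) (braid_hom X Z)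
    (assoc_hom Y X Z (u ⊗ z)))); last by lin.
  apply: eq_tsum => y0 y1; rewrite assoc_homE tensor_homE braid_homE.
  rewrite (raddf_tsum (h := fun u => assoc_hom Y Z X u)); last by lin.
  rewrite (raddf_tsum (h := fun u => yd_id Y y0 ⊗ u)); last by lin.
  by apply: eq_tsum => z0 z1; rewrite assoc_homE yd_actM.
- move=> X Y Z; apply: yd_hom_eq; apply: tens3_extV => [||x y z]; try by [lin].
  rewrite !yd_compE assocV_homE tensor_homE !braid_homE.
  rewrite (raddf_tsum (h := fun u => assocV_hom Z X Y u)); last by lin.
  rewrite (raddf_tsum (h := fun u => tensor_hom (braid_hom X Z) (yd_id Y)
    (assocV_hom X Z Y (_ ⊗ u)))); last by lin.
  transitivity (\tsum_(z0, z1 <- yd_coact z) \tsum_(p, q <- Delta z1)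
    (z0 ⊗ yd_act x p) ⊗ yd_act y q : yd_tensor (yd_tensor Z X) Y).
    apply: eq_tsum => z0 z1; rewrite tensor_actE.
    rewrite (raddf_tsum (h := fun u => assocV_hom Z X Y (z0 ⊗ u))); last by lin.
    by apply: eq_tsum => p q; rewrite assocV_homE.
  rewrite -(tsum_coact_coassoc (F := fun z p q =>
    (z ⊗ yd_act x p) ⊗ yd_act y q : yd_tensor (yd_tensor Z X) Y)); last first.
    split; cbv beta; try by [lin].
      by move=> n a p q; rewrite tpure_ydT yd_actM yd_actT.
    move=> n p a q; rewrite !yd_actM yd_actS yd_actT.
    by rewrite -(tpure_ydT (X := tensor_yd Z X)) tensor_ractE.
  apply: eq_tsum => z0 z1; rewrite assocV_homE tensor_homE braid_homE.
  by rewrite (raddf_tsum (h := fun u => u ⊗ (yd_act y z1))) //; lin.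
- move=> X; apply: yd_hom_eq; apply: runit_ext => [||x]; try by [lin].
  rewrite yd_compE braid_homE runit_homE yd_ract1 tsum_unit_coact.
    by rewrite lunit_homE yd_lact1 yd_act1.
  exact: (@braid_inner_balanced _ _ _ _ X (unit_yd RR)).
move=> X; apply: yd_hom_eq; apply: lunit_ext => [||x]; try by [lin].
rewrite yd_compE braid_homE lunit_homE yd_lact1.
rewrite (raddf_tsum (h := fun u => runit_hom X u)); last by lin.
rewrite -[RHS]tsum_coact_counit; apply: eq_tsum => x0 x1.
by rewrite runit_homE unit_actE.
Qed.
End Monoidal.

(** * Left bialgebroids and the antipode *)

Local Notation balancedL LL :=
  (balanced (fun X b => tL LL b * X) (fun b X => sL LL b * X)).
Local Notation balancedL3 LL :=
  (balanced3 (fun X b => tL LL b * X) (fun b X => sL LL b * X)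
     (fun b X => tL LL b * X) (fun b X => sL LL b * X)).

Section LeftBialgebroid.
Variables (k : fieldType) (B H : algType k) (LL : left_bialgebroid B H).
Local Notation s := (sL LL).
Local Notation t := (tL LL).
Local Notation Delta := (DeltaL LL).
Local Notation eps := (epsL LL).

Lemma tL1 : t 1 = 1. Proof. exact: rmorph1. Qed.

Lemma sL1 : s 1 = 1. Proof. exact: rmorph1. Qed.

Lemma tLM (b c : B) : t (b * c) = t c * t b.
Proof. exact: (rmorphM t (c : B^c) b). Qed.

Lemma epsL_tM (b : B) (x : H) : eps (t b * x) = eps x * b.
Proof. by have := epsL_bimod LL 1 b x; rewrite sL1 !mul1r. Qed.

Lemma epsL_t (b : B) : eps (t b) = b.
Proof. by rewrite -[t b]mulr1 epsL_tM epsL_1 mul1r. Qed.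

Lemma tpure_DeltaL (x y : H) (b : B) :
  (t b * x) ⊗ y = x ⊗ (s b * y) :> ltensor s (fun X (b : B) => t b * X).
Proof. exact: (tpure_bal (fun X (b : B) => t b * X) (fun b X => s b * X)). Qed.

Lemma DeltaL_s (b : B) : Delta (s b) = s b ⊗ 1.
Proof.
have := DeltaL_bimod LL b 1 1; rewrite tL1 !mulr1 DeltaL_1 => ->.
rewrite tsum_tpureE ?mulr1 ?mul1r //; bal => x c y.
by rewrite !mul1r mulrA sL_tL_comm -mulrA tpure_DeltaL.
Qed.

Lemma DeltaL_t (b : B) : Delta (t b) = 1 ⊗ t b.
Proof.
have := DeltaL_bimod LL 1 b 1; rewrite sL1 mulr1 mul1r DeltaL_1 => ->.
rewrite tsum_tpureE ?mulr1 ?mul1r //; bal => x c y.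
by rewrite !mul1r tpure_DeltaL mulrA sL_tL_comm -mulrA.
Qed.

Lemma tsum_DeltaLM (V : lmodType k) (F : H -> H -> V) (x y : H) :
  balancedL LL F ->
  tsum (Delta (x * y)) F =
  \tsum_(x1, x2 <- Delta x) \tsum_(y1, y2 <- Delta y) F (x1 * y1) (x2 * y2).
Proof.
move=> Fb; rewrite DeltaL_M tsum_tsum //; apply: eq_tsum => x1 x2.
by rewrite tsum_tsum //; apply: eq_tsum => y1 y2; rewrite tsum_tpureE.
Qed.

Lemma tsum_DeltaL_bimod (V : lmodType k) (F : H -> H -> V) (b c : B) (x : H) :
  balancedL LL F ->
  tsum (Delta (s b * t c * x)) F =
  \tsum_(x1, x2 <- Delta x) F (s b * x1) (t c * x2).
Proof.
move=> Fb; rewrite DeltaL_bimod tsum_tsum //; apply: eq_tsum => x1 x2.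
by rewrite tsum_tpureE.
Qed.

Lemma tsum_DeltaL_sM (V : lmodType k) (F : H -> H -> V) (b : B) (x : H) :
  balancedL LL F ->
  tsum (Delta (s b * x)) F = \tsum_(x1, x2 <- Delta x) F (s b * x1) x2.
Proof.
move=> Fb; rewrite -[s b]mulr1 -tL1 tsum_DeltaL_bimod //.
by apply: eq_tsum => x1 x2; rewrite tL1 mulr1 mul1r.
Qed.

Lemma tsum_DeltaL_takeuchi (V : lmodType k) (F G G' : H -> H -> V) (b : B)
    (x : H) :
  balancedL LL F -> (forall x1 x2, G x1 x2 = F (x1 * t b) x2) ->
  (forall x1 x2, G' x1 x2 = F x1 (x2 * s b)) ->
  tsum (Delta x) G = tsum (Delta x) G'.
Proof.
move=> Fb GE G'E; have := congr1 (fun u => tsum u F) (DeltaL_takeuchi LL b x).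
rewrite !tsum_tsum // => e; apply: etrans (etrans _ e) _; apply: eq_tsum => *.
  by rewrite tsum_tpureE.
by rewrite tsum_tpureE.
Qed.

Lemma balancedL_mul (V : lmodType k) (F : H -> H -> V) (x : H) :
  balancedL LL F ->
  balancedL LL (fun y1 y2 =>
    \tsum_(x1, x2 <- Delta x) F (x1 * y1) (x2 * y2)).
Proof.
move=> Fb; bal => y c z.
apply: (tsum_DeltaL_takeuchi (b := c)
          (F := fun x1 x2 => F (x1 * y) (x2 * z))) => [|x1 x2|x1 x2].
- by bal => x1 d x2; rewrite -!mulrA (balanced_eq Fb).
- by rewrite mulrA.
- by rewrite mulrA.
Qed.

Lemma tsum_DeltaL_Ms (V : lmodType k) (F : H -> H -> V) (b : B) (x : H) :
  balancedL LL F ->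
  tsum (Delta (x * s b)) F = \tsum_(x1, x2 <- Delta x) F (x1 * s b) x2.
Proof.
move=> Fb; rewrite tsum_DeltaLM // tsum_exchange DeltaL_s tsum_tpureE.
  by under eq_tsum => x1 x2 do rewrite mulr1.
exact: balancedL_mul.
Qed.

Section Ltensor.
Variables (M : lmodType k) (r : M -> B -> M).

Lemma tpure_ltensor (m : M) (b : B) (x : H) :
  r m b ⊗ x = m ⊗ (s b * x) :> ltensor s r.
Proof. exact: (tpure_bal r (fun b x => s b * x)). Qed.

Lemma balanced_ltensor : balanced r (fun b x => s b * x)
  (fun m x => m ⊗ x : ltensor s r).
Proof. by bal => *; apply: tpure_ltensor. Qed.

Lemma balanced3_ltensor :
  balanced3 r (fun b x => s b * x) (fun b x => t b * x) (fun b x => s b * x)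
    (fun m x y => (m ⊗ x) ⊗ y : ltensor s (ltensor_ract (s := s) t (r := r))).
Proof.
apply: balanced3_tpure => [b|b c x]; first by lin.
by rewrite !mulrA sL_tL_comm.
Qed.
End Ltensor.
End LeftBialgebroid.

(** The antipode retyped as a map from [H] to itself: [antipode] takes values in [H^c], whose
    product is the reversed one. *)
Definition hopf_S (k : fieldType) (B H : algType k) (HH : hopf_algebroid B H)
  (x : H) : H := antipode HH x.

Lemma linear_hopf_S (k : fieldType) (B H : algType k) (HH : hopf_algebroid B H)
  (U : lmodType k) (h : U -> H) :
  linear h -> linear (fun u => hopf_S HH (h u)).
Proof. by move=> hL c x y; rewrite hL /hopf_S linearP. Qed.

Lemma linear_antipodeV (k : fieldType) (B H : algType k)
    (HH : hopf_algebroid B H) (U : lmodType k) (h : U -> H) :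
  linear h -> linear (fun u => antipodeV HH (h u)).
Proof.
move=> hL c x y; apply: (can_inj (antipodeK HH)).
rewrite hL linearP antipodeVK; congr (_ *: _ + _);
  exact: esym (antipodeVK HH _).
Qed.

Ltac lin_hopf :=
  match goal with
  | |- GRing.linear_for _ (fun x => hopf_S _ (@?a x)) =>
      apply: linear_hopf_S; lin
  | |- GRing.linear_for _ (fun x => antipodeV _ (@?a x)) =>
      apply: linear_antipodeV; lin
  end.

Ltac lin_ext ::= first [lin_yd | lin_hopf].

(** * Antipode identities *)

Section HopfAlgebroid.
Variables (k : fieldType) (B H : algType k) (HH : hopf_algebroid B H).
Local Notation LL := (hopfL HH).
Local Notation RR := (hopfR HH).
Local Notation S := (hopf_S HH).
Local Notation S' := (antipodeV HH).

Lemma hopf_SK : cancel S S'. Proof. exact: antipodeK. Qed.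
Lemma hopf_S'K : cancel S' S. Proof. exact: antipodeVK. Qed.

Lemma hopf_S1 : S 1 = 1.
Proof. exact: (rmorph1 (antipode HH)). Qed.

Lemma hopf_SM (x y : H) : S (x * y) = S y * S x.
Proof. exact: (rmorphM (antipode HH)). Qed.

Lemma hopf_S'M (x y : H) : S' (x * y) = S' y * S' x.
Proof. by apply: (can_inj hopf_SK); rewrite hopf_SM !hopf_S'K. Qed.

Lemma hopf_S't (b : B) : S' (tL LL b) = tR RR b.
Proof. by rewrite hopf_tR. Qed.

Lemma hopf_St (b : B) : S (tL LL b) = sL LL b.
Proof. exact: antipode_tL. Qed.

Lemma hopf_S's (b : B) : S' (sL LL b) = tL LL b.
Proof. by rewrite -hopf_St hopf_SK. Qed.

Lemma hopf_StR (b : B) : S (tR RR b) = tL LL b.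
Proof. by rewrite -hopf_S't hopf_S'K. Qed.

Lemma hopf_epsRE (x : H) : epsR RR x = epsL LL (S x).
Proof. exact: hopf_epsR. Qed.

(** This is the axiom [antipode_Delta] after its second tensor factor has been contracted with the
    counit; on the left-hand side, counitality of [DeltaL] rebuilds S(x1). *)
Lemma tsum_antipode_l (x : H) :
  \tsum_(x1, x2 <- DeltaL LL x) S x1 * x2 = tL LL (epsR RR x).
Proof.
have Fb : balancedL LL (fun y z => tL LL (epsL LL z) * y).
  bal => y b z; by rewrite epsL_sL tLM !mulrA.
have := congr1 (fun u => tsum u (fun y z => tL LL (epsL LL z) * y))
  (antipode_Delta HH x).
rewrite tsum_tpureE // mulr1 hopf_epsRE => <-.
rewrite tsum_tsum //; apply: eq_tsum => x1 x2.
rewrite -{1}[S x1](DeltaL_counitr LL) (raddf_tsum (h := fun u => u * x2));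
  last by lin.
rewrite tsum_tsum //; apply: eq_tsum => y z.
by rewrite tsum_tpureE // mulrA.
Qed.

(** Since [DeltaR] is [DeltaL] conjugated by S with the legs flipped, the sum is the image under S
    of the previous identity at S^-1(x). *)
Lemma tsum_antipode_r (x : H) :
  \tsum_(x1, x2 <- DeltaR RR x) x1 * S x2 = sL LL (epsL LL x).
Proof.
have Fb : balancedR RR (fun x1 x2 => x1 * S x2).
  by bal => y b z; rewrite hopf_SM hopf_StR (hopf_sR HH) mulrA.
rewrite hopf_DeltaR tsum_tsum //.
rewrite -[in RHS](hopf_S'K x) -hopf_epsRE -hopf_St -tsum_antipode_l.
rewrite (raddf_tsum (h := S)); last by lin.
by apply: eq_tsum => y z; rewrite tsum_tpureE // hopf_SM.
Qed.

Lemma tsum_antipodeV_l (x : H) :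
  \tsum_(x1, x2 <- DeltaL LL x) S' x2 * x1 = tR RR (epsR RR x).
Proof.
apply: (can_inj hopf_SK); rewrite (raddf_tsum (h := S)); last by lin.
rewrite hopf_StR -tsum_antipode_l; apply: eq_tsum => x1 x2.
by rewrite hopf_SM hopf_S'K.
Qed.

Lemma tsum_antipodeV_r (x : H) :
  \tsum_(x1, x2 <- DeltaR RR x) x2 * S' x1 = tL LL (epsL LL x).
Proof.
apply: (can_inj hopf_SK); rewrite (raddf_tsum (h := S)); last by lin.
rewrite hopf_St -tsum_antipode_r; apply: eq_tsum => x1 x2.
by rewrite hopf_SM hopf_S'K.
Qed.

(** The coproduct of s_L(b) is s_L(b) (x) 1, so the left-hand side of [tsum_antipodeV_l] at s_L(b)
    is s_L(b) itself. With the converse below, s_L(b) can be moved through [DeltaR] and t_R(b)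
    through [DeltaL], as the mixed laws require. *)
Lemma hopf_sL_tR (b : B) : sL LL b = tR RR (epsR RR (sL LL b)).
Proof.
rewrite -tsum_antipodeV_l DeltaL_s tsum_tpureE.
  by rewrite -hopf_S1 hopf_SK mul1r.
by bal => x c y; rewrite hopf_S'M hopf_S's mulrA.
Qed.

Lemma hopf_tR_sL (b : B) : tR RR b = sL LL (epsL LL (tR RR b)).
Proof.
rewrite -tsum_antipode_r DeltaR_t tsum_tpureE ?hopf_S1 ?mulr1 //.
by bal => x c y; rewrite hopf_SM hopf_StR hopf_sR mulrA.
Qed.

Lemma tsum_DeltaR_sLM (V : lmodType k) (F : H -> H -> V) (b : B) (x : H) :
  balancedR RR F ->
  tsum (DeltaR RR (sL LL b * x)) F =
  \tsum_(x1, x2 <- DeltaR RR x) F (sL LL b * x1) x2.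
Proof. by move=> Fb; rewrite hopf_sL_tR tsum_DeltaR_tM. Qed.

Lemma tsum_DeltaL_MtR (V : lmodType k) (F : H -> H -> V) (b : B) (x : H) :
  balancedL LL F ->
  tsum (DeltaL LL (x * tR RR b)) F =
  \tsum_(x1, x2 <- DeltaL LL x) F (x1 * tR RR b) x2.
Proof. by move=> Fb; rewrite hopf_tR_sL tsum_DeltaL_Ms. Qed.
End HopfAlgebroid.

(** * Full Yetter-Drinfeld modules *)

Canonical fyd_as_yd (k : fieldType) (B H : algType k) (HH : hopf_algebroid B H)
  (X : fyd HH) : yd (hopfR HH) := Yd (fyd_is_yd (fydP X)).

Ltac yd_of y ::=
  lazymatch y with
  | yd_dat ?X => X
  | yd_tensor ?P ?Q =>
      let p := yd_of P in let q := yd_of Q in constr:(tensor_yd p q)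
  | yd_unit ?RR => constr:(unit_yd RR)
  | fyd_yd (fyd_dat ?X) => constr:(fyd_as_yd X)
  end.

Local Notation balancedLM HH X :=
  (balanced (@fyd_lract _ _ _ _ X) (fun b h => sL (hopfL HH) b * h)).

Section Comodule.
Variables (k : fieldType) (B H : algType k) (HH : hopf_algebroid B H).
Variable X : fyd HH.
Local Notation LL := (hopfL HH).
Local Notation RR := (hopfR HH).
Local Notation s := (sL LL).
Local Notation t := (tL LL).

Let XH := fyd_comodule (fydP X).
Let XL := hcom_L XH.

Lemma linear_fyd_lcoact (U : lmodType k) (h : U -> X) :
  linear h -> linear (fun u => fyd_lcoact (h u)).
Proof. exact: linear_comp (Lcom_linear XL). Qed.

(* Both sides have the same R-coaction, so the counit identifies them. *)
Lemma fyd_lractE (x : X) (b : B) : fyd_lract x b = yd_lact (b : B^c) x.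
Proof.
rewrite -[LHS]tsum_coact_counit -[RHS]tsum_coact_counit.
rewrite yd_coact_lact (hcom_dR_rb XH).
by congr (tsum _ _); apply: eq_tsum => x0 x1; rewrite hopf_sR.
Qed.

Lemma fyd_llactE (b : B) (x : X) : fyd_llact b x = yd_ract x (b : B^c).
Proof.
rewrite -[LHS](Lcom_counit XL) -[RHS](Lcom_counit XL) (hcom_dL_ra XH).
rewrite -{1}[fyd_llact b x](rmod_1 (bimod_right (Lcom_bimodule XL))).
rewrite (Lcom_bimod XL); congr (tsum _ _); apply: eq_tsum => x0 x1.
by rewrite hopf_sR tL1 mul1r.
Qed.

Lemma tpure_lract (x : X) (b : B) (h : H) :
  yd_lact (b : B^c) x ⊗ h = x ⊗ (s b * h) :> ltensor s (@fyd_lract _ _ _ _ X).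
Proof. by rewrite -fyd_lractE tpure_ltensor. Qed.

Lemma tsum_lcoact_counit (x : X) :
  \tsum_(x0, x1 <- fyd_lcoact x) yd_lact (epsL LL x1 : B^c) x0 = x.
Proof.
rewrite -[RHS](Lcom_counit XL); apply: eq_tsum => x0 x1.
by rewrite fyd_lractE.
Qed.

Section Functional.
Variables (V : lmodType k) (F : X -> H -> V).
Hypothesis Fb : balancedLM HH X F.

Lemma tsum_lcoact_ract (x : X) (b : B) :
  tsum (fyd_lcoact (yd_ract x (b : B^c))) F =
  \tsum_(x0, x1 <- fyd_lcoact x) F x0 (x1 * t b).
Proof.
rewrite (hcom_dL_ra XH) tsum_tsum //; apply: eq_tsum => x0 x1.
by rewrite tsum_tpureE // hopf_sR.
Qed.

Lemma tsum_lcoact_lact (x : X) (b : B) :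
  tsum (fyd_lcoact (yd_lact (b : B^c) x)) F =
  \tsum_(x0, x1 <- fyd_lcoact x) F x0 (t b * x1).
Proof.
rewrite -fyd_lractE.
rewrite -{1}[x](lmod_1 (bimod_left (Lcom_bimodule XL))) (Lcom_bimod XL).
rewrite tsum_tsum //; apply: eq_tsum => x0 x1.
by rewrite tsum_tpureE // tL1 mulr1.
Qed.

Lemma tsum_lcoact_takeuchi (G G' : X -> H -> V) (b : B) (x : X) :
  (forall x0 x1, G x0 x1 = F (yd_ract x0 (b : B^c)) x1) ->
  (forall x0 x1, G' x0 x1 = F x0 (x1 * s b)) ->
  tsum (fyd_lcoact x) G = tsum (fyd_lcoact x) G'.
Proof.
move=> GE G'E; have := congr1 (fun u => tsum u F) (Lcom_takeuchi XL b x).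
rewrite !tsum_tsum // => e; apply: etrans (etrans _ e) _; apply: eq_tsum => *.
  by rewrite tsum_tpureE // fyd_llactE.
by rewrite tsum_tpureE.
Qed.
End Functional.

Lemma tsum_lcoact_coassoc (V : lmodType k) (F : X -> H -> H -> V) (x : X) :
  balanced3 (@fyd_lract _ _ _ _ X) (fun b h => s b * h) (fun b h => t b * h)
    (fun b h => s b * h) F ->
  \tsum_(x0, x1 <- fyd_lcoact x) \tsum_(y, z <- fyd_lcoact x0) F y z x1 =
  \tsum_(x0, x1 <- fyd_lcoact x) \tsum_(y, z <- DeltaL LL x1) F x0 y z.
Proof.
move=> Fb; apply: tsum_triple (Lcom_coassoc XL x) Fb; first by move=> *; lin.
by move=> i j n; rewrite !mulrA sL_tL_comm.
Qed.

Lemma tsum_mixedR (V : lmodType k) (F : X -> H -> H -> V) (x : X) :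
  balanced3 (@fyd_lract _ _ _ _ X) (fun b h => s b * h)
    (fun a h => h * sR RR a) (fun a h => h * tR RR a) F ->
  \tsum_(x0, x1 <- yd_coact x) \tsum_(y, z <- fyd_lcoact x0) F y z x1 =
  \tsum_(x0, x1 <- fyd_lcoact x) \tsum_(y, z <- DeltaR RR x1) F x0 y z.
Proof.
move=> Fb; apply: tsum_triple (esym (hcom_mixedR XH x)) Fb.
  by move=> *; lin.
by move=> i j n; rewrite !mulrA.
Qed.

Lemma tsum_mixedL (V : lmodType k) (F : X -> H -> H -> V) (x : X) :
  balanced3 (@yd_ract _ _ _ _ X) (fun a h => h * tR RR a)
    (fun b h => t b * h) (fun b h => s b * h) F ->
  \tsum_(x0, x1 <- fyd_lcoact x) \tsum_(y, z <- yd_coact x0) F y z x1 =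
  \tsum_(x0, x1 <- yd_coact x) \tsum_(y, z <- DeltaL LL x1) F x0 y z.
Proof.
move=> Fb; apply: tsum_triple (esym (hcom_mixedL XH x)) Fb.
  by move=> *; lin.
by move=> i j n; rewrite !mulrA.
Qed.
End Comodule.

Ltac lin_fyd :=
  match goal with
  | |- GRing.linear_for _ (fun x => @fyd_lcoact _ _ _ _ (fyd_dat ?X) (@?a x)) =>
      apply: (@linear_fyd_lcoact _ _ _ _ X); lin
  end.

Ltac lin_ext ::= first [lin_yd | lin_hopf | lin_fyd].

Lemma balanced_lcounit (k : fieldType) (B H : algType k)
    (HH : hopf_algebroid B H) (X : fyd HH) :
  balancedLM HH X (fun z h => yd_lact (epsL (hopfL HH) h : B^c) z).
Proof. by bal => z b h; rewrite fyd_lractE epsL_sL -yd_lactM. Qed.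

(** * Recovering the L-coaction from the R-coaction *)

Section RightMultiplication.
Variables (k : fieldType) (B H : algType k) (s : B -> H) (N : lmodType k).
Variable r : N -> B -> N.

(** The balancing relation multiplies the second factor only from the left, so right multiplication
    descends. It allows a whole coaction to be multiplied by S of a further leg without being
    expanded. *)
Definition ltensor_mulr (u : ltensor s r) (h : H) : ltensor s r :=
  \tsum_(n, x <- u) n ⊗ (x * h).

Let Fb h : balanced r (fun b x => s b * x)
  (fun n x => n ⊗ (x * h) : ltensor s r).
Proof.
bal => n b x; rewrite -mulrA.
exact: (tpure_bal r (fun b x => s b * x)).
Qed.

Lemma ltensor_mulrE n x h : ltensor_mulr (n ⊗ x) h = n ⊗ (x * h).
Proof. exact: tsum_tpureE (Fb h). Qed.

Lemma linear_ltensor_mulr h : linear (fun u => ltensor_mulr u h).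
Proof. exact: linear_tsum (Fb h). Qed.

Lemma linear_ltensor_mulrr u : linear (fun h => ltensor_mulr u h).
Proof. by apply: linear_tsumr => n x; lin. Qed.

Lemma ltensor_mulrA u h h' :
  ltensor_mulr (ltensor_mulr u h) h' = ltensor_mulr u (h * h').
Proof.
rewrite {2}/ltensor_mulr (raddf_tsum _ _ (linear_ltensor_mulr h')).
by apply: eq_tsum => n x; rewrite ltensor_mulrE mulrA.
Qed.
End RightMultiplication.

Ltac lin_mulr :=
  match goal with
  | |- GRing.linear_for _ (fun x => ltensor_mulr (@?a x) ?h) =>
      apply: (linear_comp (linear_ltensor_mulr _)); lin
  | |- GRing.linear_for _ (fun x => ltensor_mulr ?u (@?a x)) =>
      apply: (linear_comp (linear_ltensor_mulrr _)); lin
  end.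

Ltac lin_ext ::= first [lin_yd | lin_hopf | lin_fyd | lin_mulr].

Section FullHoms.
Variables (k : fieldType) (B H : algType k) (HH : hopf_algebroid B H).
Local Notation LL := (hopfL HH).
Local Notation RR := (hopfR HH).
Local Notation S := (hopf_S HH).

(** The mixed law replaces the R-legs by the two legs of [DeltaR] of an L-leg h. There h1 S(h2)
    collapses to s_L(eps_L(h)), which crosses the tensor sign and is absorbed by the counit of the
    L-coaction. *)
Lemma tsum_lcoact_antipode (X : fyd HH) (x : X) :
  \tsum_(x0, x1 <- yd_coact x) ltensor_mulr (fyd_lcoact x0) (S x1) = x ⊗ 1.
Proof.
have Fb : balanced3 (@fyd_lract _ _ _ _ X) (fun b h => sL LL b * h)
    (fun a h => h * sR RR a) (fun a h => h * tR RR a)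
    (fun y z q => y ⊗ (z * S q) : ltensor (sL LL) (@fyd_lract _ _ _ _ X)).
  split; cbv beta; try by [lin].
    by move=> y b z q; rewrite -mulrA tpure_ltensor.
  by move=> y z b q; rewrite hopf_SM hopf_StR (hopf_sR HH) mulrA.
rewrite (tsum_mixedR _ Fb) -[in RHS](tsum_lcoact_counit x).
rewrite (raddf_tsum (h := fun y => y ⊗ 1)); last by lin.
apply: eq_tsum => x0 x1.
rewrite -(raddf_tsum (h := fun h => x0 ⊗ h)); last by lin.
by rewrite tsum_antipode_r tpure_lract mulr1.
Qed.

(* [g] is recovered from its product with the antipode, by mixed coassociativity:
   g(m) = g(m_(0)[0]) S(m_(0)[1]) m_(1). *)
Lemma lcoact_unique (X : fyd HH) (N : lmodType k) (r : N -> B -> N)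
    (f : X -> N) (g : X -> ltensor (sL LL) r) :
  linear g ->
  (forall (x : X) (b : B), g (yd_ract x (b : B^c)) = ltensor_mulr (g x)
    (tL LL b)) ->
  (forall x : X, \tsum_(x0, x1 <- yd_coact x) ltensor_mulr (g x0) (S x1) =
     f x ⊗ 1) ->
  forall x, g x = \tsum_(x0, x1 <- fyd_lcoact x) f x0 ⊗ x1.
Proof.
move=> gL gr gS x.
have Fb : balanced3 (@yd_ract _ _ _ _ X) (fun a h => h * tR RR a)
    (fun b h => tL LL b * h) (fun b h => sL LL b * h)
    (fun y p q => ltensor_mulr (g y) (S p * q)).
  split; cbv beta; try by [lin].
    by move=> y b p q; rewrite gr ltensor_mulrA hopf_SM hopf_StR mulrA.
  by move=> y p b q; rewrite hopf_SM hopf_St mulrA.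
transitivity (\tsum_(x0, x1 <- fyd_lcoact x) \tsum_(y, z <- yd_coact x0)
  ltensor_mulr (g y) (S z * x1)).
  rewrite (tsum_mixedL _ Fb) -[in LHS](tsum_coact_counit x).
  rewrite (raddf_tsum _ _ gL); apply: eq_tsum => x0 x1.
  rewrite -(raddf_tsum (h := fun h => ltensor_mulr (g x0) h)); last by lin.
  by rewrite tsum_antipode_l gr.
apply: eq_tsum => x0 x1; rewrite -[x1 in RHS]mul1r -ltensor_mulrE -gS.
rewrite (raddf_tsum (h := fun u => ltensor_mulr u x1)); last by lin.
by apply: eq_tsum => y z; rewrite ltensor_mulrA.
Qed.

(** R-colinearity of [f] lets the legs of x be replaced by those of f(x), so the composite of the
    L-coaction with [f] satisfies the equation of [lcoact_unique] by [tsum_lcoact_antipode] for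
    [Y]. *)
Lemma yd_hom_is_fyd_hom (X Y : fyd HH) (f : X -> Y) :
  is_yd_hom f -> is_fyd_hom f.
Proof.
move=> fP; have [fL fl fr fa fc] := fP.
split=> // [b x|x b|x].
- by rewrite !fyd_llactE fr.
- by rewrite !fyd_lractE fl.
apply: (lcoact_unique (g := fun x => fyd_lcoact (f x))) => {x} [|x b|x].
- by lin.
- rewrite fr -[LHS]tsum_tpure (tsum_lcoact_ract (balanced_ltensor LL _)).
  done.
rewrite -tsum_lcoact_antipode.
rewrite (tsum_hom_coact (X := fyd_as_yd X) (Y := fyd_as_yd Y) (YdHom fP)
  (F := fun y0 y1 => ltensor_mulr (fyd_lcoact y0) (S y1))) //.
bal => y b h; rewrite hopf_SM hopf_StR -ltensor_mulrA; congr ltensor_mulr.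
by rewrite -[LHS]tsum_tpure (tsum_lcoact_ract (balanced_ltensor LL _)).
Qed.
End FullHoms.

(** * Tensor products of full Yetter-Drinfeld modules *)

(** Exchanging the two sides turns a bimodule over [B^c] into one over [B]. Both the tensor product
    and the unit obtain their B-bimodule axioms in this way. *)
Lemma opposite_bimodule (k : fieldType) (B : algType k) (M : lmodType k)
    (l : B^c -> M -> M) (r : M -> B^c -> M)
    (l' : B -> M -> M) (r' : M -> B -> M) :
  is_bimodule l r -> (forall b m, l' b m = r m b) ->
  (forall m b, r' m b = l b m) -> is_bimodule l' r'.
Proof.
case=> [[[ll lr] l1 lM] [[rl rr] r1 rM] lrC] l'E r'E.
split; first split.
- by split=> [b|m] c x y; rewrite !l'E; [apply: rr | apply: rl].
- by move=> m; rewrite l'E; apply: r1.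
- by move=> m a b; rewrite !l'E; apply: rM.
- split.
  + by split=> [m|b] c x y; rewrite !r'E; [apply: lr | apply: ll].
  + by move=> m; rewrite r'E; apply: l1.
  + by move=> m a b; rewrite !r'E; apply: lM.
by move=> a m b; rewrite !l'E !r'E; apply/esym/lrC.
Qed.

Section FullTensorCoaction.
Variables (k : fieldType) (B H : algType k) (HH : hopf_algebroid B H).
Variables X Y : fyd HH.
Local Notation LL := (hopfL HH).
Local Notation RR := (hopfR HH).
Local Notation s := (sL LL).
Local Notation XY := (fyd_tensor X Y).

Lemma tensor_lractE (u : XY) (b : B) : fyd_lract u b = yd_lact (b : B^c) u.
Proof. by apply: eq_tsum => x y; rewrite fyd_lractE. Qed.

Lemma tensor_llactE (b : B) (u : XY) : fyd_llact b u = yd_ract u (b : B^c).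
Proof. by apply: eq_tsum => x y; rewrite fyd_llactE. Qed.

Section Functional.
Variables (V : lmodType k) (F : XY -> H -> V).
Hypothesis Fb : balanced (@fyd_lract _ _ _ _ XY) (fun b h => s b * h) F.

Lemma balanced_tensor_lcoact1 (y : Y) (h : H) :
  balancedLM HH X (fun x p => F (x ⊗ y) (p * h)).
Proof.
bal => x b p; rewrite fyd_lractE -mulrA -(balanced_eq Fb) tensor_lractE.
by rewrite tensor_lactE.
Qed.

(* For fixed legs of [x] the sum over the legs of [y] is not balanced: moving a
   scalar through [y] produces one on [x0], which only the Takeuchi condition
   for the whole sum over [x] transfers to [x1]. *)
Lemma balanced_tensor_lcoact2 (x : X) :
  balancedLM HH Y
    (fun y q => \tsum_(x0, x1 <- fyd_lcoact x) F (x0 ⊗ y) (x1 * q)).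
Proof.
bal => y b q.
apply: (tsum_lcoact_takeuchi (balanced_tensor_lcoact1 y q) (b := b)) => x0 x1.
  by rewrite fyd_lractE tpure_ydT.
by rewrite mulrA.
Qed.

Lemma balanced_tensor_lcoact_suml (y : Y) : balancedLM HH X (fun x0 x1 =>
  \tsum_(y0, y1 <- fyd_lcoact y) F (x0 ⊗ y0) (x1 * y1)).
Proof.
have Fb1 := balanced_tensor_lcoact1.
by bal => x b p; apply: eq_tsum => y0 y1; rewrite (balanced_eq (Fb1 _ _)).
Qed.

Lemma balanced_tensor_lcoact : balancedT RR X Y (fun x y =>
  \tsum_(x0, x1 <- fyd_lcoact x) \tsum_(y0, y1 <- fyd_lcoact y)
    F (x0 ⊗ y0) (x1 * y1)).
Proof.
have Fb2 := balanced_tensor_lcoact2; have Gb := balanced_tensor_lcoact_suml.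
bal => [x c y y'|x a y].
  (* Linearity in [y] becomes visible only with the sum over the legs of [x] innermost, as this sum
     alone is balanced in the legs of [y]. *)
  rewrite 3!(tsum_exchange (fyd_lcoact x)).
  by move: c y y'; apply: linear_comp (linear_tsum (Fb2 x))
    (linear_fyd_lcoact _).
rewrite yd_actS yd_actT (tsum_lcoact_ract (Gb y)).
rewrite [in RHS]tsum_exchange (tsum_lcoact_lact (Fb2 x)) tsum_exchange.
by apply: eq_tsum => y0 y1; apply: eq_tsum => x0 x1; rewrite mulrA.
Qed.
End Functional.

Lemma linear_tensor_lcoact : linear (@fyd_lcoact _ _ _ _ XY).
Proof. exact: linear_tsum (balanced_tensor_lcoact (balanced_ltensor LL _)). Qed.

Lemma linear_tensor_lcoact_comp (U : lmodType k) (h : U -> XY) :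
  linear h -> linear (fun u => fyd_lcoact (h u)).
Proof. exact: linear_comp linear_tensor_lcoact. Qed.

Lemma tensor_lcoactE (x : X) (y : Y) : @fyd_lcoact _ _ _ _ XY (x ⊗ y) =
  \tsum_(x0, x1 <- fyd_lcoact x) \tsum_(y0, y1 <- fyd_lcoact y)
    (x0 ⊗ y0) ⊗ (x1 * y1).
Proof. exact: tsum_tpureE (balanced_tensor_lcoact (balanced_ltensor LL _)). Qed.

Lemma tsum_tensor_lcoact (V : lmodType k) (F : XY -> H -> V) (x : X) (y : Y) :
  balanced (@fyd_lract _ _ _ _ XY) (fun b h => s b * h) F ->
  tsum (@fyd_lcoact _ _ _ _ XY (x ⊗ y)) F =
  \tsum_(x0, x1 <- fyd_lcoact x) \tsum_(y0, y1 <- fyd_lcoact y)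
    F (x0 ⊗ y0) (x1 * y1).
Proof.
move=> Fb; rewrite tensor_lcoactE.
rewrite tsum_tsum //; apply: eq_tsum => x0 x1.
rewrite tsum_tsum //; apply: eq_tsum => y0 y1.
by rewrite tsum_tpureE.
Qed.
End FullTensorCoaction.

Ltac lin_ext ::= first [lin_yd | lin_hopf | lin_fyd | lin_mulr |
  apply: linear_tensor_lcoact_comp; lin].

(** * The full Yetter-Drinfeld axioms for the tensor product *)

Section FullTensor.
Variables (k : fieldType) (B H : algType k) (HH : hopf_algebroid B H).
Variables X Y : fyd HH.
Local Notation LL := (hopfL HH).
Local Notation RR := (hopfR HH).
Local Notation s := (sL LL).
Local Notation t := (tL LL).
Local Notation XY := (fyd_tensor X Y).
Local Notation lcoact := (@fyd_lcoact _ _ _ _ XY).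

Lemma tensor_lcoact_lact (b : B) (u : yd_tensor X Y) :
  lcoact (yd_lact (b : B^c) u) =
    \tsum_(u0, u1 <- lcoact u) u0 ⊗ (t b * u1).
Proof.
have Fb := balanced_ltensor LL (@fyd_lract _ _ _ _ XY).
have Gb : balanced (@fyd_lract _ _ _ _ XY) (fun b h => s b * h)
    (fun u h => u ⊗ (t b * h) : ltensor s (@fyd_lract _ _ _ _ XY)).
  by bal => v c h; rewrite (balanced_eq Fb) !mulrA sL_tL_comm.
move: u; apply: tens_ext => [||x y]; try by [lin].
rewrite tensor_lactE [LHS]tensor_lcoactE tsum_tensor_lcoact //.
rewrite (tsum_lcoact_lact (balanced_tensor_lcoact_suml Fb y)).
by apply: eq_tsum => x0 x1; apply: eq_tsum => y0 y1; rewrite mulrA.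
Qed.

Lemma tensor_lcoact_ract (u : yd_tensor X Y) (b : B) :
  lcoact (yd_ract u (b : B^c)) =
    \tsum_(u0, u1 <- lcoact u) u0 ⊗ (u1 * t b).
Proof.
have Fb := balanced_ltensor LL (@fyd_lract _ _ _ _ XY).
have Gb : balanced (@fyd_lract _ _ _ _ XY) (fun b h => s b * h)
    (fun u h => u ⊗ (h * t b) : ltensor s (@fyd_lract _ _ _ _ XY)).
  by bal => v c h; rewrite (balanced_eq Fb) !mulrA.
move: u; apply: tens_ext => [||x y]; try by [lin].
rewrite tensor_ractE [LHS]tensor_lcoactE tsum_tensor_lcoact // tsum_exchange.
rewrite (tsum_lcoact_ract (balanced_tensor_lcoact2 Fb x)) tsum_exchange.
by apply: eq_tsum => x0 x1; apply: eq_tsum => y0 y1; rewrite mulrA.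
Qed.

Lemma tensor_lcoact_takeuchi (b : B) (u : yd_tensor X Y) :
  \tsum_(u0, u1 <- lcoact u) yd_ract u0 (b : B^c) ⊗ u1 =
    \tsum_(u0, u1 <- lcoact u) u0 ⊗ (u1 * s b)
    :> ltensor s (@fyd_lract _ _ _ _ XY).
Proof.
have Fb := balanced_ltensor LL (@fyd_lract _ _ _ _ XY).
have Gb : balanced (@fyd_lract _ _ _ _ XY) (fun b h => s b * h)
    (fun u h => u ⊗ (h * s b) : ltensor s (@fyd_lract _ _ _ _ XY)).
  by bal => v c h; rewrite (balanced_eq Fb) !mulrA.
have Hb : balanced (@fyd_lract _ _ _ _ XY) (fun b h => s b * h)
    (fun (u : yd_tensor X Y) h => yd_ract u (b : B^c) ⊗ h
      : ltensor s (@fyd_lract _ _ _ _ XY)).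
  by bal => v c h; rewrite -(balanced_eq Fb) !tensor_lractE yd_ract_lact.
move: u; apply: tens_ext => [||x y]; try by [lin].
rewrite !tsum_tensor_lcoact // tsum_exchange [RHS]tsum_exchange.
apply: (tsum_lcoact_takeuchi (balanced_tensor_lcoact2 Fb x) (b := b)) => y0 y1.
  by apply: eq_tsum => x0 x1; rewrite tensor_ractE.
by apply: eq_tsum => x0 x1; rewrite mulrA.
Qed.

Lemma tensor_lcounit (u : yd_tensor X Y) :
  \tsum_(u0, u1 <- lcoact u) yd_lact (epsL LL u1 : B^c) u0 = u.
Proof.
have Fb : balanced (@fyd_lract _ _ _ _ XY) (fun b h => s b * h)
    (fun (u : yd_tensor X Y) h => yd_lact (epsL LL h : B^c) u).
  by bal => v c h; rewrite tensor_lractE epsL_sL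
    -(yd_lactM (X := tensor_yd X Y)).
move: u; apply: tens_ext => [||x y]; try by [lin].
rewrite tsum_tensor_lcoact // tsum_exchange.
transitivity (\tsum_(y0, y1 <- fyd_lcoact y) x ⊗ yd_lact (epsL LL y1 : B^c) y0
  : yd_tensor X Y); last first.
  by rewrite -(raddf_tsum (h := fun v => x ⊗ v)) ?tsum_lcoact_counit //; lin.
apply: eq_tsum => y0 y1; rewrite -tpure_ydT -{2}[x]tsum_lcoact_counit.
rewrite (raddf_tsum (h := fun v : X => yd_ract v (epsL LL y1 : B^c) ⊗ y0));
  last by lin.
have Gb : balancedLM HH X (fun z h => yd_lact (epsL LL h : B^c) z ⊗ y0 :
  yd_tensor X Y).
  by bal => z b h; rewrite (balanced_eq (balanced_lcounit X)).
(* Here eps_L(x1 y1) = eps_L(x1 s_L(eps_L(y1))), and the Takeuchi condition trades the factor on the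
   right of x1 for a right action on x0. *)
symmetry; apply: (tsum_lcoact_takeuchi Gb (b := epsL LL y1)) => x0 x1.
  by rewrite yd_ract_lact.
by rewrite tensor_lactE epsL_Ms.
Qed.

Section CoassocL.
Variables (V : lmodType k) (F : yd_tensor X Y -> H -> H -> V).
Hypothesis Fb : balanced3 (@fyd_lract _ _ _ _ XY) (fun b h => s b * h)
  (fun b h => t b * h) (fun b h => s b * h) F.

Let F1 q := balanced3_l q Fb.

Let Fl b x y p q : F (yd_lact (b : B^c) x ⊗ y) p q = F (x ⊗ y) (s b * p) q.
Proof. by rewrite -(balanced3_eq12 Fb) tensor_lractE tensor_lactE. Qed.

Let F2 u : balancedL LL (F u).
Proof. by bal => *; apply: (balanced3_eq23 Fb). Qed.

Let F_r x p q : balancedLM HH X (fun x' p' => F (x' ⊗ x) (p' * p) (q : H)).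
Proof. by bal => y b h; rewrite fyd_lractE Fl mulrA. Qed.

Let balanced3_y (y : Y) : balanced3 (@fyd_lract _ _ _ _ X)
  (fun b h => s b * h) (fun b h => t b * h) (fun b h => s b * h)
  (fun x p q => \tsum_(y0, y1 <- fyd_lcoact y)
    \tsum_(y00, y01 <- fyd_lcoact y0) F (x ⊗ y00) (p * y01) (q * y1)).
Proof.
split; cbv beta; try by [lin].
  move=> x b p q; apply: eq_tsum => y0 y1; apply: eq_tsum => y00 y01.
  by rewrite fyd_lractE Fl mulrA.
move=> x p b q; apply: eq_tsum => y0 y1; apply: eq_tsum => y00 y01.
by rewrite -!mulrA (balanced3_eq23 Fb).
Qed.

Let F2_mul u p q : balancedL LL (fun p' q' => F u (p' * p) (q' * q)).
Proof. by bal => p' b q'; rewrite -!mulrA (balanced3_eq23 Fb). Qed.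

Let balanced3_x (x : X) : balanced3 (@fyd_lract _ _ _ _ Y)
  (fun b h => s b * h) (fun b h => t b * h) (fun b h => s b * h)
  (fun y p q => \tsum_(x0, x1 <- fyd_lcoact x)
    \tsum_(x1', x1'' <- DeltaL LL x1) F (x0 ⊗ y) (x1' * p) (x1'' * q)).
Proof.
split; cbv beta; try by [lin].
  move=> y b p q.
  have Gb : balancedLM HH X (fun x0 x1 =>
     \tsum_(x1', x1'' <- DeltaL LL x1) F (x0 ⊗ y) (x1' * p) (x1'' * q)).
    bal => z c h; rewrite tsum_DeltaL_sM //; apply: eq_tsum => x1' x1''.
    by rewrite fyd_lractE Fl mulrA.
  apply: (tsum_lcoact_takeuchi Gb (b := b)) => x0 x1.
    by rewrite fyd_lractE tpure_ydT.
  rewrite tsum_DeltaL_Ms //; apply: eq_tsum => x1' x1''.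
  by rewrite mulrA.
move=> y p b q; apply: eq_tsum => x0 x1.
apply: (tsum_DeltaL_takeuchi (LL := LL) (b := b)
  (F := fun p' q' => F (x0 ⊗ y) (p' * p) (q' * q))) => // x1' x1''.
  by rewrite mulrA.
by rewrite mulrA.
Qed.

(* As Delta_L is balanced on the left, the legs of [x] are treated before those
   of [y], in the order opposite to that of [tsum_tensor_coassoc]. *)
Lemma tsum_tensor_lcoassoc (u : yd_tensor X Y) :
  \tsum_(u0, u1 <- lcoact u) \tsum_(v0, v1 <- lcoact u0) F v0 v1 u1 =
  \tsum_(u0, u1 <- lcoact u) \tsum_(p, q <- DeltaL LL u1) F u0 p q.
Proof.
have Gb : balanced (@fyd_lract _ _ _ _ XY) (fun b h => s b * h)
    (fun u0 u1 => \tsum_(v0, v1 <- lcoact u0) F v0 v1 u1).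
  bal => v b h; rewrite tensor_lractE tensor_lcoact_lact tsum_tsum //.
  apply: eq_tsum => u0 u1; rewrite tsum_tpureE //.
  exact: (balanced3_eq23 Fb).
have Hb : balanced (@fyd_lract _ _ _ _ XY) (fun b h => s b * h)
    (fun u0 u1 => \tsum_(p, q <- DeltaL LL u1) F u0 p q).
  bal => v b h; rewrite tsum_DeltaL_sM //; apply: eq_tsum => p q.
  exact: (balanced3_eq12 Fb).
move: u; apply: tens_ext => [||x y]; try by [lin].
rewrite !tsum_tensor_lcoact //.
transitivity (\tsum_(x0, x1 <- fyd_lcoact x) \tsum_(x00, x01 <- fyd_lcoact x0)
  \tsum_(y0, y1 <- fyd_lcoact y) \tsum_(y00, y01 <- fyd_lcoact y0)
    F (x00 ⊗ y00) (x01 * y01) (x1 * y1)).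
  apply: eq_tsum => x0 x1; rewrite tsum_exchange; apply: eq_tsum => y0 y1.
  by rewrite tsum_tensor_lcoact.
rewrite (tsum_lcoact_coassoc _ (balanced3_y y)).
transitivity (\tsum_(y0, y1 <- fyd_lcoact y) \tsum_(y00, y01 <- fyd_lcoact y0)
  \tsum_(x0, x1 <- fyd_lcoact x) \tsum_(x1', x1'' <- DeltaL LL x1)
    F (x0 ⊗ y00) (x1' * y01) (x1'' * y1)).
  exact: tsum_exchange4.
rewrite (tsum_lcoact_coassoc _ (balanced3_x x)) tsum_exchange4.
apply: eq_tsum => x0 x1; rewrite tsum_exchange; apply: eq_tsum => y0 y1.
by rewrite tsum_DeltaLM.
Qed.
End CoassocL.

Section MixedR.
Variables (V : lmodType k) (F : yd_tensor X Y -> H -> H -> V).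
Hypothesis Fb : balanced3 (@fyd_lract _ _ _ _ XY) (fun b h => s b * h)
  (fun a h => h * sR RR a) (fun a h => h * tR RR a) F.

Let F1 q := balanced3_l q Fb.

Let F2 u : balancedR RR (F u).
Proof. by bal => *; apply: (balanced3_eq23 Fb). Qed.

Let Fl b x y p q : F (yd_lact (b : B^c) x ⊗ y) p q = F (x ⊗ y) (s b * p) q.
Proof. by rewrite -(balanced3_eq12 Fb) tensor_lractE tensor_lactE. Qed.

Let F_r y p q : balancedLM HH X (fun x p' => F (x ⊗ y) (p' * p) (q : H)).
Proof. by bal => x b h; rewrite fyd_lractE Fl mulrA. Qed.

Let F2_mul u p q : balancedR RR (fun p' q' => F u (p * p') (q * q')).
Proof. by bal => p' b q'; rewrite !mulrA (balanced3_eq23 Fb). Qed.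

Let balanced3_y (x : X) : balanced3 (@fyd_lract _ _ _ _ Y)
  (fun b h => s b * h) (fun a h => h * sR RR a) (fun a h => h * tR RR a)
  (fun y p q => \tsum_(x0, x1 <- yd_coact x)
    \tsum_(x00, x01 <- fyd_lcoact x0) F (x00 ⊗ y) (x01 * p) (x1 * q)).
Proof.
split; cbv beta; try by [lin].
  move=> y b p q; apply: eq_tsum => x0 x1.
  apply: (tsum_lcoact_takeuchi (F_r y p (x1 * q)) (b := b)) => x00 x01.
    by rewrite fyd_lractE tpure_ydT.
  by rewrite mulrA.
move=> y p b q; apply: eq_tsum => x0 x1; apply: eq_tsum => x00 x01.
by rewrite !mulrA (balanced3_eq23 Fb).
Qed.

Let balanced3_x (y : Y) : balanced3 (@fyd_lract _ _ _ _ X)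
  (fun b h => s b * h) (fun a h => h * sR RR a) (fun a h => h * tR RR a)
  (fun x p q => \tsum_(y0, y1 <- fyd_lcoact y)
    \tsum_(y1', y1'' <- DeltaR RR y1) F (x ⊗ y0) (p * y1') (q * y1'')).
Proof.
split; cbv beta; try by [lin].
  move=> x b p q; apply: eq_tsum => y0 y1; apply: eq_tsum => y1' y1''.
  by rewrite fyd_lractE Fl mulrA.
move=> x p b q; apply: eq_tsum => y0 y1.
apply: (tsum_DeltaR_takeuchi (RR := RR) (a := b)
  (F := fun p' q' => F (x ⊗ y0) (p * p') (q * q'))) => // y1' y1''.
  by rewrite mulrA.
by rewrite mulrA.
Qed.

(** The mixed law is applied to [y] first, with the legs of [x] summed inside: a scalar on y passes
    to a leg of x, where the Takeuchi condition of the L-coaction is needed. For [x], the scalars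
    are then exchanged by the Takeuchi condition of [DeltaR] at y1. *)
Lemma tsum_tensor_mixedR (u : yd_tensor X Y) :
  \tsum_(u0, u1 <- yd_coact u) \tsum_(v0, v1 <- lcoact u0) F v0 v1 u1 =
  \tsum_(u0, u1 <- lcoact u) \tsum_(p, q <- DeltaR RR u1) F u0 p q.
Proof.
have Gb : balancedM RR (@yd_ract _ _ _ _ (yd_tensor X Y))
    (fun u0 u1 => \tsum_(v0, v1 <- lcoact u0) F v0 v1 u1).
  bal => v b h; rewrite tensor_lcoact_ract tsum_tsum //.
  apply: eq_tsum => u0 u1; rewrite tsum_tpureE // -(hopf_sR HH).
  exact: (balanced3_eq23 Fb).
have Hb : balanced (@fyd_lract _ _ _ _ XY) (fun b h => s b * h)
    (fun u0 u1 => \tsum_(p, q <- DeltaR RR u1) F u0 p q).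
  bal => v b h; rewrite tsum_DeltaR_sLM //; apply: eq_tsum => p q.
  exact: (balanced3_eq12 Fb).
move: u; apply: tens_ext => [||x y]; try by [lin].
rewrite tsum_tensor_coact // tsum_tensor_lcoact //.
transitivity (\tsum_(x0, x1 <- yd_coact x) \tsum_(x00, x01 <- fyd_lcoact x0)
  \tsum_(y0, y1 <- yd_coact y) \tsum_(y00, y01 <- fyd_lcoact y0)
    F (x00 ⊗ y00) (x01 * y01) (x1 * y1)).
  apply: eq_tsum => x0 x1; rewrite tsum_exchange; apply: eq_tsum => y0 y1.
  by rewrite tsum_tensor_lcoact.
rewrite tsum_exchange4 (tsum_mixedR _ (balanced3_y x)).
rewrite tsum_exchange4 (tsum_mixedR _ (balanced3_x y)).
apply: eq_tsum => x0 x1; rewrite tsum_exchange; apply: eq_tsum => y0 y1.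
by rewrite tsum_DeltaRM.
Qed.
End MixedR.

Section MixedL.
Variables (V : lmodType k) (F : yd_tensor X Y -> H -> H -> V).
Hypothesis Fb : balanced3 (@yd_ract _ _ _ _ (yd_tensor X Y))
  (fun a h => h * tR RR a) (fun b h => t b * h) (fun b h => s b * h) F.

Let F1 q := balanced3_l q Fb.

Let F2 u : balancedL LL (F u).
Proof. by bal => *; apply: (balanced3_eq23 Fb). Qed.

Let F_r x p q : balancedM RR (@yd_ract _ _ _ _ Y)
  (fun y p' => F (x ⊗ y) (p * p') (q : H)).
Proof.
by bal => y b h; rewrite mulrA -(balanced3_eq12 Fb) tensor_ractE.
Qed.

Let F2_mul u p q : balancedL LL (fun p' q' => F u (p' * p) (q' * q)).
Proof. by bal => p' b q'; rewrite -!mulrA (balanced3_eq23 Fb). Qed.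

Let balanced3_x (y : Y) : balanced3 (@yd_ract _ _ _ _ X)
  (fun a h => h * tR RR a) (fun b h => t b * h) (fun b h => s b * h)
  (fun x p q => \tsum_(y0, y1 <- fyd_lcoact y)
    \tsum_(y00, y01 <- yd_coact y0) F (x ⊗ y00) (p * y01) (q * y1)).
Proof.
split; cbv beta; try by [lin].
  move=> x b p q; apply: eq_tsum => y0 y1.
  apply: (tsum_coact_takeuchi (F_r x p (q * y1)) (a := b)) => y00 y01.
    by rewrite tpure_ydT.
  by rewrite mulrA.
move=> x p b q; apply: eq_tsum => y0 y1; apply: eq_tsum => y00 y01.
by rewrite -!mulrA (balanced3_eq23 Fb).
Qed.

Let balanced3_y (x : X) : balanced3 (@yd_ract _ _ _ _ Y)
  (fun a h => h * tR RR a) (fun b h => t b * h) (fun b h => s b * h)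
  (fun y p q => \tsum_(x0, x1 <- yd_coact x)
    \tsum_(x1', x1'' <- DeltaL LL x1) F (x0 ⊗ y) (x1' * p) (x1'' * q)).
Proof.
split; cbv beta; try by [lin].
  move=> y b p q; apply: eq_tsum => x0 x1; apply: eq_tsum => x1' x1''.
  by rewrite mulrA -(balanced3_eq12 Fb) tensor_ractE.
move=> y p b q; apply: eq_tsum => x0 x1.
apply: (tsum_DeltaL_takeuchi (LL := LL) (b := b)
  (F := fun p' q' => F (x0 ⊗ y) (p' * p) (q' * q))) => // x1' x1''.
  by rewrite mulrA.
by rewrite mulrA.
Qed.

(** The order is reversed here: [x] comes first, since a scalar on x passes to a leg of y and is
    carried over by the Takeuchi condition of the R-coaction. For [y], the Takeuchi condition of
    [DeltaL] at x1 is used. *)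
Lemma tsum_tensor_mixedL (u : yd_tensor X Y) :
  \tsum_(u0, u1 <- lcoact u) \tsum_(v0, v1 <- yd_coact u0) F v0 v1 u1 =
  \tsum_(u0, u1 <- yd_coact u) \tsum_(p, q <- DeltaL LL u1) F u0 p q.
Proof.
have Gb : balanced (@fyd_lract _ _ _ _ XY) (fun b h => s b * h)
    (fun (u0 : yd_tensor X Y) u1 => \tsum_(v0, v1 <- yd_coact u0) F v0 v1 u1).
  bal => v b h.
  rewrite tensor_lractE (tsum_coact_lact (X := tensor_yd X Y)) //.
  by apply: eq_tsum => v0 v1; rewrite hopf_sR (balanced3_eq23 Fb).
have Hb : balancedM RR (@yd_ract _ _ _ _ (yd_tensor X Y))
    (fun u0 u1 => \tsum_(p, q <- DeltaL LL u1) F u0 p q).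
  bal => v b h; rewrite tsum_DeltaL_MtR //; apply: eq_tsum => p q.
  exact: (balanced3_eq12 Fb).
move: u; apply: tens_ext => [||x y]; try by [lin].
rewrite tsum_tensor_coact // tsum_tensor_lcoact //.
transitivity (\tsum_(x0, x1 <- fyd_lcoact x) \tsum_(x00, x01 <- yd_coact x0)
  \tsum_(y0, y1 <- fyd_lcoact y) \tsum_(y00, y01 <- yd_coact y0)
    F (x00 ⊗ y00) (x01 * y01) (x1 * y1)).
  apply: eq_tsum => x0 x1; rewrite tsum_exchange; apply: eq_tsum => y0 y1.
  by rewrite tsum_tensor_coact.
rewrite (tsum_mixedL _ (balanced3_x y)) tsum_exchange4.
rewrite (tsum_mixedL _ (balanced3_y x)) tsum_exchange4.
apply: eq_tsum => x0 x1; rewrite tsum_exchange; apply: eq_tsum => y0 y1.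
by rewrite tsum_DeltaLM.
Qed.
End MixedL.

Lemma tensor_Lcomodule :
  is_right_Lcomodule (@fyd_llact _ _ _ _ XY) (@fyd_lcoact _ _ _ _ XY).
Proof.
split.
- apply: (opposite_bimodule (tensor_bimodule (fyd_as_yd X) (fyd_as_yd Y))).
    exact: tensor_llactE.
  exact: tensor_lractE.
- exact: linear_tensor_lcoact.
- move=> b u b'.
  rewrite tensor_llactE tensor_lractE tensor_lcoact_lact tensor_lcoact_ract.
  rewrite tsum_tsum.
    apply: eq_tsum => u0 u1; rewrite tsum_tpureE ?mulrA //.
    bal => v c h; rewrite tpure_ltensor !mulrA; congr (_ ⊗ (_ * _)).
    by rewrite sL_tL_comm.
  bal => v c h; rewrite tpure_ltensor !mulrA; congr (_ ⊗ (_ * _)).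
  by rewrite sL_tL_comm.
- move=> b u; rewrite -tensor_lcoact_takeuchi.
  by apply: eq_tsum => u0 u1; rewrite tensor_llactE.
- move=> u; rewrite -(tsum_tensor_lcoassoc (balanced3_ltensor LL _)).
  by apply: eq_tsum => u0 u1; rewrite tpure_tsum.
move=> u; rewrite -[RHS]tensor_lcounit.
by apply: eq_tsum => u0 u1; rewrite tensor_lractE.
Qed.

Lemma tensor_is_fyd : is_fyd XY.
Proof.
split; first exact: (tensor_is_yd (fyd_as_yd X) (fyd_as_yd Y)).
split.
- exact: (tensor_coact_comodule (fyd_as_yd X) (fyd_as_yd Y)).
- exact: tensor_Lcomodule.
- move=> u a; rewrite [LHS]tensor_lcoact_ract.
  by apply: eq_tsum => u0 u1; rewrite hopf_sR.
- move=> u b; rewrite tensor_lractE [LHS](yd_coact_lact (X := tensor_yd X Y)).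
  by apply: eq_tsum => u0 u1; rewrite hopf_sR.
- move=> u; rewrite -[LHS]tsum_tensor_mixedR.
    by apply: eq_tsum => u0 u1; rewrite tpure_tsum.
  by apply: balanced3_tpure => [*|*]; [lin | rewrite /= !mulrA].
move=> u; rewrite -[LHS]tsum_tensor_mixedL.
  by apply: eq_tsum => u0 u1; rewrite tpure_tsum.
by apply: balanced3_tpure => [*|*]; [lin | rewrite /= !mulrA].
Qed.
End FullTensor.

(** * The unit object of the full category *)

Section FullUnit.
Variables (k : fieldType) (B H : algType k) (HH : hopf_algebroid B H).
Local Notation LL := (hopfL HH).
Local Notation RR := (hopfR HH).
Local Notation s := (sL LL).
Local Notation t := (tL LL).
Local Notation I := (fyd_unit HH).

Lemma unit_Lcomodule :
  is_right_Lcomodule (@fyd_llact _ _ _ _ I) (@fyd_lcoact _ _ _ _ I).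
Proof.
have Tb := balanced_ltensor LL (@fyd_lract _ _ _ _ I).
have T3 := balanced3_ltensor LL (@fyd_lract _ _ _ _ I).
have F2 u : balancedL LL (fun p q => (u ⊗ p) ⊗ q
    : ltensor s (ltensor_ract (s := s) t (r := @fyd_lract _ _ _ _ I))).
  by bal => *; apply: (balanced3_eq23 T3).
split.
- exact: (opposite_bimodule (Rcom_bimodule (yd_comodule (unit_is_yd RR)))).
- by move=> c x y /=; rewrite linearP tpureDr tpureZr.
- move=> b x b' /=; rewrite tsum_tpureE; first by rewrite !tLM mulrA.
  bal => y c h; rewrite tpure_ltensor !mulrA; congr (_ ⊗ (_ * _)).
  by rewrite sL_tL_comm.
- move=> b x /=; rewrite !tsum_tpureE.
  + rewrite mulr1 -sL_tL_comm -tpure_ltensor /=.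
    by rewrite mul1r.
  + by bal => y c h; rewrite tpure_ltensor mulrA.
  + bal => [h|y c h]; last by rewrite /= mulrA; apply: tpure_ltensor.
    apply: linear_tpurel.
    (* The product is that of [B] although the unit object is typed over [B^c], so the algebra is
       given explicitly. *)
    exact: (linear_mulr (b : B) (linear_id (U := B))).
- move=> x /=; rewrite !tsum_tpureE.
  + by rewrite tL1 DeltaL_t tsum_tpureE.
  + bal => y c h; rewrite tsum_DeltaL_sM //; apply: eq_tsum => p q.
    exact: (balanced3_eq12 T3).
  + bal => y c h; rewrite /= tLM.
    exact: (balanced3_eq23 T3).
move=> x /=; rewrite tsum_tpureE ?epsL_t ?mul1r //.
split=> [h|y|y c h] /=; last by rewrite epsL_sL mulrA.
- exact: (linear_mull (epsL LL h) (linear_id (U := B))).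
exact: (linear_mulr (y : B) (linear_linear (epsL LL) (linear_id (U := H)))).
Qed.

Lemma unit_is_fyd : is_fyd I.
Proof.
split; first exact: unit_is_yd.
split.
- exact: (yd_comodule (unit_is_yd RR)).
- exact: unit_Lcomodule.
- move=> x a /=; rewrite tsum_tpureE.
    by rewrite hopf_sR -tLM.
  by bal => y c h; rewrite tpure_ltensor mulrA.
- move=> x b /=; rewrite tsum_tpureE.
    by rewrite -hopf_sR -rmorphM.
  by bal => y c h; rewrite tpure_rtensor mulrA.
- move=> x.
  have cL (a : B^c) : linear (fun h : H => h * sR RR a) by lin.
  have cs (b : B) (a : B^c) (h : H) : s b * h * sR RR a = s b * (h * sR RR a).
    by rewrite mulrA.
  have T3 := balanced3_tpure (@fyd_lract _ _ _ _ I)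
    (fun (a : B^c) (h : H) => h * tR RR a) cL cs.
  have F2 u : balancedR RR (fun p q => (u ⊗ p) ⊗ q
      : tens (fun (u : ltensor s (@fyd_lract _ _ _ _ I)) (a : B^c) =>
          \tsum_(m, h <- u) m ⊗ (h * sR RR a)) (fun a h => h * tR RR a)).
    by bal => *; apply: (balanced3_eq23 T3).
  rewrite /= !tsum_tpureE.
  + by rewrite tL1 -(hopf_sR HH x) DeltaR_s tsum_tpureE.
  + bal => y c h; rewrite /= tLM -(hopf_sR HH c).
    exact: (balanced3_eq23 T3).
  + bal => y c h; rewrite tsum_DeltaR_sLM //; apply: eq_tsum => p q.
    exact: (balanced3_eq12 T3).
move=> x.
have cL (b : B) : linear (fun h : H => t b * h) by lin.
have ct (a : B^c) (b : B) (h : H) : t b * (h * tR RR a) = t b * h * tR RR a.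
  by rewrite mulrA.
have T3 := balanced3_tpure (@yd_ract _ _ _ _ I)
  (fun (b : B) (h : H) => s b * h) cL ct.
have F2 u : balancedL LL (fun p q => (u ⊗ p) ⊗ q
    : tens (fun (u : rtensor (tR RR) (@yd_ract _ _ _ _ I)) (b : B) =>
        \tsum_(m, h <- u) m ⊗ (t b * h)) (fun b h => s b * h)).
  by bal => *; apply: (balanced3_eq23 T3).
rewrite /= !tsum_tpureE.
- by rewrite sR1 hopf_sR DeltaL_t tsum_tpureE.
- bal => y c h; rewrite /= hopf_sR tLM -(hopf_sR HH y).
  exact: (balanced3_eq23 T3).
bal => y c h; rewrite tsum_DeltaL_MtR //; apply: eq_tsum => p q.
exact: (balanced3_eq12 T3).
Qed.
End FullUnit.

(** * The braiding of full Yetter-Drinfeld modules *)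

Section BraidingInverse.
Variables (k : fieldType) (B H : algType k) (HH : hopf_algebroid B H).
Variables X Y : fyd HH.
Local Notation RR := (hopfR HH).
Local Notation S' := (antipodeV HH).

Definition braidV_map (u : yd_tensor Y X) : yd_tensor X Y :=
  \tsum_(y, x <- u) \tsum_(y0, y1 <- fyd_lcoact y) yd_act x (S' y1) ⊗ y0.

Let braidV_inner (x : X) : balancedLM HH Y
  (fun y h => yd_act x (S' h) ⊗ y : yd_tensor X Y).
Proof.
bal => y b h; rewrite fyd_lractE -tpure_ydT -yd_actS hopf_S'M hopf_S's.
by rewrite -yd_actM (hopf_sR HH).
Qed.

Let braidV_outer : balancedT RR Y X (fun y x =>
  \tsum_(y0, y1 <- fyd_lcoact y) yd_act x (S' y1) ⊗ y0 : yd_tensor X Y).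
Proof.
have Fb := braidV_inner.
bal => y b x; rewrite yd_actS tsum_lcoact_ract //.
by apply: eq_tsum => y0 y1; rewrite hopf_S'M hopf_S't yd_actM.
Qed.

Lemma braidV_mapE (x : X) (y : Y) : braidV_map (y ⊗ x) =
  \tsum_(y0, y1 <- fyd_lcoact y) yd_act x (S' y1) ⊗ y0.
Proof. exact: tsum_tpureE braidV_outer. Qed.

Lemma linear_braidV_map : linear braidV_map.
Proof. exact: linear_tsum braidV_outer. Qed.

Local Notation braid := (@braid_map _ _ _ RR (fyd_as_yd X) (fyd_as_yd Y)).

(** The first mixed law brings S^-1 and the leg it cancels into a single [DeltaR], where h2 S^-1(h1)
    = t_L(eps_L(h)). This scalar moves from x to the remaining leg of y and disappears by the counit
    of the L-coaction. *)
Lemma braid_mapK : cancel braid braidV_map.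
Proof.
have bL : linear braid := @linear_braid_map _ _ _ RR (fyd_as_yd X)
  (fyd_as_yd Y).
have bVL := linear_braidV_map.
apply: tens_ext => [||x y]; try by [lin].
rewrite (@braid_mapE _ _ _ RR (fyd_as_yd X) (fyd_as_yd Y)).
rewrite (raddf_tsum _ _ bVL).
transitivity (\tsum_(y0, y1 <- yd_coact y) \tsum_(n, p <- fyd_lcoact y0)
  yd_act x (y1 * S' p) ⊗ n : yd_tensor X Y).
  apply: eq_tsum => y0 y1; rewrite braidV_mapE.
  by apply: eq_tsum => n p; rewrite yd_actM.
rewrite (tsum_mixedR (F := fun n p q => yd_act x (q * S' p) ⊗ n : yd_tensor X
  Y)).
  rewrite -[y in RHS]tsum_lcoact_counit (raddf_tsum (h := fun y => x ⊗ y)).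
    apply: eq_tsum => y0 y1.
    rewrite -(raddf_tsum (h := fun h => yd_act x h ⊗ y0)); last by lin.
    by rewrite tsum_antipodeV_r -tpure_ydT -yd_actS hopf_sR.
  by lin.
split; cbv beta; try by [lin].
  move=> n b p q; rewrite fyd_lractE -tpure_ydT -yd_actS -yd_actM.
  by rewrite hopf_S'M hopf_S's -mulrA (hopf_sR HH).
by move=> n p b q; rewrite hopf_S'M hopf_sR hopf_S't mulrA.
Qed.

(** As in [braid_mapK], but with the other mixed law, the identity S^-1(h2) h1 = t_R(eps_R(h)) for
    [DeltaL], and the counit of the R-coaction. *)
Lemma braidV_mapK : cancel braidV_map braid.
Proof.
have bL : linear braid := @linear_braid_map _ _ _ RR (fyd_as_yd X)
  (fyd_as_yd Y).
have bVL := linear_braidV_map.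
apply: tens_ext => [||y x]; try by [lin].
rewrite braidV_mapE (raddf_tsum _ _ bL).
transitivity (\tsum_(y0, y1 <- fyd_lcoact y) \tsum_(n, p <- yd_coact y0)
  n ⊗ yd_act x (S' y1 * p) : yd_tensor Y X).
  apply: eq_tsum => y0 y1.
  rewrite (@braid_mapE _ _ _ RR (fyd_as_yd X) (fyd_as_yd Y)).
  by apply: eq_tsum => n p; rewrite yd_actM.
rewrite (tsum_mixedL (F := fun n p q => n ⊗ yd_act x (S' q * p) : yd_tensor Y
  X)).
  rewrite -[y in RHS]tsum_coact_counit (raddf_tsum (h := fun y => y ⊗ x)).
    apply: eq_tsum => y0 y1.
    rewrite -(raddf_tsum (h := fun h => y0 ⊗ yd_act x h)); last by lin.
    by rewrite tsum_antipodeV_l tpure_ydT yd_actT.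
  by lin.
split; cbv beta; try by [lin].
  by move=> n b p q; rewrite tpure_ydT -yd_actT -yd_actM mulrA.
by move=> n p b q; rewrite hopf_S'M hopf_S's mulrA.
Qed.
End BraidingInverse.

(** * Monoidal structure and braiding of the full category *)

Section FullMonoidal.
Variables (k : fieldType) (B H : algType k) (HH : hopf_algebroid B H).
Local Notation RR := (hopfR HH).
Local Notation yd X := (fyd_as_yd X).

Definition fyd_lift (X Y : fyd HH) (f : yd_hom X Y) : fyd_hom X Y :=
  FydHom (yd_hom_is_fyd_hom (yd_funP f)).

Definition fyd_forget (X Y : fyd HH) (f : fyd_hom X Y) : yd_hom X Y :=
  YdHom (fydh_yd (fyd_funP f)).

Definition tensor_fyd (X Y : fyd HH) : fyd HH := Fyd (tensor_is_fyd X Y).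
Definition unit_fyd : fyd HH := Fyd (unit_is_fyd HH).

Lemma yd_hom_eq1 (X Y : yd_data RR) (f g : yd_hom X Y) : f = g -> f =1 g.
Proof. by move=> ->. Qed.

(** The tensor product and unit of full modules have those of Yetter-Drinfeld modules as underlying
    data, by conversion, and morphisms are determined by their functions. Each axiom is therefore
    the axiom of [yd_monoidal] read pointwise. *)
Definition fyd_monoidal :
  monoidal (C := FYD HH) (fun X Y => Fyd (tensor_is_fyd X Y))
    (Fyd (unit_is_fyd HH)).
Proof.
apply: (@Monoidal (FYD HH) _ _
  (fun X X' Y Y' f g => @fyd_lift (tensor_fyd X Y) (tensor_fyd X' Y')
     (@tensor_hom _ _ _ _ (yd X) (yd X') (yd Y) (yd Y') (fyd_forget f)
       (fyd_forget g)))
  (fun X Y Z => @fyd_lift (tensor_fyd (tensor_fyd X Y) Z)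
     (tensor_fyd X (tensor_fyd Y Z)) (assoc_hom (yd X) (yd Y) (yd Z)))
  (fun X Y Z => @fyd_lift (tensor_fyd X (tensor_fyd Y Z))
     (tensor_fyd (tensor_fyd X Y) Z) (assocV_hom (yd X) (yd Y) (yd Z)))
  (fun X => @fyd_lift (tensor_fyd unit_fyd X) X (lunit_hom (yd X)))
  (fun X => @fyd_lift X (tensor_fyd unit_fyd X) (lunitV_hom (yd X)))
  (fun X => @fyd_lift (tensor_fyd X unit_fyd) X (runit_hom (yd X)))
  (fun X => @fyd_lift X (tensor_fyd X unit_fyd) (runitV_hom (yd X)))).
- move=> X Y; apply: fyd_hom_eq; exact: (yd_hom_eq1
    (tenh_id (yd_monoidal RR) (yd X) (yd Y))).
- move=> X X' X'' Y Y' Y'' f' f g' g.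
  apply: fyd_hom_eq; exact: (yd_hom_eq1 (@tenh_comp _ _ _ (yd_monoidal RR)
    (yd X) (yd X') (yd X'')
    (yd Y) (yd Y') (yd Y'') (fyd_forget f') (fyd_forget f) (fyd_forget g')
      (fyd_forget g))).
- move=> X Y Z; case: (assoc_iso (yd_monoidal RR) (yd X) (yd Y) (yd Z)) => e e'.
  by split; apply: fyd_hom_eq; [exact: (yd_hom_eq1 e) | exact: (yd_hom_eq1 e')].
- move=> X X' Y Y' Z Z' f g h.
  apply: fyd_hom_eq; exact: (yd_hom_eq1 (@assoc_nat _ _ _ (yd_monoidal RR)
    (yd X) (yd X') (yd Y) (yd Y')
    (yd Z) (yd Z') (fyd_forget f) (fyd_forget g) (fyd_forget h))).
- move=> X; case: (lunit_iso (yd_monoidal RR) (yd X)) => e e'.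
  by split; apply: fyd_hom_eq; [exact: (yd_hom_eq1 e) | exact: (yd_hom_eq1 e')].
- move=> X Y f.
  apply: fyd_hom_eq; exact: (yd_hom_eq1 (@lunit_nat _ _ _ (yd_monoidal RR)
    (yd X) (yd Y) (fyd_forget f))).
- move=> X; case: (runit_iso (yd_monoidal RR) (yd X)) => e e'.
  by split; apply: fyd_hom_eq; [exact: (yd_hom_eq1 e) | exact: (yd_hom_eq1 e')].
- move=> X Y f.
  apply: fyd_hom_eq; exact: (yd_hom_eq1 (@runit_nat _ _ _ (yd_monoidal RR)
    (yd X) (yd Y) (fyd_forget f))).
- move=> W X Y Z.
  apply: fyd_hom_eq; exact: (yd_hom_eq1 (pentagon (yd_monoidal RR) (yd W) (yd X)
    (yd Y) (yd Z))).
move=> X Y; apply: fyd_hom_eq; exact: (yd_hom_eq1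
  (triangle (yd_monoidal RR) (yd X) (yd Y))).
Defined.

Lemma fyd_monoidal_canonical : fyd_canonical fyd_monoidal.
Proof.
split=> [X X' Y Y' f g x y|X Y Z x y z|X a x|X x a].
- exact: (tensor_homE (X := yd X) (X' := yd X') (Y := yd Y) (Y' := yd Y')
    (fyd_forget f) (fyd_forget g)).
- exact: (assoc_homE (X := yd X) (Y := yd Y) (Z := yd Z)).
- exact: (lunit_homE (X := yd X)).
- exact: (runit_homE (X := yd X)).
Qed.

Definition fyd_braid (X Y : fyd HH) : fyd_hom (tensor_fyd X Y) (tensor_fyd Y X)
  :=
  fyd_lift (X := tensor_fyd X Y) (Y := tensor_fyd Y X)
    (braid_hom (yd X) (yd Y)).

Lemma fyd_prebraiding : is_prebraiding fyd_monoidal fyd_braid.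
Proof.
have P := yd_prebraiding RR.
split.
- move=> X X' Y Y' f g; apply: fyd_hom_eq.
  exact: (yd_hom_eq1 (@braid_nat _ _ _ _ _ P (yd X) (yd X') (yd Y) (yd Y')
    (fyd_forget f) (fyd_forget g))).
- move=> X Y Z; apply: fyd_hom_eq.
  exact: (yd_hom_eq1 (braid_hexagon1 P (yd X) (yd Y) (yd Z))).
- move=> X Y Z; apply: fyd_hom_eq.
  exact: (yd_hom_eq1 (braid_hexagon2 P (yd X) (yd Y) (yd Z))).
- move=> X; apply: fyd_hom_eq; exact: (yd_hom_eq1 (braid_lunit P (yd X))).
- move=> X; apply: fyd_hom_eq; exact: (yd_hom_eq1 (braid_runit P (yd X))).
Qed.

(** The formula with S^-1 enters only as an inverse map: [yd_hom_inverse] makes it a Yetter-Drinfeld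
    morphism, and [fyd_lift] supplies L-colinearity. *)
Lemma fyd_braid_inverse (X Y : fyd HH) :
  exists brV : fyd_hom (tensor_fyd Y X) (tensor_fyd X Y),
    inverses (C := FYD HH) (fyd_braid X Y) brV.
Proof.
have bK := @braid_mapK _ _ _ _ X Y; have bVK := @braidV_mapK _ _ _ _ X Y.
have VP := yd_hom_inverse (f := braid_hom (yd X) (yd Y)) bK bVK.
exists (fyd_lift (X := tensor_fyd Y X) (Y := tensor_fyd X Y) (YdHom VP)).
by split; apply: fyd_hom_eq; [exact: bK | exact: bVK].
Qed.
End FullMonoidal.

Theorem theorem4p3 (k : fieldType) :
  (forall (A R : algType k) (RR : right_bialgebroid A R),
     exists (T_yd : forall X Y : yd RR, is_yd (yd_tensor X Y))
            (I_yd : is_yd (yd_unit RR))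
            (M : monoidal (C := YD RR) (fun X Y => Yd (T_yd X Y)) (Yd I_yd)),
       yd_canonical M /\ pre_braided M)
  /\
  (forall (B H : algType k) (HH : hopf_algebroid B H),
     exists (T_fyd : forall X Y : fyd HH, is_fyd (fyd_tensor X Y))
            (I_fyd : is_fyd (fyd_unit HH))
            (M : monoidal (C := FYD HH) (fun X Y => Fyd (T_fyd X Y))
                   (Fyd I_fyd)),
       fyd_canonical M /\ braided M).
Proof.
split=> [A R RR|B H HH].
  exists (@tensor_is_yd _ _ _ RR), (unit_is_yd RR), (yd_monoidal RR).
  split; first exact: yd_monoidal_canonical.
  by exists (fun X Y => braid_hom X Y); exact: yd_prebraiding.
exists (@tensor_is_fyd _ _ _ HH), (unit_is_fyd HH), (fyd_monoidal HH).
split; first exact: fyd_monoidal_canonical.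
exists (@fyd_braid _ _ _ HH).
by split; [exact: fyd_prebraiding | exact: fyd_braid_inverse].
Qed.
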